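(* Consider the setting described in the context, assume A1–A5, and let $s=\frac{r}{2-4r}$. A sequence of alternatives $f_n$ with $cn^{-r}\le\|f_n\|\le Cn^{-r}$ (constants $0<c<C$) is consistent if and only if there exist $P_0>0$, constants $0<c_1\le C_1$ and a sequence $f_{1n}\in\bar{\mathbb{B}}^s_{2\infty}(P_0)$ with $c_1n^{-r}\le\|f_{1n}\|\le C_1n^{-r}$ such that $$\|f_n\|^2=\|f_{1n}\|^2+\|f_n-f_{1n}\|^2 .$$
   Context: Fix $\sigma>0$, $0<r<1/2$ and an orthonormal basis $(\phi_j)_{j\ge1}$ of $\mathbb{L}_2(0,1)$. For each $n$ one observes $dY_n(t)=f(t)\,dt+\sigma n^{-1/2}dw(t)$, equivalently $y_j=\theta_j+\sigma n^{-1/2}\xi_j$, $\theta_j=\int_0^1f\phi_j$, $\xi_j$ i.i.d. $N(0,1)$; $H_0:f=0$. Weights $\kappa_{nj}^2\ge0$, $\rho_n=\sum_j\kappa_{nj}^2$, $T_n(Y_n)=\sum_j\kappa_{nj}^2y_j^2-\sigma^2n^{-1}\rho_n$, $k_n=\sup\{k:\sum_{j<k}\kappa_{nj}^2\le\rho_n/2\}$, $\kappa_n^2=\kappa_{nk_n}^2$. Assumptions: (A1) $j\mapsto\kappa_{nj}^2$ decreasing; (A2) $C_1<\sigma^{-4}n^2\sum_j\kappa_{nj}^4<C_2$; (A3) $c_1n^{-2r}\le\rho_n\le c_2n^{-2r}$; (A4) $\exists C_1>0,\lambda>1$: $\kappa^2_{n,[(1+\delta)k_n]}<C_1(1+\delta)^{-\lambda}\kappa_n^2$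 for all $\delta>0,n$; (A5) $\kappa_{n1}^2\asymp\kappa_n^2$ and for each $c>1$ there is $C>0$ with $\kappa^2_{n,[ck_n]}\ge C\kappa_n^2$. A test generated by $T_n$ rejects $H_0$ iff $T_n$ exceeds a threshold. A sequence $f_n$ is consistent if for every $\alpha\in(0,1)$ and every sequence of tests $K_n$ generated by $T_n$ with $\alpha(K_n)=\alpha(1+o(1))$, $\limsup_n\beta(K_n,f_n)<1-\alpha$ ($\alpha(\cdot)$, $\beta(\cdot,f)$: type I and type II error probabilities). $\bar{\mathbb{B}}^s_{2\infty}(P_0)=\{f=\sum_j\theta_j\phi_j:\ \sup_{\lambda>0}\lambda^{2s}\sum_{j>\lambda}\theta_j^2\le P_0\}$. *)

(* Defs.v *)
From HB Require Import structures.
From mathcomp Require Import all_boot all_order all_algebra.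
From mathcomp Require Import all_classical all_reals all_analysis.
Set Implicit Arguments. Unset Strict Implicit. Unset Printing Implicit Defensive.
Import Order.TTheory GRing.Theory Num.Theory.
Import numFieldNormedType.Exports.
Local Open Scope classical_set_scope.
Local Open Scope ring_scope.

Section Defs.
Variable R : realType.

Definition rsum1 (a : nat -> R) : R := limn (fun N => \sum_(1 <= j < N) a j).

Definition esum1 (a : nat -> R) : \bar R := (\sum_(1 <= j <oo) (a j)%:E)%E.

Definition I01 : set R := `[(0:R), 1]%classic.

Definition L2 (f : R -> R) : Prop :=
  measurable_fun I01 f /\
  lebesgue_measure.-integrable I01 (fun x => ((f x) ^+ 2)%:E).

Definition ip (f g : R -> R) : R := Rintegral lebesgue_measure I01 (fun x => f x * g x).

Definition L2norm (f : R -> R) : R := Num.sqrt (ip f f).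

(* orthonormal basis (phi_j)_{j>=1} of L2(0,1) (phi 0 is unused) *)
Definition ONB (phi : nat -> R -> R) : Prop :=
  (forall j, (1 <= j)%N -> L2 (phi j)) /\
  (forall i j, (1 <= i)%N -> (1 <= j)%N -> ip (phi i) (phi j) = (i == j)%:R) /\
  (forall f, L2 f -> (forall j, (1 <= j)%N -> ip f (phi j) = 0) ->
     lebesgue_measure.-negligible (I01 `&` [set x | f x != 0])).

Definition coef (phi : nat -> R -> R) (f : R -> R) (j : nat) : R := ip f (phi j).

Definition besov_ball (phi : nat -> R -> R) (s P0 : R) (f : R -> R) : Prop :=
  forall lam : R, 0 < lam ->
    ((lam `^ (2 * s))%:E *
       (\sum_(1 <= j <oo | (lam < j%:R)%R) ((coef phi f j) ^+ 2)%:E) <= P0%:E)%E.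

(* ---------- weights: kappa n j stands for kappa_{nj}^2 ---------- *)
Definition rhoE (kap : nat -> nat -> R) (n : nat) : \bar R := esum1 (kap n).
Definition rho (kap : nat -> nat -> R) (n : nat) : R := fine (rhoE kap n).

Definition kn_prop (kap : nat -> nat -> R) (n k : nat) : Prop :=
  \sum_(1 <= j < k) kap n j <= rho kap n / 2.
Definition kn (kap : nat -> nat -> R) (n : nat) : nat :=
  xget 0%N [set k | kn_prop kap n k /\ forall m, kn_prop kap n m -> (m <= k)%N].
Definition kapn (kap : nat -> nat -> R) (n : nat) : R := kap n (kn kap n).

Definition A1 (kap : nat -> nat -> R) : Prop :=
  forall n j, (1 <= n)%N -> (1 <= j)%N -> kap n j.+1 <= kap n j.

Definition A2 (sigma : R) (kap : nat -> nat -> R) : Prop :=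
  exists C1 C2 : R, 0 < C1 /\ forall n, (1 <= n)%N ->
    (C1%:E < (sigma ^- 4 * n%:R ^+ 2)%:E * esum1 (fun j => (kap n j ^+ 2)%R))%E /\
    ((sigma ^- 4 * n%:R ^+ 2)%:E * esum1 (fun j => (kap n j ^+ 2)%R) < C2%:E)%E.

Definition A3 (r : R) (kap : nat -> nat -> R) : Prop :=
  exists c1 c2 : R, 0 < c1 /\ 0 < c2 /\ forall n, (1 <= n)%N ->
    ((c1 * n%:R `^ (- (2 * r)))%:E <= rhoE kap n)%E /\
    (rhoE kap n <= (c2 * n%:R `^ (- (2 * r)))%:E)%E.

Definition A4 (kap : nat -> nat -> R) : Prop :=
  exists C1 lam : R, 0 < C1 /\ 1 < lam /\ forall (delta : R) n, 0 < delta -> (1 <= n)%N ->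
    kap n (Num.truncn ((1 + delta) * (kn kap n)%:R))
      < C1 * (1 + delta) `^ (- lam) * kapn kap n.

Definition A5 (kap : nat -> nat -> R) : Prop :=
  (exists a b : R, 0 < a /\ 0 < b /\ forall n, (1 <= n)%N ->
      a * kapn kap n <= kap n 1%N /\ kap n 1%N <= b * kapn kap n) /\
  (forall c : R, 1 < c -> exists C : R, 0 < C /\ forall n, (1 <= n)%N ->
      kap n (Num.truncn (c * (kn kap n)%:R)) >= C * kapn kap n).

Section Model.
Context d (Omega : measurableType d) (P : probability Omega R).

Definition iid_std_normal (xi : nat -> Omega -> R) : Prop :=
  (forall j, measurable_fun setT (xi j)) /\
  (forall j (B : set R), measurable B -> P (xi j @^-1` B) = normal_prob 0 1 B) /\
  (forall (J : seq nat) (B : nat -> set R), uniq J -> (forall j, measurable (B j)) ->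
     P (\big[setI/setT]_(j <- J) (xi j @^-1` B j)) =
     (\prod_(j <- J) P (xi j @^-1` B j))%E).

Definition obs (xi : nat -> Omega -> R) (sigma : R) (n : nat) (theta : nat -> R)
    (w : Omega) (j : nat) : R :=
  theta j + sigma * n%:R `^ (- (1/2)) * xi j w.

Definition Tstat (xi : nat -> Omega -> R) (sigma : R) (kap : nat -> nat -> R) (n : nat)
    (theta : nat -> R) (w : Omega) : R :=
  rsum1 (fun j => kap n j * (obs xi sigma n theta w j) ^+ 2)
  - sigma ^+ 2 * n%:R^-1 * rho kap n.

(* test K_n rejecting H0 iff T_n > t : type I and type II error probabilities *)
Definition alpha_err xi sigma kap n (t : R) : R :=
  fine (P [set w | t < Tstat xi sigma kap n (fun _ => 0) w]).
Definition beta_err xi sigma kap n (t : R) (theta : nat -> R) : R :=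
  fine (P [set w | Tstat xi sigma kap n theta w <= t]).

Definition consistent xi sigma kap (phi : nat -> R -> R) (f : nat -> R -> R) : Prop :=
  forall (alpha : R) (t : nat -> R), 0 < alpha < 1 ->
    (fun n => alpha_err xi sigma kap n (t n) / alpha) @ \oo --> (1:R) ->
    limn_sup (fun n => beta_err xi sigma kap n (t n) (coef phi (f n))) < 1 - alpha.

End Model.
End Defs.

(* Main.v *)
(** Write [theta_n] for the coefficients of [f_n] and
    [A_n = sum_j kappa_nj^2 theta_nj^2].  Then [n^2 T_n] splits into a centred
    quadratic form in the noise, the shift [n^2 A_n], and a linear form whose
    variance tends to 0.  A Lindeberg replacement against the heat kernel shows
    that the law of the quadratic form spreads over the line without
    concentrating on small intervals, uniformly in [n]; hence the type II error
    stays below [1 - alpha] in the limit exactly when [n^2 A_n] stays bounded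
    away from 0.  As the weights are of constant order up to [k_n ~ n^(2-4r)]
    and decay faster than [1/j] beyond, this means that [f_n] carries norm of
    order [n^(-r)] on its first [O(k_n)] coefficients.  The truncation to these
    coefficients is the required [f_1n]; conversely, Parseval's identity and
    the tail bound of the Besov ball show that an orthogonal component [f_1n]
    forces this. *)
Require Import Defs.
From HB Require Import structures.
From mathcomp Require Import all_boot all_order all_algebra.
From mathcomp Require Import all_classical all_reals all_analysis.
From mathcomp Require Import measurable_realfun.
From mathcomp Require Import ring lra.
Set Implicit Arguments.
Unset Strict Implicit.
Unset Printing Implicit Defensive.
Import Order.TTheory GRing.Theory Num.Theory.
Import numFieldNormedType.Exports.
Local Open Scope classical_set_scope.
Local Open Scope ring_scope.

(** * Taylor estimates for the heat kernel *)

Section HeatKernel.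
Variable R : realType.
Implicit Types (f df : R -> R) (x y u v s t B : R).

(** The weights change with n and the variance of the quadratic form is only pinned between two
    constants, so no single limit law is available. Two estimates replace it, uniform over all forms
    with variance in a fixed range and small coefficients: an upper bound for the mass of short
    intervals and a lower bound for the mass of intervals with bounded centre. The heat kernel is
    the test function because averaging it over an independent Gaussian increment only raises its
    variance parameter. Each replacement step trades one summand for variance, and no Gaussian
    companion variables are introduced. The error is governed by the largest coefficient, of order
    n^(2r-1), which tends to 0 because r < 1/2. Consistency quantifies over tests of asymptotically
    exact level, so exploiting it means exhibiting one, although the law of T_n could a priori have
    atoms. The upper bound on short intervals makes a near-median threshold have asymptotic level
    1/2. *)

Lemma MVT_norm_bound f df x y B :
  (forall u, Num.min x y <= u <= Num.max x y -> is_derive u 1 f (df u)) ->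
  (forall u, Num.min x y <= u <= Num.max x y -> `|df u| <= B) ->
  `|f y - f x| <= B * `|y - x|.
Proof.
wlog xy : x y / x <= y => [H|].
  case/orP: (le_total x y) => [xy|yx] df_ dfB; first exact: H.
  rewrite distrC (distrC y).
  by apply: H => // u; rewrite minC maxC; [apply: df_|apply: dfB].
rewrite (min_l xy) (max_r xy) => df_ dfB.
have cf : {within `[x, y], continuous f}.
  apply: derivable_within_continuous => z; rewrite in_itv/= => zxy.
  by have [] := df_ z zxy.
have [z|c] := @MVT_segment _ f df _ _ xy _ cf.
  rewrite in_itv/= => /andP[xz zy]; apply: df_; lra.
by rewrite in_itv/= => cxy ->; rewrite normrM ler_wpM2r ?normr_ge0 ?dfB.
Qed.

Lemma minmax_dist x y u : Num.min x y <= u <= Num.max x y -> `|u - x| <= `|y - x|.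
Proof.
case/orP: (le_total x y) => xy.
  rewrite (min_l xy) (max_r xy) => /andP[xu uy].
  by rewrite !ger0_norm; lra.
rewrite (min_r xy) (max_l xy) => /andP[yu ux].
by rewrite !ler0_norm; lra.
Qed.

Lemma minmax_trans x y u z : Num.min x y <= u <= Num.max x y ->
  Num.min x u <= z <= Num.max x u -> Num.min x y <= z <= Num.max x y.
Proof.
rewrite !ge_min !le_max.
by case: (leP x u); case: (leP y u); case: (leP u x); case: (leP u y);
   case: (leP x z); case: (leP y z); case: (leP z x); case: (leP z y); case: (leP u z);
   case: (leP z u) => //=; lra.
Qed.

(** The mean value bound is applied twice, which costs the factor 1/2 of the sharp constant. The
    hypotheses are local, on the segment between x and y, because the kernel is differentiated in
    its variance parameter only where that parameter is positive. *)
Lemma taylor2_norm_bound f f1 f2 x y B :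
  (forall u, Num.min x y <= u <= Num.max x y -> is_derive u 1 f (f1 u)) ->
  (forall u, Num.min x y <= u <= Num.max x y -> is_derive u 1 f1 (f2 u)) ->
  (forall u, Num.min x y <= u <= Num.max x y -> `|f2 u| <= B) ->
  `|f y - f x - (y - x) * f1 x| <= B * (y - x) ^+ 2.
Proof.
move=> d1 d2 b2.
have B0 : 0 <= B.
  apply: le_trans (b2 x _); first exact: normr_ge0.
  by rewrite ge_min le_max lexx.
have b1 u : Num.min x y <= u <= Num.max x y -> `|f1 u - f1 x| <= B * `|y - x|.
  move=> ui; have H : `|f1 u - f1 x| <= B * `|u - x|.
    apply: (@MVT_norm_bound _ f2) => z zi; [apply: d2|apply: b2]; exact: minmax_trans zi.
  apply: le_trans H _; apply: ler_wpM2l => //.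
  exact: minmax_dist.
have dg u : Num.min x y <= u <= Num.max x y ->
    is_derive u 1 (fun u => f u - (u - x) * f1 x) (f1 u - f1 x).
  move=> ui; have ? := d1 u ui.
  apply: is_derive_eq.
  by rewrite subr0 scaler0 add0r /GRing.scale/= mulr1.
have := MVT_norm_bound dg b1.
rewrite subrr mul0r subr0 addrAC -[in leRHS]mulrA -expr2 real_normK ?num_real//.
Qed.

Lemma taylor3_norm_bound f f1 f2 f3 x y B :
  (forall u, is_derive u 1 f (f1 u)) -> (forall u, is_derive u 1 f1 (f2 u)) ->
  (forall u, is_derive u 1 f2 (f3 u)) -> (forall u, `|f3 u| <= B) ->
  `|f (x + y) - f x - y * f1 x - y ^+ 2 / 2 * f2 x| <= B * `|y| ^+ 3.
Proof.
move=> d1 d2 d3 b3.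
have B0 : 0 <= B by apply: le_trans (b3 x); exact: normr_ge0.
pose h u := f u - (u - x) * f1 x - (u - x) ^+ 2 / 2 * f2 x.
have dh u : is_derive u 1 h (f1 u - f1 x - (u - x) * f2 x).
  have ? := d1 u; rewrite /h.
  apply: is_derive_eq.
  by rewrite !subr0 !scaler0 !add0r ?scaler1 /GRing.scale/=; field.
have bh u : Num.min x (x + y) <= u <= Num.max x (x + y) ->
    `|f1 u - f1 x - (u - x) * f2 x| <= B * `|y| ^+ 2.
  move=> ui; apply: (@le_trans _ _ (B * (u - x) ^+ 2)).
    exact: (@taylor2_norm_bound f1 f2 f3).
  rewrite ler_wpM2l// -[leLHS]real_normK ?num_real// lerXn2r ?nnegrE ?normr_ge0//.
  by have := minmax_dist ui; rewrite (addrC x y) addrK.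
have := @MVT_norm_bound h _ x (x + y) _ (fun u _ => dh u) bh.
rewrite /h subrr mul0r expr0n/= !mul0r !subr0 (addrC x y) addrK.
move=> H; rewrite [leRHS](_ : _ = B * `|y| ^+ 2 * `|y|); last by ring.
by rewrite [X in `|X|](_ : _ = f (y + x) - y * f1 x - y ^+ 2 / 2 * f2 x - f x)//; ring.
Qed.

(** For v > 0 this is v^(-1/2) exp(-x^2/(2v)), the Gaussian density of variance v without the factor
    1/sqrt(2 pi). As a single exponential it is positive for all arguments and easy to
    differentiate. *)
Definition heat v x : R := expR (- (ln v / 2) - x ^+ 2 / (2 * v)).

Lemma heat_gt0 v x : 0 < heat v x.
Proof. exact: expR_gt0. Qed.

Lemma is_derive_expR_comp f x (a : R) :
  is_derive x 1 f a -> is_derive x 1 (fun y => expR (f y)) (a * expR (f x)).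
Proof. by move=> ?; rewrite mulrC; exact: (@is_derive1_comp _ expR f). Qed.

Lemma is_derive_heat_x v x : v != 0 -> is_derive x 1 (heat v) (- (x / v) * heat v x).
Proof.
move=> v0; apply: is_derive_expR_comp.
apply: is_derive_eq.
by rewrite !scaler0 !add0r /GRing.scale/=; field.
Qed.

Lemma is_derive_heat_xx v x : v != 0 ->
  is_derive x 1 (fun x => - (x / v) * heat v x) ((x ^+ 2 / v ^+ 2 - v^-1) * heat v x).
Proof.
move=> v0; have ? := is_derive_heat_x x v0.
apply: is_derive_eq.
by rewrite !scaler0 !add0r /GRing.scale/=; field.
Qed.

Lemma is_derive_heat_xxx v x : v != 0 ->
  is_derive x 1 (fun x => (x ^+ 2 / v ^+ 2 - v^-1) * heat v x)
    ((3 * x / v ^+ 2 - x ^+ 3 / v ^+ 3) * heat v x).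
Proof.
move=> v0; have ? := is_derive_heat_x x v0.
apply: is_derive_eq.
by rewrite !scaler0 !add0r /GRing.scale/=; field.
Qed.

Lemma is_derive_heat_v v x : 0 < v ->
  is_derive v 1 (heat^~ x) ((x ^+ 2 / v ^+ 2 - v^-1) / 2 * heat v x).
Proof.
move=> v0; have vn0 := lt0r_neq0 v0.
apply: is_derive_expR_comp.
have ? := is_derive1_ln v0.
have ? : is_derive v 1 (fun v => (2 * v)^-1) (- (2 * v) ^- 2 *: 2).
  apply: is_deriveV; first by rewrite mulf_neq0.
  by apply: is_derive_eq; rewrite ?scaler0 ?addr0 ?add0r /GRing.scale/= mulr1.
apply: is_derive_eq.
by rewrite ?scaler0 ?addr0 ?add0r /GRing.scale/=; field.
Qed.

Lemma is_derive_heat_vv v x : 0 < v ->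
  is_derive v 1 (fun v => (x ^+ 2 / v ^+ 2 - v^-1) / 2 * heat v x)
   ((x ^+ 4 / (4 * v ^+ 4) - 3 * x ^+ 2 / (2 * v ^+ 3) + 3 / (4 * v ^+ 2)) * heat v x).
Proof.
move=> v0; have vn0 := lt0r_neq0 v0; have ? := is_derive_heat_v x v0.
have ? : is_derive v 1 (fun v => v^-1) (- v ^- 2 *: 1).
  by apply: (@is_deriveV _ id) => //; exact: is_derive_id.
have ? : is_derive v 1 (fun v => (v ^+ 2)^-1) (- (v ^+ 2) ^- 2 *: (2 * v)).
  apply: (@is_deriveV _ (fun v => v ^+ 2)) => //; first by rewrite expf_neq0.
  by apply: is_derive_eq; rewrite /GRing.scale/=; ring.
apply: is_derive_eq.
by rewrite ?scaler0 ?add0r ?addr0 /GRing.scale/=; field.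
Qed.

(** With z = x^2/(2v), the kernel is [heat v 0] times exp(-z), and 1, z and z^2/2 are all at most
    exp(z). Since [heat v 0] decreases in v, the value at d serves for every larger variance. *)
Lemma heat_bounds d v x : 0 < d -> d <= v ->
  [/\ heat v x <= heat d 0, x ^+ 2 / v * heat v x <= 2 * heat d 0
    & x ^+ 4 / v ^+ 2 * heat v x <= 8 * heat d 0].
Proof.
move=> d0 dv; have v0 : 0 < v by exact: lt_le_trans dv.
pose z := x ^+ 2 / (2 * v).
have z0 : 0 <= z by rewrite divr_ge0 ?sqr_ge0// mulr_ge0// ltW.
have hE : heat v x = heat v 0 * expR (- z).
  by rewrite /heat expr0n/= mul0r subr0 expRD.
have hvd : heat v 0 <= heat d 0.
  rewrite /heat expr0n/= !mul0r !subr0 ler_expR lerN2 ler_pM2r// ler_ln//.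
have key c : 0 <= c -> c <= expR z -> c * heat v x <= heat d 0.
  move=> c0 ce; rewrite hE mulrCA -[leRHS]mulr1 ler_pM ?(ltW (heat_gt0 _ _))//.
    by rewrite mulr_ge0// expR_ge0.
  by rewrite expRN ler_pdivrMr ?expR_gt0// mul1r.
have x2 : x ^+ 2 / v = 2 * z by rewrite /z; field; exact: lt0r_neq0.
have x4 : x ^+ 4 / v ^+ 2 = 8 * (z ^+ 2 / 2) by rewrite /z; field; exact: lt0r_neq0.
split.
- by have := @key 1 ler01; rewrite mul1r; apply; rewrite -expR0 ler_expR.
- rewrite x2 -mulrA ler_pM2l//; apply: key => //.
  by apply: le_trans (expR_ge1Dx z); rewrite lerDr.
- rewrite x4 -mulrA ler_pM2l//; apply: key; first by rewrite divr_ge0// sqr_ge0.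
  by apply: le_trans (expR_ge1Dxn 1 z0); rewrite lerDr.
Qed.

(** Odd powers are absorbed by |x| <= 1 + x^2 and |x|^3 <= 1 + x^4, which leaves the three
    quantities of [heat_bounds] with spare powers of 1/v, at most those of 1/d. The bound has to be
    uniform in v >= d because the variance parameter grows along the replacement. *)
Lemma heat_xxx_bound d : 0 < d -> exists2 B : R, 0 <= B & forall v x, d <= v ->
  `|(3 * x / v ^+ 2 - x ^+ 3 / v ^+ 3) * heat v x| <= B.
Proof.
move=> d0; exists ((3 * d^-1 ^+ 2 + 14 * d^-1 + d^-1 ^+ 3) * heat d 0).
  by rewrite mulr_ge0 ?(ltW (heat_gt0 _ _))// !addr_ge0 ?mulr_ge0 ?exprn_ge0 ?invr_ge0 ?(ltW d0).
move=> v x dv; have v0 : 0 < v by exact: lt_le_trans dv.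
have [b0 b2 b4] := heat_bounds x d0 dv.
have iv : v^-1 <= d^-1 by rewrite lef_pV2.
have iv0 : 0 <= v^-1 by rewrite invr_ge0 ltW.
set h := heat v x in b0 b2 b4 *; set H := heat d 0 in b0 b2 b4 *.
have h0 : 0 < h := heat_gt0 _ _.
have H0 : 0 < H := heat_gt0 _ _.
rewrite normrM (ger0_norm (ltW h0)).
have x1 : `|x| <= 1 + x ^+ 2.
  by rewrite -(real_normK (num_real x)); have := sqr_ge0 (`|x| - 1 / 2); nra.
have x3 : `|x| ^+ 3 <= 1 + x ^+ 4.
  rewrite -[x ^+ 4]/(x ^+ (2 * 2)) exprM -(real_normK (num_real x)).
  have := normr_ge0 x; set a := `|x| => a0.
  by have := sqr_ge0 (a ^+ 2 - a / 2); have := sqr_ge0 (a - 1); nra.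
have n1 : `|3 * x / v ^+ 2 - x ^+ 3 / v ^+ 3| <=
    3 * v^-1 ^+ 2 + 3 * (x ^+ 2 / v) * v^-1 + v^-1 ^+ 3 + x ^+ 4 / v ^+ 2 * v^-1.
  apply: le_trans (ler_normB _ _) _.
  rewrite !normrM !normfV !normrX (ger0_norm (ltW v0)) (ger0_norm (ler0n R 3)).
  have -> : 3 * v^-1 ^+ 2 + 3 * (x ^+ 2 / v) / v + v^-1 ^+ 3 + x ^+ 4 / v ^+ 2 / v =
     3 * (1 + x ^+ 2) / v ^+ 2 + (1 + x ^+ 4) / v ^+ 3 by field; exact: lt0r_neq0.
  apply: lerD; apply: ler_wpM2r; rewrite ?invr_ge0 ?exprn_ge0 ?(ltW v0)//.
  by rewrite ler_wpM2l.
apply: le_trans (ler_wpM2r (ltW h0) n1) _.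
have -> : (3 * v^-1 ^+ 2 + 3 * (x ^+ 2 / v) / v + v^-1 ^+ 3 + x ^+ 4 / v ^+ 2 / v) * h =
  (3 * v^-1 ^+ 2 + v^-1 ^+ 3) * h + 3 * v^-1 * (x ^+ 2 / v * h) + v^-1 * (x ^+ 4 / v ^+ 2 * h).
  by ring.
have -> : (3 * d^-1 ^+ 2 + 14 / d + d^-1 ^+ 3) * H =
  (3 * d^-1 ^+ 2 + d^-1 ^+ 3) * H + 3 * d^-1 * (2 * H) + d^-1 * (8 * H) by ring.
have e2 : v^-1 ^+ 2 <= d^-1 ^+ 2 by rewrite lerXn2r ?nnegrE// (le_trans iv0).
have e3 : v^-1 ^+ 3 <= d^-1 ^+ 3 by rewrite lerXn2r ?nnegrE// (le_trans iv0).
apply: lerD; [apply: lerD|].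
- apply: ler_pM => //; last by apply: lerD => //; rewrite ler_pM2l.
  by rewrite addr_ge0// ?mulr_ge0 ?exprn_ge0.
  exact: ltW.
- apply: ler_pM => //; first by rewrite mulr_ge0.
    by rewrite mulr_ge0 ?(ltW h0)// divr_ge0 ?sqr_ge0// ltW.
  by rewrite ler_pM2l.
- apply: ler_pM => //.
  by rewrite mulr_ge0 ?(ltW h0)// divr_ge0 ?exprn_even_ge0// exprn_ge0// ltW.
Qed.

Lemma heat_vv_bound d : 0 < d -> exists2 B : R, 0 <= B & forall v x, d <= v ->
  `|(x ^+ 4 / (4 * v ^+ 4) - 3 * x ^+ 2 / (2 * v ^+ 3) + 3 / (4 * v ^+ 2)) * heat v x| <= B.
Proof.
move=> d0; exists (6 * d^-1 ^+ 2 * heat d 0).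
  by rewrite mulr_ge0 ?(ltW (heat_gt0 _ _))// mulr_ge0 ?exprn_ge0 ?invr_ge0 ?(ltW d0).
move=> v x dv; have v0 : 0 < v by exact: lt_le_trans dv.
have [b0 b2 b4] := heat_bounds x d0 dv.
have iv : v^-1 <= d^-1 by rewrite lef_pV2.
have iv0 : 0 <= v^-1 by rewrite invr_ge0 ltW.
set h := heat v x in b0 b2 b4 *; set H := heat d 0 in b0 b2 b4 *.
have h0 : 0 < h := heat_gt0 _ _.
have e2 : v^-1 ^+ 2 <= d^-1 ^+ 2 by rewrite lerXn2r ?nnegrE// (le_trans iv0).
have a2 : 0 <= x ^+ 2 / v * h by rewrite mulr_ge0 ?(ltW h0)// divr_ge0 ?sqr_ge0// ltW.
have a4 : 0 <= x ^+ 4 / v ^+ 2 * h.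
  by rewrite mulr_ge0 ?(ltW h0)// divr_ge0 ?exprn_even_ge0// exprn_ge0// ltW.
have -> : (x ^+ 4 / (4 * v ^+ 4) - 3 * x ^+ 2 / (2 * v ^+ 3) + 3 / (4 * v ^+ 2)) * h =
  v^-1 ^+ 2 * ((x ^+ 4 / v ^+ 2 * h) / 4 - 3 / 2 * (x ^+ 2 / v * h) + 3 / 4 * h).
  by field; exact: lt0r_neq0.
rewrite normrM (ger0_norm (exprn_ge0 2 iv0)) [leRHS](_ : _ = d^-1 ^+ 2 * (6 * H)); last by ring.
apply: ler_pM => //.
  exact: exprn_ge0.
by rewrite ler_norml; apply/andP; split; lra.
Qed.

(* The heat equation [heat_v = heat_xx / 2] makes the second-order terms match. *)
Lemma heat_step d : 0 < d -> exists2 C : R, 0 <= C & forall v s x y, d <= v -> 0 <= s ->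
  `|heat v (x + y) - heat (v + s) x - y * (- (x / v) * heat v x)
     - (y ^+ 2 - s) / 2 * ((x ^+ 2 / v ^+ 2 - v^-1) * heat v x)| <=
  C * (`|y| ^+ 3 + s ^+ 2).
Proof.
move=> d0; have [B B0 HB] := heat_xxx_bound d0; have [B' B'0 HB'] := heat_vv_bound d0.
exists (B + B'); first by rewrite addr_ge0.
move=> v s x y dv s0; have v0 : 0 < v by exact: lt_le_trans dv.
have vn0 := lt0r_neq0 v0.
have T3 := @taylor3_norm_bound _ _ _ _ x y B (fun u => is_derive_heat_x u vn0)
  (fun u => is_derive_heat_xx u vn0) (fun u => is_derive_heat_xxx u vn0) (fun u => HB v u dv).
have vvs : v <= v + s by rewrite lerDl.
have T2 : `|heat (v + s) x - heat v x - (v + s - v) * ((x ^+ 2 / v ^+ 2 - v^-1) / 2 * heat v x)|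
    <= B' * (v + s - v) ^+ 2.
  pose h1 u := (x ^+ 2 / u ^+ 2 - u^-1) / 2 * heat u x.
  apply: (@taylor2_norm_bound (heat^~ x) h1 (fun u => (x ^+ 4 / (4 * u ^+ 4)
    - 3 * x ^+ 2 / (2 * u ^+ 3) + 3 / (4 * u ^+ 2)) * heat u x)) => u;
    rewrite (min_l vvs) => /andP[vu _].
  - by apply: is_derive_heat_v; exact: lt_le_trans vu.
  - by apply: is_derive_heat_vv; exact: lt_le_trans vu.
  - by apply: HB'; exact: le_trans vu.
rewrite (addrC v s) addrK in T2.
rewrite (addrC v s).
move: T3 T2; set a := (X in `|X| <= _) => T3; set b := (X in `|X| <= _) => T2.
rewrite [X in `|X|](_ : _ = a - b); last by rewrite /a /b; field.
apply: le_trans (ler_normB _ _) _.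
have : 0 <= B * s ^+ 2 by rewrite mulr_ge0// sqr_ge0.
have : 0 <= B' * `|y| ^+ 3 by rewrite mulr_ge0// exprn_ge0.
by rewrite mulrDl !mulrDr; lra.
Qed.

End HeatKernel.

(** * Independence and expectations *)

Section Independence.
Context (R : realType) (d : measure_display) (Omega : measurableType d)
  (P : probability Omega R).

Definition indep_RV (U V : Omega -> R) := forall A B : set R,
  measurable A -> measurable B ->
  P (U @^-1` A `&` V @^-1` B) = (P (U @^-1` A) * P (V @^-1` B))%E.

Section ProductLaw.
Variables U V : Omega -> R.
Hypotheses (mU : measurable_fun setT U) (mV : measurable_fun setT V)
  (UV : indep_RV U V).

Let U' : {mfun Omega >-> R} := mfun_Sub (mem_set mU).
Let V' : {mfun Omega >-> R} := mfun_Sub (mem_set mV).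
Let W (w : Omega) : R * R := (U w, V w).
Let mW : measurable_fun setT W.
Proof. exact/measurable_fun_pair. Qed.
Let W' : {mfun Omega >-> (R * R)%type} := mfun_Sub (mem_set mW).

(** Independence is agreement on rectangles, and rectangles determine the product measure; hence the
    joint law of U and V is the product of their laws and Fubini's theorem becomes available. *)
Let prod_law (X : set (R * R)) : measurable X ->
  (distribution P U' \x distribution P V')%E X = distribution P W' X.
Proof.
apply: product_measure_unique => A B mA mB /=.
by rewrite /distribution /pushforward -UV.
Qed.

Let int_prod (f : R * R -> \bar R) :
  (\int[(distribution P U' \x distribution P V')%E]_z f z =
   \int[distribution P W']_z f z)%E.
Proof. by apply: eq_measure_integral => X mX _; exact: prod_law. Qed.

Lemma indep_ge0_expectation (f g : R -> R) :
  measurable_fun setT f -> measurable_fun setT g ->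
  (forall x, 0 <= f x) -> (forall x, 0 <= g x) ->
  (\int[P]_w (f (U w) * g (V w))%:E =
   (\int[P]_w (f (U w))%:E) * (\int[P]_w (g (V w))%:E))%E.
Proof.
move=> mf mg f0 g0.
pose F (z : R * R) : \bar R := (f z.1 * g z.2)%:E.
have mF : measurable_fun setT F.
  by apply/measurable_EFinP/measurable_funM; apply: measurableT_comp.
have := int_prod F.
rewrite (@ge0_integral_distribution _ _ _ _ _ P W')//; last first.
  by move=> y; rewrite lee_fin mulr_ge0.
move=> /= <-; rewrite fubini_tonelli1//; last by move=> y; rewrite lee_fin mulr_ge0.
rewrite /fubini_F /F /=.
under eq_integral => x _.
  under eq_integral do rewrite EFinM.
  rewrite ge0_integralZl//; [|exact/measurable_EFinP|by move=> y _; rewrite lee_fin|by rewrite lee_fin].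
  over.
rewrite ge0_integralZr//; last by apply: integral_ge0 => y _; rewrite lee_fin.
rewrite (@ge0_integral_distribution _ _ _ _ _ P U')//; last exact/measurable_EFinP.
by rewrite (@ge0_integral_distribution _ _ _ _ _ P V')//; exact/measurable_EFinP.
- exact/measurable_EFinP.
- by move=> x _; rewrite lee_fin.
Qed.

Lemma indep_integrableM : P.-integrable setT (EFin \o U) -> P.-integrable setT (EFin \o V) ->
  P.-integrable setT (EFin \o (U \* V)).
Proof.
move=> iU iV; apply/integrableP; split.
  exact/measurable_EFinP/measurable_funM.
under eq_integral do rewrite /= normrM.
rewrite (@indep_ge0_expectation Num.norm Num.norm)//.
by apply: lte_mul_pinfty; [exact: integral_ge0| |]; move/integrableP: iU iV => [_ iU] /integrableP[_ iV] //;
  rewrite ge0_fin_numE ?integral_ge0.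
Qed.

Lemma indep_expectationM : P.-integrable setT (EFin \o U) -> P.-integrable setT (EFin \o V) ->
  \int[P]_w (U w * V w) = (\int[P]_w U w) * (\int[P]_w V w).
Proof.
move=> iU iV; have iUV := indep_integrableM iU iV.
pose F (z : R * R) : \bar R := (z.1 * z.2)%:E.
have mF : measurable_fun setT F.
  by apply/measurable_EFinP/measurable_funM.
have iF : (distribution P W').-integrable setT F.
  exact: (integrable_pushforward mW).
have iF2 : (distribution P U' \x distribution P V')%E.-integrable setT F.
  move/integrableP: iF => [_ iF]; apply/integrableP; split => //.
  by rewrite int_prod.
have iU2 : (distribution P U').-integrable setT (EFin \o @id R).
  by apply: integrable_pushforward => //; exact/measurable_EFinP.
have iV2 : (distribution P V').-integrable setT (EFin \o @id R).
  by apply: integrable_pushforward => //; exact/measurable_EFinP.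
have EU : (\int[distribution P U']_x x%:E = \int[P]_w (U w)%:E)%E.
  by rewrite (@integral_distribution _ _ _ _ _ P U' EFin)//; exact/measurable_EFinP.
have EV : (\int[distribution P V']_x x%:E = \int[P]_w (V w)%:E)%E.
  by rewrite (@integral_distribution _ _ _ _ _ P V' EFin)//; exact/measurable_EFinP.
have := int_prod F.
rewrite (@integral_distribution _ _ _ _ _ P W')//= -integral12_prod_meas1//.
rewrite /fubini_F /F /=.
under eq_integral => x _.
  under eq_integral do rewrite EFinM.
  rewrite integralZl// EV -[X in (_ * X)%E]fineK; last exact: integrable_fin_num.
  over.
rewrite integralZr// EU.
rewrite fineK; last exact: integrable_fin_num.
by rewrite /Rintegral => <-; rewrite fineM//; exact: integrable_fin_num.
Qed.

End ProductLaw.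
End Independence.

(** * Independence of each variable from the functions of the earlier ones *)

Section Past.
Context (R : realType) (d : measure_display) (Omega : measurableType d)
  (P : probability Omega R) (xi : nat -> Omega -> R).
Hypothesis Hxi : iid_std_normal P xi.

Let mxi j : measurable_fun setT (xi j).
Proof. by case: Hxi. Qed.

Let mpre j (B : set R) : measurable B -> measurable (xi j @^-1` B).
Proof. by move=> mB; rewrite -(setTI (_ @^-1` _)); exact: mxi. Qed.

(** Events on the variables of index below N. They are closed under intersection and generate the
    past, as a Dynkin class argument requires. *)
Definition cylinders (N : nat) : set (set Omega) := [set A | exists B : nat -> set R,
  (forall j, measurable (B j)) /\ A = \big[setI/setT]_(j <- iota 0 N) (xi j @^-1` B j)].

Definition past_measurable (N : nat) (f : Omega -> R) :=
  measurable_fun setT (f : g_sigma_algebraType (cylinders N) -> R).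

Lemma xi_past_measurable N j : (j < N)%N -> past_measurable N (xi j).
Proof.
move=> jN _ B mB; rewrite setTI; apply: sub_sigma_algebra.
exists (fun i => if i == j then B else setT); split; first by move=> i; case: ifP.
rewrite (bigD1_seq j) ?iota_uniq ?mem_iota//= eqxx big1 ?setIT//.
by move=> i /negbTE ->; rewrite preimage_setT.
Qed.

Lemma past_measurable_le N M f : (N <= M)%N -> past_measurable N f -> past_measurable M f.
Proof.
move=> NM mf _ B mB; have := mf measurableT B mB; rewrite !setTI.
apply: smallest_sub; first exact: smallest_sigma_algebra.
move=> A [C [mC ->]]; apply: sub_sigma_algebra.
exists (fun i => if (i < N)%N then C i else setT); split; first by move=> i; case: ifP.
rewrite -(subnKC NM) iotaD big_cat/= [X in _ `&` X]big1_seq ?setIT; last first.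
  move=> i /andP[_]; rewrite mem_iota add0n => /andP[Ni _].
  by rewrite ltnNge Ni preimage_setT.
by apply: eq_big_seq => i; rewrite mem_iota add0n => /andP[_ ->].
Qed.

Let cyl_meas N : cylinders N `<=` measurable.
Proof.
move=> A [B [mB ->]]; elim/big_ind : _ => //; first exact: measurableI.
by move=> i _; exact: mpre.
Qed.

Let past_sub N : <<s cylinders N >> `<=` measurable.
Proof. by apply: smallest_sub; [exact: sigma_algebra_measurable|exact: cyl_meas]. Qed.

Lemma past_measurable_fun N f : past_measurable N f -> measurable_fun setT f.
Proof.
by move=> mf _ B mB; have := mf measurableT B mB; rewrite !setTI; exact: past_sub.
Qed.

(** The events independent of [C] form a Dynkin system. It contains the cylinders by the product
    formula for finite families, used once for the indices up to N and once for those below N; being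
    stable under intersection, the cylinders carry the property to the generated sigma-algebra. *)
Let past_indep_set N (B : set R) : measurable B -> forall A, <<s cylinders N >> A ->
  P (A `&` xi N @^-1` B) = (P A * P (xi N @^-1` B))%E.
Proof.
move=> mB; set C := xi N @^-1` B.
have mC : measurable C by exact: mpre.
have fC : P C \is a fin_num by exact: fin_num_measure.
suff : <<s cylinders N >> `<=` [set A | measurable A /\ P (A `&` C) = (P A * P C)%E].
  by move=> H A /H[].
rewrite -setI_closed_g_dynkin_g_sigma_algebra; last first.
  move=> _ _ [B1 [mB1 ->]] [B2 [mB2 ->]].
  exists (fun j => B1 j `&` B2 j); split; first by move=> j; exact: measurableI.
  by rewrite -big_split/=.
apply: smallest_sub; first split.
- by split; rewrite ?setTI ?probability_setT ?mul1e.
- move=> A [mA AC]; split; first exact: measurableC.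
  have mAC : measurable (A `&` C) by exact: measurableI.
  rewrite probability_setC// muleBl ?mul1e//.
  rewrite setIC -setDE measureD//; last by rewrite ltey_eq fC.
  by congr (_ - _)%E; rewrite (setIC C A); exact: AC.
- move=> F tF HF.
  have mF i : measurable (F i) by case: (HF i).
  split; first exact: bigcup_measurable.
  rewrite setI_bigcupl measure_semi_bigcup//; first last.
  - by apply: bigcup_measurable => i _; exact: measurableI.
  - by apply: trivIset_setIr.
  - by move=> i; exact: measurableI.
  rewrite measure_semi_bigcup//; last exact: bigcup_measurable.
  rewrite muleC -(fineK fC) -nneseriesZl//.
  by apply: eq_eseriesr => i _; rewrite fineK// muleC; case: (HF i).
move=> _ [B1 [mB1 ->]]; split; first by apply: cyl_meas; exists B1.
case: Hxi => _ [_ ind].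
have := ind (rcons (iota 0 N) N) (fun j => if j == N then B else B1 j).
rewrite -cats1 cat_uniq iota_uniq/= mem_iota add0n ltnn/= !big_cat !big_seq1 eqxx/=.
have E : \big[setI/setT]_(j <- iota 0 N) (xi j @^-1` (if j == N then B else B1 j)) =
    \big[setI/setT]_(j <- iota 0 N) (xi j @^-1` B1 j).
  by apply: eq_big_seq => i; rewrite mem_iota add0n => /andP[_ iN]; rewrite ltn_eqF.
rewrite E => -> //; last by move=> j; case: ifP.
congr (_ * _)%E.
rewrite ind ?iota_uniq//; apply: eq_big_seq => i; rewrite mem_iota add0n => /andP[_ iN].
by rewrite ltn_eqF.
Qed.

Lemma past_indep N f h : past_measurable N f -> measurable_fun setT h ->
  indep_RV P f (h \o xi N).
Proof.
move=> mf mh A B mA mB; rewrite comp_preimage.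
apply: (@past_indep_set N (h @^-1` B)).
  by rewrite -(setTI (h @^-1` _)); exact: mh.
by have := mf measurableT A mA; rewrite setTI.
Qed.

Lemma expectation_past N f h : past_measurable N f -> measurable_fun setT h ->
  P.-integrable setT (EFin \o f) -> P.-integrable setT (EFin \o (h \o xi N)) ->
  P.-integrable setT (EFin \o (fun w => f w * h (xi N w))) /\
  \int[P]_w (f w * h (xi N w)) = (\int[P]_w f w) * (\int[P]_w h (xi N w)).
Proof.
move=> mf mh intf inth; have fh := past_indep mf mh.
have mf' := past_measurable_fun mf.
have mh' : measurable_fun setT (h \o xi N) by exact: measurableT_comp.
by split; [exact: (indep_integrableM mf' mh')|exact: (indep_expectationM mf' mh')].
Qed.

End Past.

(** * Moments of the standard normal law *)

Section NormalMoments.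
Context {R : realType}.
Local Notation mu := (@lebesgue_measure R).
Local Notation pdf := (@normal_pdf R 0 1).

Lemma integral_normal_probE (f : R -> \bar R) : measurable_fun setT f ->
  (\int[normal_prob 0 1]_x `|f x| < +oo)%E ->
  (\int[normal_prob 0 1]_x f x = \int[mu]_x (f x * (pdf x)%:E))%E.
Proof.
move=> mf finf.
have dom := @normal_prob_dominates R 0 1.
rewrite -(Radon_Nikodym_change_of_variables dom)//=; last exact/integrableP.
apply: ae_eq_integral => //.
- by apply: emeasurable_funM => //; apply: (measurable_int mu).
- by apply: emeasurable_funM => //=; apply/measurableT_comp => //=; exact: measurable_normal_pdf.
- apply: ae_eqe_mul2l => /=.
  rewrite Radon_NikodymE//=.
  case: cid => /= h [h1 h2 h3].
  apply: integral_ae_eq => //=.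
  + by apply/measurableT_comp => //; exact: measurable_normal_pdf.
  + by move=> E E01 mE; rewrite -h3.
Qed.

(** No integrability is assumed here, so that finiteness under the normal law can be deduced from
    finiteness of the Lebesgue integral. *)
Lemma ge0_integral_normal_probE (f : R -> \bar R) : (forall x, 0 <= f x)%E ->
  measurable_fun setT f ->
  (\int[normal_prob 0 1]_x f x = \int[mu]_x (f x * (pdf x)%:E))%E.
Proof.
move=> f0 mf.
have dom := @normal_prob_dominates R 0 1.
rewrite -(Radon_Nikodym_SigmaFinite.change_of_variables dom)//=.
have iN := Radon_Nikodym_SigmaFinite.f_integrable dom.
apply: ae_eq_integral => //.
- by apply: emeasurable_funM => //; apply: (measurable_int mu).
- by apply: emeasurable_funM => //=; apply/measurableT_comp => //=; exact: measurable_normal_pdf.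
- apply: ae_eqe_mul2l => /=.
  apply: integral_ae_eq => //=.
  + by apply/measurableT_comp => //; exact: measurable_normal_pdf.
  + by move=> E E01 mE; rewrite -(Radon_Nikodym_SigmaFinite.f_integral dom).
Qed.

Lemma pdfE x : pdf x = normal_peak 1 * expR (- (x ^+ 2 / 2)).
Proof.
by rewrite normal_pdfE ?oner_eq0// /normal_fun subr0 expr1n mulNr -[1 *+ 2]/(2%:R).
Qed.

(** Half of the Gaussian exponent pays for the polynomial: with z = x^2/4, exp(z) >= 1 + z^3/3! and
    x^6 = 4^3 z^3. The sixth power is what the third absolute moment of x^2 - 1 calls for. *)
Lemma pow6_expR (x : R) : x ^+ 6 * expR (- (x ^+ 2 / 2)) <= 6 * 4 ^+ 3 * expR (- (x ^+ 2 / 4)).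
Proof.
have z0 : 0 <= x ^+ 2 / 4 by rewrite divr_ge0// sqr_ge0.
have := expR_ge1Dxn 2 z0; rewrite -[3`!]/6%N => H.
have -> : - (x ^+ 2 / 2) = - (x ^+ 2 / 4) - (x ^+ 2 / 4) by field.
rewrite expRD mulrA ler_wpM2r ?expR_ge0// expRN ler_pdivrMr ?expR_gt0//.
apply: le_trans (_ : 6 * 4 ^+ 3 * (1 + (x ^+ 2 / 4) ^+ 3 / 6) <= _); last by rewrite ler_pM2l.
have -> : 6 * 4 ^+ 3 * (1 + (x ^+ 2 / 4) ^+ 3 / 6) = 6 * 4 ^+ 3 + x ^+ 6 by field.
by rewrite lerDr mulr_ge0// exprn_ge0.
Qed.

Lemma integrable_pow6_pdf : mu.-integrable setT (fun x => (x ^+ 6 * pdf x)%:E).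
Proof.
pose s : R := Num.sqrt 2.
have s0 : s != 0 by rewrite gt_eqF// sqrtr_gt0.
(* The remaining factor exp(-x^2/4) is, up to its peak, the normal density of standard deviation
   sqrt 2. *)
have I := integrableZl measurableT (6 * 4 ^+ 3 * normal_peak 1 / normal_peak s) (integrable_normal_pdf 0 s).
apply: le_integrable I => //.
  apply/measurable_EFinP/measurable_funM => //.
  exact: measurable_normal_pdf.
move=> x _; rewrite /= lee_fin ger0_norm; last first.
  by rewrite mulr_ge0 ?normal_pdf_ge0// exprn_even_ge0.
apply: le_trans (ler_norm _); rewrite pdfE normal_pdfE// /normal_fun subr0.
rewrite sqr_sqrtr//.
have p0 : normal_peak s != 0 by rewrite gt_eqF// normal_peak_gt0.
rewrite [leRHS](_ : _ = normal_peak 1 * (6 * 4 ^+ 3 * expR (- (x ^+ 2 / 4)))); last first.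
  rewrite mulNr (_ : 2 *+ 2 = 4 :> R); last by rewrite -[2 *+ 2]mulr_natr -natrM.
  by rewrite mulrA divfK// [_ * normal_peak 1]mulrC; exact/esym/mulrA.
by rewrite mulrCA ler_wpM2l ?normal_peak_ge0// pow6_expR.
Qed.

Lemma integrable_poly_pdf (h : R -> R) C : measurable_fun setT h ->
  (forall x, `|h x| <= C * (1 + x ^+ 6)) -> mu.-integrable setT (fun x => (h x * pdf x)%:E).
Proof.
move=> mh hC.
have I := integrableZl measurableT C (integrableD measurableT (integrable_normal_pdf 0 1) integrable_pow6_pdf).
apply: le_integrable I => //.
  by apply/measurable_EFinP/measurable_funM => //; exact: measurable_normal_pdf.
move=> x _; rewrite /= lee_fin; apply: le_trans (ler_norm _).
rewrite normrM (ger0_norm (normal_pdf_ge0 _ _ _)) -[X in _ <= C * (X + _)]mul1r -mulrDl mulrA.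
by rewrite ler_wpM2r ?normal_pdf_ge0.
Qed.

Lemma pow6_pdf_bound x : (1 + x ^+ 6) * pdf x <= (1 + 6 * 4 ^+ 3) * normal_peak 1.
Proof.
rewrite pdfE mulrCA mulrC ler_wpM2r ?normal_peak_ge0// mulrDl mul1r.
have := pow6_expR x.
have : expR (- (x ^+ 2 / 2)) <= 1 by rewrite -expR0 ler_expR oppr_le0 divr_ge0// sqr_ge0.
have : expR (- (x ^+ 2 / 4)) <= 1 by rewrite -expR0 ler_expR oppr_le0 divr_ge0// sqr_ge0.
have : 0 <= 6 * 4 ^+ 3 :> R by rewrite mulr_ge0// exprn_ge0.
move: (6 * 4 ^+ 3) => c c0 h1 h2 h3; apply: lerD => //; apply: le_trans h3 _.
by rewrite ler_piMr.
Qed.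

(** The integral over [-n, n] is F(n) - F(-n), at most 2C/n by the decay hypothesis, and dominated
    convergence extends it to the line. *)
Lemma integral_derivative_eq0 (F f : R -> R) C :
  (forall x : R, is_derive x 1 F (f x)) -> continuous f ->
  mu.-integrable setT (EFin \o f) -> (forall x, `|x| * `|F x| <= C) ->
  (\int[mu]_x (f x)%:E = 0)%E.
Proof.
move=> dF cf intf FC.
pose f_ (n : nat) (x : R) : \bar R := (f x * \1_(`[- n%:R, n%:R]%classic : set R) x)%:E.
have mf : measurable_fun setT (EFin \o f) by exact: (measurable_int mu).
have mf_ n : measurable_fun setT (f_ n).
  by apply/measurable_EFinP/measurable_funM => //; exact/measurable_EFinP.
have cvgf : {ae mu, forall x, setT x -> f_ ^~ x @ \oo --> (EFin \o f) x}.
  apply: aeW => x _; apply: cvg_near_cst.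
  near=> n; rewrite /f_ /= indicE mem_set ?mulr1//= in_itv/= -ler_norml.
  by near: n; exact: nbhs_infty_ger.
have dom : {ae mu, forall x n, setT x -> (`|f_ n x| <= (EFin \o (fun x => `|f x|)%R) x)%E}.
  apply: aeW => x n _; rewrite /f_ /= lee_fin normrM ler_piMr//.
  by rewrite indicE; case: (_ \in _); rewrite ?normr0 ?normr1.
have [_ _ lim1] := @dominated_convergence _ _ _ mu _ measurableT _ _ _ mf_ mf cvgf (integrable_norm intf) dom.
have lim2 : [sequence (\int[mu]_x (f_ n x))%E]_n @ \oo --> 0%E.
  have -> : [sequence (\int[mu]_x (f_ n x))%E]_n = (fun n => (F n%:R - F (- n%:R))%:E).
    apply/funext => n /=.
    rewrite (_ : (fun x => f_ n x) = (EFin \o f) \_ `[- n%:R, n%:R]%classic); last first.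
      apply/funext => x; rewrite /f_ patchE indicE /=.
      by case: (_ \in _); rewrite ?mulr1 ?mulr0.
    rewrite -integral_mkcond.
    have [->|n0] := eqVneq n 0%N.
      by rewrite oppr0 set_itv1 integral_set1 subrr.
    rewrite (@continuous_FTC2 _ f F) ?EFinB//.
    - by rewrite lt_neqAle eqNr pnatr_eq0 n0/= ge0_cp// ler0n.
    - exact: continuous_subspaceT.
    - split.
      + by move=> x _; have [] := dF x.
      + apply: cvg_at_right_filter; apply: differentiable_continuous.
        by apply/derivable1_diffP; have [] := dF (- n%:R).
      + apply: cvg_at_left_filter; apply: differentiable_continuous.
        by apply/derivable1_diffP; have [] := dF (n%:R).
    - by move=> x _; rewrite derive1E; have [] := dF x.
  have C0 : 0 <= C by apply: le_trans (FC 0); rewrite mulr_ge0.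
  apply/cvg_EFin; first by near=> n.
  have H : (fun n : nat => 2 * C / n%:R) @ \oo --> 0.
    rewrite -(mulr0 (2 * C)); apply: cvgM; first exact: cvg_cst.
    rewrite -cvg_shiftS.
    exact: cvg_harmonic.
  apply/norm_cvg0P; apply: (squeeze_cvgr _ (cvg_cst 0) H).
  near=> n; rewrite normr_ge0/=.
  have n0 : 0 < n%:R :> R by rewrite ltr0n; near: n; exact: nbhs_infty_gt.
  rewrite ler_pdivlMr// mulrC.
  have := FC n%:R; have := FC (- n%:R); rewrite normrN (ger0_norm (ltW n0)) => H1 H2.
  apply: le_trans (ler_wpM2l (ltW n0) (ler_normB _ _)) _.
  by rewrite mulrDr; lra.
exact: (cvg_unique _ lim1 lim2).
Unshelve. all: by end_near. Qed.

Lemma is_derive_pdf (x : R) : is_derive x 1 pdf (- x * pdf x).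
Proof.
have -> : pdf = fun x => normal_peak 1 * expR (- (x ^+ 2 / 2)) by apply/funext => y; exact: pdfE.
have ? : is_derive x 1 (fun x => expR (- (x ^+ 2 / 2))) (- x * expR (- (x ^+ 2 / 2))).
  apply: is_derive_expR_comp; apply: is_derive_eq.
  by rewrite ?scaler0 ?add0r ?addr0 /GRing.scale/=; field.
by apply: is_derive_eq; rewrite ?scaler0 ?add0r ?addr0 /GRing.scale/=; ring.
Qed.

(** Stein's identity: x g - g', multiplied by the density, is the derivative of minus g times the
    density. The choices g = 1, x, x^3 yield all the moments used below. *)
Lemma poly_pdf_derivative_eq0 (g dg h : R -> R) C :
  (forall x : R, is_derive x 1 g (dg x)) -> (forall x, h x = x * g x - dg x) ->
  continuous h -> (forall x, `|h x| <= C * (1 + x ^+ 6)) ->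
  (forall x, `|x| * `|g x| <= C * (1 + x ^+ 6)) ->
  (\int[mu]_x (h x * pdf x)%:E = 0)%E.
Proof.
move=> dg_ hE cg b1 b2.
apply: (@integral_derivative_eq0 (fun x => - g x * pdf x) _ (C * ((1 + 6 * 4 ^+ 3) * normal_peak 1))).
- move=> x; have ? := dg_ x; have ? := is_derive_pdf x.
  by apply: is_derive_eq; rewrite hE /GRing.scale/=; ring.
- by move=> x; apply: cvgM; [exact: cg|exact: (continuous_normal_pdf (oner_neq0 R))].
- exact: (integrable_poly_pdf (continuous_measurable_fun cg) b1).
- move=> x; rewrite normrM normrN (ger0_norm (normal_pdf_ge0 _ _ _)) mulrA.
  apply: le_trans (ler_wpM2r (normal_pdf_ge0 _ _ _) (b2 x)) _.
  rewrite -mulrA; apply: ler_wpM2l (pow6_pdf_bound x).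
  have := b2 0; rewrite normr0 mul0r expr0n/= addr0 mulr1; exact.
Qed.

End NormalMoments.

Section NormalSequence.
Context (R : realType) (d : measure_display) (Omega : measurableType d)
  (P : probability Omega R) (xi : nat -> Omega -> R).
Hypothesis Hxi : iid_std_normal P xi.
Local Notation mu := (@lebesgue_measure R).
Local Notation pdf := (@normal_pdf R 0 1).

Let mxi j : measurable_fun setT (xi j).
Proof. by case: Hxi. Qed.

Let X j : {mfun Omega >-> measurableTypeR R} :=
  @mfun_Sub _ _ Omega (measurableTypeR R) (xi j) (mem_set (mxi j)).

Let int_law j (f : R -> \bar R) :
  (\int[normal_prob 0 1]_x f x = \int[distribution P (X j)]_x f x)%E.
Proof.
apply: eq_measure_integral => A mA _.
case: Hxi => _ [H _]; exact/esym/(H j A mA).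
Qed.

Lemma ge0_expectation_xi j (f : R -> \bar R) : (forall x, 0 <= f x)%E ->
  measurable_fun setT f -> (\int[P]_w f (xi j w) = \int[mu]_x (f x * (pdf x)%:E))%E.
Proof.
move=> f0 mf; rewrite -ge0_integral_normal_probE//.
by rewrite (int_law j) ge0_integral_distribution.
Qed.

Lemma integrable_xi j (h : R -> R) C : measurable_fun setT h ->
  (forall x, `|h x| <= C * (1 + x ^+ 6)) -> P.-integrable setT (EFin \o (h \o xi j)).
Proof.
move=> mh hC; apply/integrableP; split.
  by apply/measurable_EFinP; exact: measurableT_comp.
rewrite (ge0_expectation_xi j (f := fun x => `|(h x)%:E|%E))//; last first.
  by apply: measurableT_comp => //; exact/measurable_EFinP.
have /integrableP[_] := integrable_poly_pdf mh hC.
apply: le_lt_trans; apply: ge0_le_integral => //.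
- by move=> x _; rewrite mule_ge0// lee_fin normal_pdf_ge0.
- apply: emeasurable_funM; first by apply: measurableT_comp => //; exact/measurable_EFinP.
  by apply/measurable_EFinP; exact: measurable_normal_pdf.
- apply/measurableT_comp => //; apply/measurable_EFinP/measurable_funM => //.
  exact: measurable_normal_pdf.
- by move=> x _; rewrite EFinM abseM; apply: lee_wpmul2l => //=; rewrite lee_fin ler_norm.
Qed.

Lemma expectation_xiE j (h : R -> R) C : measurable_fun setT h ->
  (forall x, `|h x| <= C * (1 + x ^+ 6)) ->
  \int[P]_w h (xi j w) = fine (\int[mu]_x (h x * pdf x)%:E)%E.
Proof.
move=> mh hC; rewrite /Rintegral; congr fine.
have I := integrable_xi j mh hC.
rewrite -[LHS]/(\int[P]_w ((EFin \o h) \o xi j) w)%E.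
rewrite -(@integral_distribution _ _ _ _ _ P (X j)) -?int_law//; last exact/measurable_EFinP.
rewrite integral_normal_probE//; first exact/measurable_EFinP.
rewrite (int_law j) ge0_integral_distribution//; first by case/integrableP: I.
by apply: measurableT_comp => //; exact/measurable_EFinP.
Qed.

Lemma pow_le_1D6 (x : R) : [/\ `|x| <= 1 + x ^+ 6, x ^+ 2 <= 1 + x ^+ 6 & x ^+ 4 <= 1 + x ^+ 6].
Proof.
have E : x ^+ 6 = (x ^+ 2) ^+ 3 by rewrite -exprM.
have E4 : x ^+ 4 = (x ^+ 2) ^+ 2 by rewrite -exprM.
have N : x ^+ 2 = `|x| ^+ 2 by rewrite real_normK ?num_real.
rewrite E E4; have := sqr_ge0 x; set y := x ^+ 2 => y0.
have Y : y <= 1 + y ^+ 3.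
  by case: (lerP y 1) => y1; have := exprn_ge0 3 y0; nra.
split => //.
- have := normr_ge0 x; have := sqr_ge0 (`|x| - 1); rewrite /y N in Y *.
  case: (lerP `|x| 1) => x1; first by have := exprn_ge0 3 y0; rewrite /y N; lra.
  nra.
- by case: (lerP y 1) => y1; have := exprn_ge0 3 y0; nra.
Qed.

Let pow6_ge0 (x : R) : 0 <= x ^+ 6.
Proof. exact: exprn_even_ge0. Qed.

Let cont_pow k : continuous (fun x : R => x ^+ k).
Proof. exact: exprn_continuous. Qed.

Lemma expectation_xi j : \int[P]_w xi j w = 0.
Proof.
have b (x : R) : `|x| <= 1 * (1 + x ^+ 6) by rewrite mul1r; have [] := pow_le_1D6 x.
rewrite (@expectation_xiE j id 1)//.
rewrite (@poly_pdf_derivative_eq0 R (cst 1) (cst 0) id 1)//.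
- by move=> x /=; rewrite mulr1 subr0.
- by move=> x A.
- by move=> x /=; rewrite normr1 mulr1.
Qed.

Lemma expectation_xi2 j : \int[P]_w (xi j w ^+ 2 - 1) = 0.
Proof.
pose h (x : R) := x ^+ 2 - 1.
have ch : continuous h by move=> x; apply: cvgB; [exact: cont_pow|exact: cvg_cst].
have b x : `|h x| <= 2 * (1 + x ^+ 6).
  have [_ + _] := pow_le_1D6 x; have := sqr_ge0 x; have := pow6_ge0 x => ? ? ?.
  by rewrite ler_norml; apply/andP; split; rewrite /h; lra.
rewrite (@expectation_xiE j h 2 (continuous_measurable_fun ch) b).
rewrite (@poly_pdf_derivative_eq0 R id (cst 1) h 2)//.
move=> x /=; rewrite -expr2 real_normK ?num_real//.
by have [_ + _] := pow_le_1D6 x; have := pow6_ge0 x; lra.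
Qed.

Lemma expectation_xi4 j : \int[P]_w (xi j w ^+ 4 - 3 * xi j w ^+ 2) = 0.
Proof.
pose h (x : R) := x ^+ 4 - 3 * x ^+ 2.
have ch : continuous h.
  move=> x; apply: cvgB; first exact: cont_pow.
  by apply: cvgM; [exact: cvg_cst|exact: cont_pow].
have b x : `|h x| <= 4 * (1 + x ^+ 6).
  have [_ a2 a4] := pow_le_1D6 x; have := sqr_ge0 x; have := pow6_ge0 x.
  have : 0 <= x ^+ 4 by rewrite exprn_even_ge0.
  by move=> ? ? ?; rewrite ler_norml; apply/andP; split; rewrite /h; lra.
rewrite (@expectation_xiE j h 4 (continuous_measurable_fun ch) b).
have dg (x : R) : is_derive x 1 (fun x : R => x ^+ 3) (3 * x ^+ 2).
  by apply: is_derive_eq; rewrite /GRing.scale/=; ring.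
rewrite (@poly_pdf_derivative_eq0 R _ _ h 4 dg)//.
move=> x /=; rewrite -normrM -exprS ger0_norm ?exprn_even_ge0//.
by have [_ _ a4] := pow_le_1D6 x; have := pow6_ge0 x; lra.
Qed.

End NormalSequence.

(** * Quadratic forms of normal variables *)

Section SmoothBounds.
Variable R : realType.
Implicit Types v x : R.

Lemma derivable_continuous_fun (f df : R -> R) :
  (forall x : R, is_derive x 1 f (df x)) -> continuous f.
Proof.
move=> H x; apply: differentiable_continuous.
by apply/derivable1_diffP; have [] := H x.
Qed.

Lemma heat_le_diag v x : 0 < v -> heat v x <= heat v 0.
Proof. by move=> v0; have [] := heat_bounds x v0 (lexx v). Qed.

(** This bound and the next one only serve to integrate the first- and second-order Taylor terms, so
    unlike that of [heat_xxx_bound] their constants may depend on v. *)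
Lemma heat_x_bound v : 0 < v -> exists B : R, forall x, `|- (x / v) * heat v x| <= B.
Proof.
move=> v0; exists ((v^-1 + 2) * heat v 0) => x.
have [b0 b2 _] := heat_bounds x v0 (lexx v).
have h0 := heat_gt0 v x.
rewrite normrM normrN (ger0_norm (ltW h0)) normrM normfV (ger0_norm (ltW v0)).
have x1 : `|x| <= 1 + x ^+ 2.
  by rewrite -(real_normK (num_real x)); have := sqr_ge0 (`|x| - 1 / 2); nra.
apply: (@le_trans _ _ ((1 + x ^+ 2) / v * heat v x)).
  by apply: ler_wpM2r; [exact: ltW|apply: ler_wpM2r; rewrite ?invr_ge0 ?(ltW v0)].
rewrite mulrDl mul1r mulrDl [leRHS]mulrDl; apply: lerD => //.
by apply: ler_wpM2l => //; rewrite invr_ge0 ltW.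
Qed.

Lemma heat_xx_bound v : 0 < v ->
  exists B : R, forall x, `|(x ^+ 2 / v ^+ 2 - v^-1) * heat v x| <= B.
Proof.
move=> v0; exists (3 * v^-1 * heat v 0) => x.
have [b0 b2 _] := heat_bounds x v0 (lexx v).
have h0 := heat_gt0 v x.
have iv0 : 0 <= v^-1 by rewrite invr_ge0 ltW.
have -> : (x ^+ 2 / v ^+ 2 - v^-1) * heat v x = v^-1 * (x ^+ 2 / v * heat v x - heat v x).
  by field; exact: lt0r_neq0.
rewrite normrM (ger0_norm iv0) [leRHS](_ : _ = v^-1 * (3 * heat v 0)); last by ring.
apply: ler_wpM2l => //.
have : 0 <= x ^+ 2 / v * heat v x.
  by rewrite mulr_ge0 ?(ltW h0)// divr_ge0 ?sqr_ge0// ltW.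
by move=> ?; rewrite ler_norml; apply/andP; split; lra.
Qed.

Lemma continuous_heat v : 0 < v -> continuous (heat v).
Proof.
move=> v0; apply: (@derivable_continuous_fun _ (fun x => - (x / v) * heat v x)) => x.
exact/is_derive_heat_x/lt0r_neq0.
Qed.

Lemma continuous_heat_x v : 0 < v -> continuous (fun x => - (x / v) * heat v x).
Proof.
move=> v0; apply: (@derivable_continuous_fun _ (fun x => (x ^+ 2 / v ^+ 2 - v^-1) * heat v x)) => x.
exact/is_derive_heat_xx/lt0r_neq0.
Qed.

Lemma continuous_heat_xx v : 0 < v ->
  continuous (fun x => (x ^+ 2 / v ^+ 2 - v^-1) * heat v x).
Proof.
move=> v0; apply: (@derivable_continuous_fun _
  (fun x => (3 * x / v ^+ 2 - x ^+ 3 / v ^+ 3) * heat v x)) => x.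
exact/is_derive_heat_xxx/lt0r_neq0.
Qed.

End SmoothBounds.

(** * Lindeberg replacement for weighted sums of centred squares *)

Section Lindeberg.
Context (R : realType) (d : measure_display) (Omega : measurableType d)
  (P : probability Omega R) (xi : nat -> Omega -> R).
Hypothesis Hxi : iid_std_normal P xi.

Let mxi j : measurable_fun setT (xi j).
Proof. by case: Hxi. Qed.

(** Covers both the quadratic form (h = [sq1]) and the linear form (h = [id]). The index N itself is
    excluded, so the sum is measurable with respect to the past of N. *)
Definition xi_sum (a : nat -> R) (h : R -> R) (N : nat) (w : Omega) : R :=
  \sum_(1 <= j < N) a j * h (xi j w).

Lemma xi_sum_le1 a h N w : (N <= 1)%N -> xi_sum a h N w = 0.
Proof. by move=> N1; rewrite /xi_sum big_geq. Qed.

Lemma xi_sumS a h N w : (1 <= N)%N -> xi_sum a h N.+1 w = xi_sum a h N w + a N * h (xi N w).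
Proof. by move=> N1; rewrite /xi_sum big_nat_recr. Qed.

Lemma xi_sum_past a h N : measurable_fun setT h -> past_measurable xi N (xi_sum a h N).
Proof.
move=> mh; elim: N => [|[|N] IH].
- rewrite (_ : xi_sum _ _ _ = cst 0); first exact: measurable_cst.
  by apply/funext => w; rewrite xi_sum_le1.
- rewrite (_ : xi_sum _ _ _ = cst 0); first exact: measurable_cst.
  by apply/funext => w; rewrite xi_sum_le1.
rewrite (_ : xi_sum a h N.+2 = fun w => xi_sum a h N.+1 w + a N.+1 * h (xi N.+1 w)); last first.
  by apply/funext => w; rewrite xi_sumS.
apply: measurable_funD; first exact: (past_measurable_le (leqnSn _) IH).
apply: measurable_funM; first exact: measurable_cst.
by apply: (measurableT_comp mh); exact: (xi_past_measurable (ltnSn _)).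
Qed.

Lemma measurable_xi_sum a h N : measurable_fun setT h -> measurable_fun setT (xi_sum a h N).
Proof.
move=> mh; apply: measurable_sum => j; apply: measurable_funM => //.
exact: measurableT_comp.
Qed.

Lemma bounded_integrable (f : Omega -> R) B : measurable_fun setT f ->
  (forall w, `|f w| <= B) -> P.-integrable setT (EFin \o f).
Proof.
move=> mf fB.
have I : P.-integrable setT (EFin \o cst B) by exact: finite_measure_integrable_cst.
apply: le_integrable I => //; first exact/measurable_EFinP.
by move=> w _; rewrite /= lee_fin (le_trans (fB w))// ler_norm.
Qed.

Lemma expectation_constant (c : R) : \int[P]_w c = c.
Proof.
rewrite (@Rintegral_cst _ _ _ P setT measurableT c) -[RHS]mulr1; congr (_ * _).
exact: (congr1 fine (probability_setT P)).
Qed.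

Section SecondMoment.
Variables (h : R -> R) (m : R).
Hypotheses (mh : measurable_fun setT h)
  (ih : forall j, P.-integrable setT (EFin \o (h \o xi j)))
  (ih2 : forall j, P.-integrable setT (EFin \o ((fun x => h x ^+ 2) \o xi j)))
  (Eh : forall j, \int[P]_w h (xi j w) = 0)
  (Eh2 : forall j, \int[P]_w (h (xi j w) ^+ 2) = m).

(** Expanding the square when one summand is added, the cross term has mean zero because h of the
    new variable is centred and independent of the past. *)
Lemma xi_sum_second_moment a N :
  [/\ P.-integrable setT (EFin \o xi_sum a h N),
      P.-integrable setT (EFin \o (fun w => xi_sum a h N w ^+ 2)) &
      \int[P]_w (xi_sum a h N w ^+ 2) = m * \sum_(1 <= j < N) a j ^+ 2].
Proof.
elim: N => [|N].
  have E0 : xi_sum a h 0 = cst 0 by apply/funext => w; rewrite xi_sum_le1.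
  have E2 : (fun w => xi_sum a h 0 w ^+ 2) = cst 0.
    by apply/funext => w; rewrite xi_sum_le1// expr0n.
  have I0 : P.-integrable setT (EFin \o (cst 0 : Omega -> R)).
    exact: finite_measure_integrable_cst.
  by rewrite E2 E0 big_geq// mulr0 Rintegral_cst// mul0r.
case: N => [|N].
  have E0 : xi_sum a h 1 = cst 0 by apply/funext => w; rewrite xi_sum_le1.
  have E1 : xi_sum a h 0 = cst 0 by apply/funext => w; rewrite xi_sum_le1.
  by rewrite E0 E1 !big_geq.
set S := xi_sum a h N.+1 => -[iS iS2 ES2].
have [iSh ESh] := expectation_past Hxi (@xi_sum_past a h N.+1 mh) mh iS (ih N.+1).
rewrite Eh mulr0 in ESh.
have iah : P.-integrable setT (EFin \o (fun w => a N.+1 * h (xi N.+1 w))).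
  exact: (integrableZl measurableT (a N.+1) (ih N.+1)).
have i2 : P.-integrable setT (EFin \o (fun w => 2 * a N.+1 * (S w * h (xi N.+1 w)))).
  exact: (integrableZl measurableT (2 * a N.+1) iSh).
have i3 : P.-integrable setT (EFin \o (fun w => a N.+1 ^+ 2 * h (xi N.+1 w) ^+ 2)).
  exact: (integrableZl measurableT (a N.+1 ^+ 2) (ih2 N.+1)).
have i12 : P.-integrable setT (EFin \o (fun w => S w ^+ 2 + 2 * a N.+1 * (S w * h (xi N.+1 w)))).
  exact: (integrableD measurableT iS2 i2).
have E1 : xi_sum a h N.+2 = fun w => S w + a N.+1 * h (xi N.+1 w).
  by apply/funext => w; rewrite xi_sumS.
have E2 : (fun w => xi_sum a h N.+2 w ^+ 2) =
    fun w => (S w ^+ 2 + 2 * a N.+1 * (S w * h (xi N.+1 w))) + a N.+1 ^+ 2 * h (xi N.+1 w) ^+ 2.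
  by apply/funext => w; rewrite xi_sumS// -/S; ring.
split.
- by rewrite E1; exact: (integrableD measurableT iS iah).
- by rewrite E2; exact: (integrableD measurableT i12 i3).
- rewrite E2 RintegralD// RintegralD// ES2.
  rewrite (@RintegralZl _ _ _ P setT (fun w => S w * h (xi N.+1 w)))// ESh.
  rewrite (@RintegralZl _ _ _ P setT (fun w => h (xi N.+1 w) ^+ 2))//; last exact: ih2.
  by rewrite Eh2 [in RHS]big_nat_recr//=; ring.
Qed.

End SecondMoment.

Definition sq1 (x : R) : R := x ^+ 2 - 1.

Lemma measurable_sq1 : measurable_fun setT sq1.
Proof. by apply: measurable_funB => //; exact: measurable_funX. Qed.

Let poly4 (a b c x : R) := a * x ^+ 4 + b * x ^+ 2 + c.

Let m_poly4 a b c : measurable_fun setT (poly4 a b c).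
Proof.
apply: measurable_funD => //; apply: measurable_funD => //.
  by apply: measurable_funM => //; exact: exprn_measurable.
by apply: measurable_funM => //; exact: exprn_measurable.
Qed.

Let i_poly4 a b c j : P.-integrable setT (EFin \o (poly4 a b c \o xi j)).
Proof.
apply: (@integrable_xi _ _ _ _ _ Hxi j _ (`|a| + `|b| + `|c|)) => // x.
have x6 : 0 <= x ^+ 6 by exact: exprn_even_ge0.
have [_ x2 x4] := pow_le_1D6 x.
rewrite /poly4 !mulrDl; apply: le_trans (ler_normD _ _) _; apply: lerD.
  apply: le_trans (ler_normD _ _) _; rewrite (normrM a) (normrM b); apply: lerD; apply: ler_wpM2l => //.
  - by rewrite ger0_norm// exprn_even_ge0.
  - by rewrite ger0_norm// sqr_ge0.
by rewrite ler_peMr// lerDl.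
Qed.

(** The polynomial is rewritten as a combination of the two centred functions x^4 - 3 x^2 and x^2 -
    1 plus a constant. *)
Lemma expectation_poly4 a b c j :
  \int[P]_w (a * xi j w ^+ 4 + b * xi j w ^+ 2 + c) = 3 * a + b + c.
Proof.
have i4 : P.-integrable setT (EFin \o (fun w => xi j w ^+ 4 - 3 * xi j w ^+ 2)).
  have := i_poly4 1 (- 3) 0 j; congr (P.-integrable _ (EFin \o _)).
  by apply/funext => w; rewrite /poly4 /=; ring.
have i2 : P.-integrable setT (EFin \o (fun w => xi j w ^+ 2 - 1)).
  have := i_poly4 0 1 (-1) j; congr (P.-integrable _ (EFin \o _)).
  by apply/funext => w; rewrite /poly4 /=; ring.
have iA : P.-integrable setT (EFin \o (fun w => a * (xi j w ^+ 4 - 3 * xi j w ^+ 2))).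
  exact: (integrableZl measurableT a i4).
have iB : P.-integrable setT (EFin \o (fun w => (3 * a + b) * (xi j w ^+ 2 - 1))).
  exact: (integrableZl measurableT (3 * a + b) i2).
have iC : P.-integrable setT (EFin \o (fun=> 3 * a + b + c) : Omega -> \bar R).
  exact: finite_measure_integrable_cst.
have iAB : P.-integrable setT (EFin \o (fun w =>
    a * (xi j w ^+ 4 - 3 * xi j w ^+ 2) + (3 * a + b) * (xi j w ^+ 2 - 1))).
  exact: (integrableD measurableT iA iB).
transitivity (\int[P]_w (a * (xi j w ^+ 4 - 3 * xi j w ^+ 2) + (3 * a + b) * (xi j w ^+ 2 - 1)
    + (3 * a + b + c))).
  by apply: eq_Rintegral => w _; ring.
rewrite RintegralD// RintegralD// (RintegralZl _ measurableT i4) (RintegralZl _ measurableT i2).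
rewrite (expectation_xi4 Hxi) (expectation_xi2 Hxi) !mulr0 !add0r.
exact: expectation_constant.
Qed.

Lemma integrable_sq1 j : P.-integrable setT (EFin \o (sq1 \o xi j)).
Proof.
have := i_poly4 0 1 (-1) j; congr (P.-integrable _ (EFin \o _)).
by apply/funext => w; rewrite /poly4 /sq1 /=; ring.
Qed.

Lemma integrable_sq1_sqr j : P.-integrable setT (EFin \o ((fun x => sq1 x ^+ 2) \o xi j)).
Proof.
have := i_poly4 1 (- 2) 1 j; congr (P.-integrable _ (EFin \o _)).
by apply/funext => w; rewrite /poly4 /sq1 /=; ring.
Qed.

Lemma expectation_sq1_sqr j : \int[P]_w (sq1 (xi j w) ^+ 2) = 2.
Proof.
transitivity (\int[P]_w (1 * xi j w ^+ 4 + - 2 * xi j w ^+ 2 + 1)).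
  by apply: eq_Rintegral => w _; rewrite /sq1; ring.
by rewrite expectation_poly4; ring.
Qed.

Lemma sq1_sum_second_moment a N :
  [/\ P.-integrable setT (EFin \o xi_sum a sq1 N),
      P.-integrable setT (EFin \o (fun w => xi_sum a sq1 N w ^+ 2)) &
      \int[P]_w (xi_sum a sq1 N w ^+ 2) = 2 * \sum_(1 <= j < N) a j ^+ 2].
Proof.
apply: (xi_sum_second_moment measurable_sq1 integrable_sq1 integrable_sq1_sqr _ expectation_sq1_sqr).
exact: (expectation_xi2 Hxi).
Qed.

Lemma id_sum_second_moment a N :
  [/\ P.-integrable setT (EFin \o xi_sum a id N),
      P.-integrable setT (EFin \o (fun w => xi_sum a id N w ^+ 2)) &
      \int[P]_w (xi_sum a id N w ^+ 2) = \sum_(1 <= j < N) a j ^+ 2].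
Proof.
rewrite -[X in _ = X]mul1r.
apply: (@xi_sum_second_moment id 1) => //.
- move=> j; apply: (@integrable_xi _ _ _ _ _ Hxi j id 1) => // x.
  by rewrite mul1r; have [] := pow_le_1D6 x.
- move=> j; have := i_poly4 0 1 0 j; congr (P.-integrable _ (EFin \o _)).
  by apply/funext => w; rewrite /poly4 /=; ring.
- exact: (expectation_xi Hxi).
- move=> j; transitivity (\int[P]_w (0 * xi j w ^+ 4 + 1 * xi j w ^+ 2 + 0)).
    by apply: eq_Rintegral => w _; ring.
  by rewrite expectation_poly4; ring.
Qed.

Let abs_sq1_cube (x : R) : `| `|sq1 x| ^+ 3| <= 1 * (1 + x ^+ 6).
Proof.
have x6 : x ^+ 6 = (x ^+ 2) ^+ 3 by rewrite -exprM.
rewrite ger0_norm ?exprn_ge0// mul1r x6 /sq1; have := sqr_ge0 x; move: (x ^+ 2) => y y0.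
have [y1|y1] := lerP 1 y.
  rewrite (@le_trans _ _ (y ^+ 3))// ?lerDr//.
  by rewrite lerXn2r ?nnegrE ?subr_ge0// gerBl.
rewrite (@le_trans _ _ 1)// ?lerDl ?exprn_ge0//.
by rewrite exprn_ile1// ?subr_ge0 ?(ltW y1)// gerBl.
Qed.

Let m_abs_sq1 : measurable_fun setT (fun x => `|sq1 x| ^+ 3).
Proof. by apply: measurable_funX; apply: measurableT_comp => //; exact: measurable_sq1. Qed.

(** [heat_step] is applied with y = a_N (xi_N^2 - 1) and s = 2 a_N^2, the variance of y. The
    coefficients y and (y^2 - s)/2 are centred and independent of the past, so both Taylor terms
    integrate to zero and only the remainder |y|^3 + s^2 is left. *)
Lemma heat_sum_step (dl : R) : 0 < dl -> exists2 C : R, 0 <= C & forall (a : nat -> R) N v t,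
  (1 <= N)%N -> dl <= v ->
  `|\int[P]_w heat v (xi_sum a sq1 N.+1 w - t)
    - \int[P]_w heat (v + 2 * a N ^+ 2) (xi_sum a sq1 N w - t)|
  <= C * (`|a N| ^+ 3 + a N ^+ 4).
Proof.
move=> dl0; have [C C0 step] := heat_step dl0.
(* The third absolute moment of xi_j^2 - 1, the same for every j; it enters only through the
   constant. *)
pose m3 : R := fine (\int[@lebesgue_measure R]_x (`|sq1 x| ^+ 3 * normal_pdf 0 1 x)%:E)%E.
have m3E j : \int[P]_w `|sq1 (xi j w)| ^+ 3 = m3.
  exact: (@expectation_xiE _ _ _ _ _ Hxi j (fun x => `|sq1 x| ^+ 3) 1 m_abs_sq1 abs_sq1_cube).
have m30 : 0 <= m3 by rewrite -(m3E 0%N); apply: Rintegral_ge0 => w _; rewrite exprn_ge0.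
exists (C * (m3 + 4)); first by rewrite mulr_ge0// addr_ge0.
move=> a N v t N1 dv.
have v0 : 0 < v by exact: lt_le_trans dv.
set b := a N; set s := 2 * b ^+ 2.
have s0 : 0 <= s by rewrite mulr_ge0// sqr_ge0.
have vs0 : 0 < v + s by rewrite ltr_wpDr.
set S := xi_sum a sq1 N.
have pS : past_measurable xi N (fun w => S w - t).
  by apply: measurable_funB; [exact: (xi_sum_past a measurable_sq1)|exact: measurable_cst].
have mS := past_measurable_fun Hxi pS.
pose A (x : R) := - (x / v) * heat v x.
pose B (x : R) := (x ^+ 2 / v ^+ 2 - v^-1) * heat v x.
have mA : measurable_fun setT A := continuous_measurable_fun (continuous_heat_x v0).
have mB : measurable_fun setT B := continuous_measurable_fun (continuous_heat_xx v0).
have [bA HA] := heat_x_bound v0; have [bB HB] := heat_xx_bound v0.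
pose hA (z : R) := b * sq1 z.
pose hB (z : R) := ((b * sq1 z) ^+ 2 - s) / 2.
have mhA : measurable_fun setT hA by apply: measurable_funM => //; exact: measurable_sq1.
have mhB : measurable_fun setT hB.
  apply: measurable_funM => //; apply: measurable_funB => //.
  exact: measurable_funX.
have iA : P.-integrable setT (EFin \o (fun w => A (S w - t))).
  exact: (bounded_integrable (measurableT_comp mA mS) (fun w => HA _)).
have iB : P.-integrable setT (EFin \o (fun w => B (S w - t))).
  exact: (bounded_integrable (measurableT_comp mB mS) (fun w => HB _)).
have ihA : P.-integrable setT (EFin \o (hA \o xi N)).
  exact: (integrableZl measurableT b (integrable_sq1 N)).
(* By the fourth moment 3 the mean is b^2 (3/2 - 1 - 1/2) = 0. *)
have hBE w : hB (xi N w) = b ^+ 2 / 2 * xi N w ^+ 4 + - b ^+ 2 * xi N w ^+ 2 + - (b ^+ 2 / 2).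
  by rewrite /hB /sq1 /s; field.
have ihB : P.-integrable setT (EFin \o (hB \o xi N)).
  have := i_poly4 (b ^+ 2 / 2) (- b ^+ 2) (- (b ^+ 2 / 2)) N.
  by congr (P.-integrable _ (EFin \o _)); apply/funext => w /=; rewrite hBE.
have EhA : \int[P]_w hA (xi N w) = 0.
  by rewrite (RintegralZl _ measurableT (integrable_sq1 N)) (expectation_xi2 Hxi) mulr0.
have EhB : \int[P]_w hB (xi N w) = 0.
  under eq_Rintegral do rewrite hBE.
  by rewrite expectation_poly4; field.
have pA : past_measurable xi N (fun w => A (S w - t)) by exact: (measurableT_comp mA pS).
have pB : past_measurable xi N (fun w => B (S w - t)) by exact: (measurableT_comp mB pS).
have [iAA EAA] := expectation_past Hxi pA mhA iA ihA.
have [iBB EBB] := expectation_past Hxi pB mhB iB ihB.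
rewrite EhA mulr0 in EAA; rewrite EhB mulr0 in EBB.
have mheat (u : R) : 0 < u -> measurable_fun setT (heat u).
  by move=> u0; exact: (continuous_measurable_fun (continuous_heat u0)).
have i1 : P.-integrable setT (EFin \o (fun w => heat v (S w - t + hA (xi N w)))).
  apply: (@bounded_integrable _ (heat v 0)).
    apply: (measurableT_comp (mheat v v0)); apply: measurable_funD => //.
    exact: measurableT_comp.
  by move=> w; rewrite ger0_norm ?(ltW (heat_gt0 _ _))// heat_le_diag.
have i2 : P.-integrable setT (EFin \o (fun w => heat (v + s) (S w - t))).
  apply: (@bounded_integrable _ (heat (v + s) 0)).
    exact: (measurableT_comp (mheat _ vs0)).
  by move=> w; rewrite ger0_norm ?(ltW (heat_gt0 _ _))// heat_le_diag.
have i12 := integrableB measurableT i1 i2.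
have i12A := integrableB measurableT i12 iAA.
have iD := integrableB measurableT i12A iBB.
pose D w := heat v (S w - t + hA (xi N w)) - heat (v + s) (S w - t)
  - A (S w - t) * hA (xi N w) - B (S w - t) * hB (xi N w).
have ED : \int[P]_w D w = \int[P]_w heat v (xi_sum a sq1 N.+1 w - t)
    - \int[P]_w heat (v + s) (S w - t).
  rewrite /D (@RintegralB _ _ _ P setT (fun w => heat v (S w - t + hA (xi N w)) - heat (v + s) (S w - t)
    - A (S w - t) * hA (xi N w)))//.
  rewrite (@RintegralB _ _ _ P setT (fun w => heat v (S w - t + hA (xi N w)) - heat (v + s) (S w - t)))//.
  rewrite EAA EBB !subr0 (@RintegralB _ _ _ P setT (fun w => heat v (S w - t + hA (xi N w))))//.
  by congr (_ - _); apply: eq_Rintegral => w _; rewrite xi_sumS// -/S /hA addrAC.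
rewrite -ED.
apply: le_trans (le_normr_Rintegral measurableT iD) _.
have i3 : P.-integrable setT (EFin \o (fun w => `|sq1 (xi N w)| ^+ 3)).
  exact: (@integrable_xi _ _ _ _ _ Hxi N (fun x => `|sq1 x| ^+ 3) 1 m_abs_sq1 abs_sq1_cube).
have i3b : P.-integrable setT (EFin \o (fun w => C * `|b| ^+ 3 * `|sq1 (xi N w)| ^+ 3)).
  exact: (integrableZl measurableT (C * `|b| ^+ 3) i3).
have ic : P.-integrable setT (EFin \o (cst (C * s ^+ 2) : Omega -> R)).
  exact: finite_measure_integrable_cst.
apply: (@le_trans _ _ (\int[P]_w (C * `|b| ^+ 3 * `|sq1 (xi N w)| ^+ 3 + C * s ^+ 2))).
  apply: le_Rintegral => //.
  - exact: (integrable_norm iD).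
  - exact: (integrableD measurableT i3b ic).
  move=> w _; have := step v s (S w - t) (hA (xi N w)) dv s0.
  set lhs := (X in `|X| <= _) => H.
  rewrite [X in `|X| <= _](_ : _ = lhs); last by rewrite /lhs /A /B /hB /hA; ring.
  apply: le_trans H _; rewrite /hA normrM le_eqVlt; apply/orP; left; apply/eqP; ring.
rewrite (RintegralD measurableT i3b ic) expectation_constant (RintegralZl _ measurableT i3) m3E.
have -> : s ^+ 2 = 4 * b ^+ 4 by rewrite /s; ring.
have b3 : 0 <= `|b| ^+ 3 by rewrite exprn_ge0.
have b4 : 0 <= b ^+ 4 by rewrite exprn_even_ge0.
rewrite -!mulrA -mulrDr; apply: ler_wpM2l => //.
rewrite mulrDr !mulrDl (mulrC m3 (`|b| ^+ 3)).
have := mulr_ge0 m30 b4; lra.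
Qed.

(** Summands are removed from the last to the first, each adding its variance to the kernel. The
    kernel variance never drops below [dl], so one constant serves every step; when the sum is
    exhausted, the expectation is the kernel at -t. *)
Lemma heat_sum_lindeberg (dl : R) : 0 < dl -> exists2 C : R, 0 <= C & forall (a : nat -> R) N t,
  `|\int[P]_w heat dl (xi_sum a sq1 N w - t) - heat (dl + 2 * \sum_(1 <= j < N) a j ^+ 2) (- t)|
  <= C * \sum_(1 <= j < N) (`|a j| ^+ 3 + a j ^+ 4).
Proof.
move=> dl0; have [C C0 step] := heat_sum_step dl0; exists C => // a N t.
(* The induction needs an arbitrary starting variance, since removing a summand changes it. *)
suff H v : dl <= v ->
  `|\int[P]_w heat v (xi_sum a sq1 N w - t) - heat (v + 2 * \sum_(1 <= j < N) a j ^+ 2) (- t)|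
  <= C * \sum_(1 <= j < N) (`|a j| ^+ 3 + a j ^+ 4) by exact: H.
have base n u : (n <= 1)%N ->
  `|\int[P]_w heat u (xi_sum a sq1 n w - t) - heat (u + 2 * \sum_(1 <= j < n) a j ^+ 2) (- t)|
  <= C * \sum_(1 <= j < n) (`|a j| ^+ 3 + a j ^+ 4).
  move=> n1; rewrite !big_geq// !mulr0 addr0.
  under eq_Rintegral do rewrite xi_sum_le1// sub0r.
  by rewrite expectation_constant subrr normr0.
elim: N v => [|[|N] IH] v dv; [exact: base|exact: base|].
rewrite !(@big_nat_recr _ _ _ N.+1)//=.
set V := \sum_(1 <= j < N.+1) a j ^+ 2; set B := \sum_(1 <= j < N.+1) (_ + _).
have st := step a N.+1 v t isT dv.
have := IH (v + 2 * a N.+1 ^+ 2); rewrite -/V -/B.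
have dv2 : dl <= v + 2 * a N.+1 ^+ 2.
  by apply: le_trans dv _; rewrite lerDl mulr_ge0// sqr_ge0.
move=> /(_ dv2); rewrite (_ : v + 2 * a N.+1 ^+ 2 + 2 * V = v + 2 * (V + a N.+1 ^+ 2)); last by ring.
move=> ih; apply: le_trans (ler_distD (\int[P]_w heat (v + 2 * a N.+1 ^+ 2) (xi_sum a sq1 N.+1 w - t)) _ _) _.
by rewrite [leRHS]mulrDr [leRHS]addrC lerD.
Qed.

End Lindeberg.

Arguments sq1 {R} x.

(** * Uniform bounds on interval probabilities of limits of quadratic forms *)

Section Concentration.
Context (R : realType) (d : measure_display) (Omega : measurableType d)
  (P : probability Omega R) (xi : nat -> Omega -> R).
Hypothesis Hxi : iid_std_normal P xi.

Definition Pr (A : set Omega) : R := fine (P A).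

Lemma Pr_ge0 A : 0 <= Pr A.
Proof. exact/fine_ge0/measure_ge0. Qed.

Lemma PrK A : measurable A -> (Pr A)%:E = P A.
Proof. by move=> mA; rewrite fineK// fin_num_measure. Qed.

Lemma Pr_le1 A : measurable A -> Pr A <= 1.
Proof. by move=> mA; rewrite -lee_fin PrK// probability_le1. Qed.

Lemma Pr_le A B : measurable A -> measurable B -> A `<=` B -> Pr A <= Pr B.
Proof. by move=> mA mB AB; rewrite -lee_fin !PrK// le_measure ?inE. Qed.

Lemma Pr_setU A B : measurable A -> measurable B -> Pr (A `|` B) <= Pr A + Pr B.
Proof.
move=> mA mB; rewrite -lee_fin EFinD !PrK//; last exact: measurableU.
exact: measureU2.
Qed.

Lemma Pr_setC A : measurable A -> Pr (~` A) = 1 - Pr A.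
Proof.
move=> mA; apply: EFin_inj; rewrite EFinB !PrK//; last exact: measurableC.
exact: probability_setC.
Qed.

Lemma Pr_setUI0 A B : measurable A -> measurable B -> A `&` B = set0 ->
  Pr (A `|` B) = Pr A + Pr B.
Proof.
move=> mA mB AB; apply: EFin_inj; rewrite EFinD !PrK//; last exact: measurableU.
exact: measureU.
Qed.

Lemma expectation_indicator A : measurable A -> \int[P]_w \1_A w = Pr A.
Proof. by move=> mA; rewrite /Rintegral integral_indic// setIT. Qed.

Let i_indic A (c : R) : measurable A -> P.-integrable setT (EFin \o (fun w => c * \1_A w)).
Proof.
move=> mA; apply: (@bounded_integrable _ _ _ _ _ `|c|).
  by apply: measurable_funM => //; exact: measurable_indic.
by move=> w; rewrite normrM ler_piMr// indicE; case: (_ \in _); rewrite ?normr1 ?normr0.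
Qed.

Lemma markov_lower A (c : R) (f : Omega -> R) : measurable A ->
  P.-integrable setT (EFin \o f) -> (forall w, c * \1_A w <= f w) ->
  c * Pr A <= \int[P]_w f w.
Proof.
move=> mA iF cf; rewrite -(expectation_indicator mA).
have i1 : P.-integrable setT (EFin \o (\1_A : Omega -> R)).
  have := i_indic 1 mA; congr (P.-integrable _ (EFin \o _)).
  by apply/funext => w; rewrite mul1r.
rewrite -(RintegralZl c measurableT i1); apply: le_Rintegral => //; first exact: i_indic.
Qed.

Lemma markov_upper A (c k : R) (f : Omega -> R) : measurable A ->
  P.-integrable setT (EFin \o f) -> (forall w, f w <= c * \1_A w + k) ->
  \int[P]_w f w <= c * Pr A + k.
Proof.
move=> mA iF cf.
have ik : P.-integrable setT (EFin \o (cst k : Omega -> R)).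
  exact: finite_measure_integrable_cst.
have i1 : P.-integrable setT (EFin \o (\1_A : Omega -> R)).
  have := i_indic 1 mA; congr (P.-integrable _ (EFin \o _)).
  by apply/funext => w; rewrite mul1r.
have iC := i_indic c mA.
apply: (@le_trans _ _ (\int[P]_w (c * \1_A w + k))).
  apply: le_Rintegral => //.
  exact: (integrableD measurableT iC ik).
rewrite (RintegralD measurableT iC ik) (RintegralZl c measurableT i1).
by rewrite expectation_indicator// expectation_constant.
Qed.

Lemma expectation_limit (S : nat -> Omega -> R) (X : Omega -> R) (g : R -> R) B :
  (forall N, measurable_fun setT (S N)) -> measurable_fun setT X ->
  {ae P, forall w, S N w @[N --> \oo] --> X w} ->
  continuous g -> (forall x, `|g x| <= B) ->
  (\int[P]_w g (S N w)) @[N --> \oo] --> \int[P]_w g (X w).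
Proof.
move=> mS mX SX cg gB.
have mg := continuous_measurable_fun cg.
have m1 N : measurable_fun setT (fun w => (g (S N w))%:E).
  by apply/measurable_EFinP; exact: (measurableT_comp mg (mS N)).
have m2 : measurable_fun setT (fun w => (g (X w))%:E).
  by apply/measurable_EFinP; exact: (measurableT_comp mg mX).
have iB : P.-integrable setT (EFin \o (cst B : Omega -> R)).
  exact: finite_measure_integrable_cst.
have [] := @dominated_convergence _ _ _ P setT measurableT
  (fun N w => (g (S N w))%:E) (fun w => (g (X w))%:E) (EFin \o cst B) m1 m2 _ iB _.
- apply: filterS SX => w Sw _.
  apply: cvg_EFin; first by near=> N.
  exact: (cvg_comp _ _ Sw (cg (X w))).
- by apply: aeW => w N _; rewrite /= lee_fin.
move=> iX _ lim.
rewrite /Rintegral; apply: fine_cvg.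
rewrite fineK; last exact: integrable_fin_num.
exact: lim.
Unshelve. all: by end_near. Qed.

(** Only the approximations have a known second moment. Markov's inequality is therefore applied to
    min(x^2, M^2), a bounded continuous function whose expectations pass to the almost sure
    limit. *)
Lemma truncated_chebyshev (S : nat -> Omega -> R) (X : Omega -> R) (v M : R) :
  (forall N, measurable_fun setT (S N)) -> measurable_fun setT X ->
  {ae P, forall w, S N w @[N --> \oo] --> X w} ->
  (forall N, P.-integrable setT (EFin \o (fun w => S N w ^+ 2))) ->
  (forall N, \int[P]_w (S N w ^+ 2) <= v) -> 0 < M ->
  Pr [set w | M <= `|X w|] <= v / M ^+ 2.
Proof.
move=> mS mX SX iS Sv M0.
pose g (x : R) := Num.min (x ^+ 2) (M ^+ 2).
have cg : continuous g.
  apply: (@min_fun_continuous _ _ _ (fun x : R => x ^+ 2) (fun=> M ^+ 2)).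
    exact: exprn_continuous.
  by move=> x; exact: cvg_cst.
have M20 : 0 < M ^+ 2 by rewrite exprn_gt0.
have g0 x : 0 <= g x by rewrite le_min sqr_ge0 ltW.
have gB x : `|g x| <= M ^+ 2 by rewrite ger0_norm// ge_min lexx orbT.
have mg := continuous_measurable_fun cg.
have lim := expectation_limit mS mX SX cg gB.
have Ev : \int[P]_w g (X w) <= v.
  apply: (cvgr_to_le lim); near=> N; apply: le_trans (Sv N).
  apply: le_Rintegral => //.
    exact: (bounded_integrable P (measurableT_comp mg (mS N)) (fun w => gB _)).
  by move=> w _; rewrite /g ge_min lexx.
rewrite ler_pdivlMr// mulrC; apply: le_trans Ev.
apply: markov_lower.
- rewrite (_ : [set w | _] = (fun w => `|X w|) @^-1` `[M, +oo[%classic); last first.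
    by apply/seteqP; split => w /=; rewrite in_itv/= andbT.
  rewrite -[X in measurable X]setTI.
  have mn : measurable_fun setT (fun w => `|X w|) by exact: measurableT_comp.
  exact: mn.
- exact: (bounded_integrable P (measurableT_comp mg mX) (fun w => gB _)).
- move=> w; rewrite indicE; case: (boolP (_ \in _)) => [|_].
    rewrite inE /= => Mw; rewrite mulr1 /g le_min lexx andbT.
    by rewrite -(real_normK (num_real (X w))) lerXn2r ?nnegrE// ltW.
  by rewrite mulr0.
Unshelve. all: by end_near. Qed.

(** The class over which the estimates below are uniform: almost sure limits of quadratic forms with
    the sum of squared coefficients (half the variance) between [v0] and [v1] and every coefficient
    at most [e]. The lower bound is required of one partial sum and is inherited by all later
    ones. *)
Definition quad_limit (a : nat -> R) (X : Omega -> R) (v0 v1 e : R) : Prop :=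
  [/\ measurable_fun setT X,
      {ae P, forall w, xi_sum xi a sq1 N w @[N --> \oo] --> X w},
      (forall j, (1 <= j)%N -> `|a j| <= e),
      (forall N, \sum_(1 <= j < N) a j ^+ 2 <= v1) &
      (exists N0, v0 <= \sum_(1 <= j < N0) a j ^+ 2)].

Lemma heat_sqr0 (q : R) : 0 < q -> heat (q ^+ 2) 0 = q^-1.
Proof.
move=> q0; rewrite /heat expr0n/= mul0r subr0 lnXn// expRN; congr (_^-1).
rewrite -[RHS](lnK q0) ?posrE//; congr expR.
by rewrite mulr2n; field.
Qed.

Lemma heat0_le (u v : R) : 0 < u -> u <= v -> heat v 0 <= heat u 0.
Proof. by move=> u0 uv; have [] := heat_bounds 0 u0 uv. Qed.

(** For coefficients at most e <= 1, |a|^3 + a^4 <= 2 e a^2, so the replacement error is at most C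
    (2 e v1) and survives the limit. The lower bound combines the worst height, at the largest
    variance, with the worst exponent, at the smallest. *)
Lemma quad_limit_heat (dl : R) : 0 < dl -> exists2 C : R, 0 <= C & forall a X (v0 v1 e t : R),
  0 < v0 -> 0 <= e -> e <= 1 -> quad_limit a X v0 v1 e ->
  \int[P]_w heat dl (X w - t) <= heat (2 * v0) 0 + C * (2 * e * v1) /\
  expR (- (ln (dl + 2 * v1) / 2) - t ^+ 2 / (4 * v0)) - C * (2 * e * v1)
    <= \int[P]_w heat dl (X w - t).
Proof.
move=> dl0; have [C C0 HC] := heat_sum_lindeberg Hxi dl0; exists C => //.
move=> a X v0 v1 e t v00 e0 e1 [mX aeX ae av1 [N0 av0]].
have ch : continuous (fun x => heat dl (x - t)).
  move=> x; apply: (@continuous_comp _ _ _ (fun x => x - t) (heat dl)).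
    by apply: cvgB; [exact: cvg_id|exact: cvg_cst].
  exact: continuous_heat.
have bh x : `|heat dl (x - t)| <= heat dl 0.
  by rewrite ger0_norm ?(ltW (heat_gt0 _ _))// heat_le_diag.
have mS N := measurable_xi_sum Hxi a N (@measurable_sq1 R).
have lim := expectation_limit mS mX aeX ch bh.
have err N : C * \sum_(1 <= j < N) (`|a j| ^+ 3 + a j ^+ 4) <= C * (2 * e * v1).
  apply: ler_wpM2l => //; apply: (@le_trans _ _ (2 * e * \sum_(1 <= j < N) a j ^+ 2)); last first.
    by apply: ler_wpM2l => //; rewrite mulr_ge0.
  rewrite mulr_sumr !big_nat; apply: ler_sum => j /andP[j1 _].
  have aj := ae j j1; have aj0 := normr_ge0 (a j).
  have -> : a j ^+ 4 = `|a j| ^+ 4 by rewrite -normrX ger0_norm// exprn_even_ge0.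
  have -> : a j ^+ 2 = `|a j| ^+ 2 by rewrite real_normK ?num_real.
  have -> : `|a j| ^+ 3 + `|a j| ^+ 4 = (`|a j| + `|a j| ^+ 2) * `|a j| ^+ 2 by ring.
  apply: ler_wpM2r; first exact: sqr_ge0.
  nra.
have mono N : (N0 <= N)%N -> v0 <= \sum_(1 <= j < N) a j ^+ 2.
  move=> NN; apply: le_trans av0 _.
  have [N01|N01] := leqP N0 1; first by rewrite big_geq//; apply: sumr_ge0 => *; exact: sqr_ge0.
  rewrite (@big_cat_nat _ _ _ N0 1 N)//=; last exact: ltnW.
  by rewrite lerDl; apply: sumr_ge0 => *; exact: sqr_ge0.
split.
  apply: (cvgr_to_le lim); near=> N.
  have NN : (N0 <= N)%N by near: N; exact: nbhs_infty_ge.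
  have := HC a N t; rewrite ler_norml => /andP[_ H].
  have := err N; have v0N := mono N NN.
  set V := \sum_(1 <= j < N) a j ^+ 2 in v0N H *.
  have V0 : 0 < dl + 2 * V by rewrite addr_gt0// mulr_gt0//; exact: lt_le_trans v0N.
  have h1 : heat (dl + 2 * V) (- t) <= heat (dl + 2 * V) 0 by exact: heat_le_diag.
  have h2 : heat (dl + 2 * V) 0 <= heat (2 * v0) 0.
    by apply: heat0_le; [rewrite mulr_gt0|lra].
  by move=> ?; lra.
apply: (cvgr_to_ge lim); near=> N.
have NN : (N0 <= N)%N by near: N; exact: nbhs_infty_ge.
have := HC a N t; rewrite ler_norml => /andP[H _].
have := err N; have v0N := mono N NN; have v1N := av1 N.
set V := \sum_(1 <= j < N) a j ^+ 2 in v0N v1N H *.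
have V0 : 0 < dl + 2 * V by rewrite addr_gt0// mulr_gt0//; exact: lt_le_trans v0N.
have h1 : expR (- (ln (dl + 2 * v1) / 2) - t ^+ 2 / (4 * v0)) <= heat (dl + 2 * V) (- t).
  rewrite /heat ler_expR sqrrN; apply: lerD.
    by rewrite lerN2 ler_pM2r// ler_ln ?posrE; lra.
  rewrite lerN2; apply: ler_wpM2l; first exact: sqr_ge0.
  rewrite lef_pV2 ?posrE; lra.
by move=> ?; lra.
Unshelve. all: by end_near. Qed.

Let m_near (X : Omega -> R) (t eta : R) : measurable_fun setT X ->
  measurable [set w : Omega | `|X w - t| <= eta].
Proof.
move=> mX; rewrite (_ : [set w | _] = (fun w => `|X w - t|) @^-1` `]-oo, eta]%classic); last first.
  by apply/seteqP; split => w /=; rewrite in_itv/=.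
rewrite -[X in measurable X]setTI.
have mn : measurable_fun setT (fun w => `|X w - t|).
  by apply: measurableT_comp => //; exact: measurable_funB.
exact: mn.
Qed.

Let i_heat (X : Omega -> R) (dl t : R) : 0 < dl -> measurable_fun setT X ->
  P.-integrable setT (EFin \o (fun w => heat dl (X w - t))).
Proof.
move=> dl0 mX; apply: (@bounded_integrable _ _ _ _ _ (heat dl 0)).
  apply: (measurableT_comp (continuous_measurable_fun (continuous_heat dl0))).
  exact: measurable_funB.
by move=> w; rewrite ger0_norm ?(ltW (heat_gt0 _ _))// heat_le_diag.
Qed.

(** A kernel of variance q^2 is at least exp(-1/2)/q on an interval of half-width q, while its
    expectation stays below a bound independent of q. The probability is thus of order q. *)
Lemma quad_limit_anticoncentration (v0 v1 eps : R) : 0 < v0 -> 0 <= v1 -> 0 < eps ->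
  exists eta e : R, [/\ 0 < eta, 0 < e & forall a X t, quad_limit a X v0 v1 e ->
    Pr [set w | `|X w - t| <= eta] <= eps].
Proof.
move=> v00 v10 eps0; pose H0 := heat (2 * v0) 0.
have H00 : 0 < H0 := heat_gt0 _ _.
(* Chosen so that q exp(1/2) (H0 + 1) = eps. The summand 1 leaves room for the replacement error,
   whose constant depends on q; hence q is fixed before the bound 1/K on the coefficients. *)
pose q := eps / (expR (1 / 2) * (H0 + 1)).
have Q0 : 0 < expR (1 / 2) * (H0 + 1) by rewrite mulr_gt0 ?expR_gt0// addr_gt0.
have q0 : 0 < q by rewrite divr_gt0.
have [C C0 HC] := quad_limit_heat (exprn_gt0 2 q0).
pose K := 2 * C * v1 + 1.
have K0 : 1 <= K by rewrite lerDr !mulr_ge0.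
exists q, K^-1; split=> //; first by rewrite invr_gt0 (lt_le_trans ltr01).
move=> a X t QX.
have K0' : 0 < K by exact: lt_le_trans K0.
have [Hup _] := HC a X v0 v1 K^-1 t v00 (ltW (eqbRL (invr_gt0 _) K0')) (eqbRL (invf_le1 K0') K0) QX.
have KC : C * (2 * K^-1 * v1) <= 1.
  have -> : C * (2 * K^-1 * v1) = (2 * C * v1) / K by rewrite -!mulrA; ring.
  by rewrite ler_pdivrMr// mul1r lerDl.
have mX : measurable_fun setT X by case: QX.
have mk := @markov_lower [set w | `|X w - t| <= q] (q^-1 * expR (- (1 / 2)))
  (fun w => heat (q ^+ 2) (X w - t)) (m_near _ _ mX) (i_heat _ (exprn_gt0 2 q0) mX).
have : q^-1 * expR (- (1 / 2)) * Pr [set w | `|X w - t| <= q] <= H0 + 1.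
  apply: le_trans (mk _) _; last by apply: le_trans Hup _; rewrite lerD2l.
  move=> w; rewrite indicE; case: (boolP (_ \in _)) => [|_]; last by rewrite mulr0 ltW// heat_gt0.
  rewrite inE /= => wq; rewrite mulr1 -(heat_sqr0 q0) /heat -expRD ler_expR expr0n/= mul0r subr0.
  have q20 : 0 < 2 * q ^+ 2 by apply: mulr_gt0 => //; exact: exprn_gt0.
  rewrite lerD2l lerN2 ler_pdivrMr//.
  rewrite (_ : 1 / 2 * (2 * q ^+ 2) = q ^+ 2); last by field.
  by rewrite -(real_normK (num_real (X w - t))) lerXn2r ?nnegrE// ltW.
have qe0 : 0 < q * expR (1 / 2) by apply: mulr_gt0 => //; exact: expR_gt0.
rewrite expRN -invfM mulrC ler_pdivrMr// => /le_trans; apply.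
by rewrite /q; rewrite le_eqVlt; apply/orP; left; apply/eqP; field; rewrite !gt_eqF ?expR_gt0// addr_gt0.
Qed.

(** The expectation of a narrow kernel centred at t is bounded below. At distance at least eta the
    kernel of variance q^2 is at most 2q/eta^2, too little to account for that expectation, so the
    interval must carry mass. *)
Lemma quad_limit_spread (v0 v1 M eta : R) : 0 < v0 -> 0 <= v1 -> 0 <= M -> 0 < eta ->
  exists c e : R, [/\ 0 < c, 0 < e & forall a X t, quad_limit a X v0 v1 e -> `|t| <= M ->
    c <= Pr [set w | `|X w - t| <= eta]].
Proof.
move=> v00 v10 M0 eta0.
(* The kernel variance q^2 <= 1 is replaced by 1, which frees m from q. Then q makes the far part at
   most m/3, and K makes the replacement error at most m/3. *)
pose m := expR (- (ln (1 + 2 * v1) / 2) - M ^+ 2 / (4 * v0)).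
have m0 : 0 < m by exact: expR_gt0.
pose q := Num.min 1 (m * eta ^+ 2 / 6).
have q0 : 0 < q by rewrite lt_min ltr01/= divr_gt0// mulr_gt0// exprn_gt0.
have q1 : q <= 1 by rewrite ge_min lexx.
have q2 : q <= m * eta ^+ 2 / 6 by rewrite ge_min lexx orbT.
have [C C0 HC] := quad_limit_heat (exprn_gt0 2 q0).
pose K := 6 * C * v1 / m + 1.
have K0 : 1 <= K by rewrite lerDr divr_ge0 ?(ltW m0)// !mulr_ge0.
have K0' : 0 < K by exact: lt_le_trans K0.
exists (q * m / 3), K^-1; split; [by rewrite divr_gt0// mulr_gt0|by rewrite invr_gt0|].
move=> a X t QX tM.
have [_ Hlo] := HC a X v0 v1 K^-1 t v00 (ltW (eqbRL (invr_gt0 _) K0')) (eqbRL (invf_le1 K0') K0) QX.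
have KC : C * (2 * K^-1 * v1) <= m / 3.
  have -> : C * (2 * K^-1 * v1) = (6 * C * v1 / m) / K * (m / 3).
    by field; rewrite !gt_eqF.
  by rewrite ler_piMl ?divr_ge0 ?(ltW m0)// ler_pdivrMr// mul1r lerDl.
have mX : measurable_fun setT X by case: QX.
have mt : m <= expR (- (ln (q ^+ 2 + 2 * v1) / 2) - t ^+ 2 / (4 * v0)).
  have q21 : q ^+ 2 <= 1 by rewrite exprn_ile1// ltW.
  have q20 : 0 < q ^+ 2 by rewrite exprn_gt0.
  rewrite ler_expR; apply: lerD; first by rewrite lerN2 ler_pM2r// ler_ln ?posrE; lra.
  rewrite lerN2 ler_pM2r ?invr_gt0 ?mulr_gt0// -(real_normK (num_real t)).
  by rewrite lerXn2r ?nnegrE.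
have mk := @markov_upper [set w | `|X w - t| <= eta] q^-1 (2 * q / eta ^+ 2)
  (fun w => heat (q ^+ 2) (X w - t)) (m_near _ _ mX) (i_heat _ (exprn_gt0 2 q0) mX).
have : m - m / 3 <= q^-1 * Pr [set w | `|X w - t| <= eta] + 2 * q / eta ^+ 2.
  apply: le_trans (mk _); first by lra.
  move=> w; rewrite indicE; case: (boolP (_ \in _)) => [_|].
    rewrite mulr1 -(heat_sqr0 q0) (le_trans (heat_le_diag _ _)) ?exprn_gt0// lerDl.
    by rewrite divr_ge0 ?exprn_ge0// ?mulr_ge0// ltW.
  rewrite notin_setE /= => /negP; rewrite -ltNge => wq; rewrite mulr0 add0r.
  have x2 : eta ^+ 2 <= (X w - t) ^+ 2.
    by rewrite -(real_normK (num_real (X w - t))) lerXn2r ?nnegrE// ltW.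
  have [_ b2 _] := heat_bounds (X w - t) (exprn_gt0 2 q0) (lexx _).
  rewrite (heat_sqr0 q0) in b2.
  have h0 := heat_gt0 (q ^+ 2) (X w - t).
  rewrite ler_pdivlMr ?exprn_gt0//.
  apply: (@le_trans _ _ (heat (q ^+ 2) (X w - t) * (X w - t) ^+ 2)).
    by rewrite ler_pM2l.
  rewrite [leLHS](_ : _ = (X w - t) ^+ 2 / q ^+ 2 * heat (q ^+ 2) (X w - t) * q ^+ 2); last first.
    by field; exact: lt0r_neq0.
  rewrite (_ : 2 * q = 2 * q^-1 * q ^+ 2); last by field; exact: lt0r_neq0.
  by rewrite ler_pM2r ?exprn_gt0.
have e1 : 2 * q / eta ^+ 2 <= m / 3.
  by rewrite ler_pdivrMr ?exprn_gt0//; lra.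
move=> H; have : m / 3 <= q^-1 * Pr [set w | `|X w - t| <= eta] by lra.
by rewrite (mulrC q^-1) ler_pdivlMr// mulrC mulrA.
Qed.

Lemma quad_limit_tight (v0 v1 e M : R) a X : 0 < M -> quad_limit a X v0 v1 e ->
  Pr [set w | M <= `|X w|] <= 2 * v1 / M ^+ 2.
Proof.
move=> M0 [mX aeX _ av1 _].
apply: (truncated_chebyshev (fun N => measurable_xi_sum Hxi a N (@measurable_sq1 R)) mX aeX _ _ M0).
  by move=> N; have [] := sq1_sum_second_moment Hxi a N.
by move=> N; have [_ _ ->] := sq1_sum_second_moment Hxi a N; rewrite ler_pM2l.
Qed.

End Concentration.

(** * Orthonormal bases of L2 *)

Section NonnegativeSeries.
Variable R : realType.

Lemma nneseries_le (Q : pred nat) (a : nat -> R) m (c : R) : (forall j, 0 <= a j) ->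
  (forall n, \sum_(m <= j < n | Q j) a j <= c) ->
  (\sum_(m <= j <oo | Q j) (a j)%:E <= c%:E)%E.
Proof.
move=> a0 ac; apply: lime_le; first by apply: is_cvg_nneseries => j _ _; rewrite lee_fin.
by apply: nearW => n; rewrite sumEFin lee_fin.
Qed.

Lemma nneseries_partial_le (Q : pred nat) (a : nat -> R) m (c : R) n : (forall j, 0 <= a j) ->
  (\sum_(m <= j <oo | Q j) (a j)%:E <= c%:E)%E -> \sum_(m <= j < n | Q j) a j <= c.
Proof.
move=> a0; rewrite -lee_fin -sumEFin; apply: le_trans.
by apply: nneseries_lim_ge => j _ _; rewrite lee_fin.
Qed.

End NonnegativeSeries.

(** * Inner product and completeness of the space of square-integrable functions *)

Section L2Space.
Variable R : realType.
Local Notation mu := (@lebesgue_measure R).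
Local Notation D := (@I01 R).
Implicit Types f g h : R -> R.

Lemma measurable_I01 : measurable (D : set (measurableTypeR R)).
Proof. exact: measurable_itv. Qed.

Lemma I01_measure : mu D = 1%E.
Proof. by rewrite lebesgue_measure_itv/= lte_fin ltr01 oppr0 adde0. Qed.

Lemma integral_cst_I01 (c : \bar R) : (\int[mu]_(x in D) c = c)%E.
Proof.
rewrite integral_cst; last exact: measurable_I01.
by rewrite -[RHS]mule1; congr (_ * _)%E; exact: I01_measure.
Qed.

Lemma L2_mul f g : L2 f -> L2 g -> mu.-integrable D (EFin \o (fun x => f x * g x)).
Proof.
move=> [mf if2] [mg ig2].
apply: (le_integrable measurable_I01 _ _ (integrableD measurable_I01 if2 ig2)).
  by apply/measurable_EFinP; exact: measurable_funM.
move=> x _ /=; rewrite lee_fin [leRHS]ger0_norm ?addr_ge0 ?sqr_ge0//.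
rewrite normrM -(real_normK (num_real (f x))) -(real_normK (num_real (g x))).
by have := sqr_ge0 (`|f x| - `|g x|); have := sqr_ge0 (`|f x| + `|g x|); nra.
Qed.

Lemma L2D f g : L2 f -> L2 g -> L2 (fun x => f x + g x).
Proof.
move=> Lf Lg; have [mf if2] := Lf; have [mg ig2] := Lg.
split; first exact: measurable_funD.
have i1 := integrableD measurable_I01 if2 ig2.
have i2 := integrableZl measurable_I01 2 (L2_mul Lf Lg).
have := integrableD measurable_I01 i1 i2; congr (mu.-integrable _ _).
by apply/funext => x /=; congr EFin; ring.
Qed.

Lemma L2Z (c : R) f : L2 f -> L2 (fun x => c * f x).
Proof.
move=> [mf if2]; split; first exact: measurable_funM.
have := integrableZl measurable_I01 (c ^+ 2) if2; congr (mu.-integrable _ _).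
by apply/funext => x /=; congr EFin; ring.
Qed.

Lemma L2_cst (c : R) : L2 (fun=> c).
Proof.
split; first exact: measurable_cst.
apply/integrableP; split; first exact: measurable_cst.
by rewrite integral_cst_I01 ltry.
Qed.

Lemma L2B f g : L2 f -> L2 g -> L2 (fun x => f x - g x).
Proof.
move=> Lf Lg; have := L2D Lf (L2Z (-1) Lg); congr L2.
by apply/funext => x; rewrite mulN1r.
Qed.

Lemma ipC f g : ip f g = ip g f.
Proof. by apply: eq_Rintegral => x _; rewrite mulrC. Qed.

Lemma ipDl f g h : L2 f -> L2 g -> L2 h -> ip (fun x => f x + g x) h = ip f h + ip g h.
Proof.
move=> Lf Lg Lh; rewrite /ip -(RintegralD measurable_I01 (L2_mul Lf Lh) (L2_mul Lg Lh)).
by apply: eq_Rintegral => x _; rewrite mulrDl.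
Qed.

Lemma ipZl (c : R) f h : L2 f -> L2 h -> ip (fun x => c * f x) h = c * ip f h.
Proof.
move=> Lf Lh; rewrite /ip -(RintegralZl c measurable_I01 (L2_mul Lf Lh)).
by apply: eq_Rintegral => x _; rewrite mulrA.
Qed.

Lemma ipBl f g h : L2 f -> L2 g -> L2 h -> ip (fun x => f x - g x) h = ip f h - ip g h.
Proof.
move=> Lf Lg Lh; rewrite -mulN1r -ipZl// -ipDl//; last exact: L2Z.
by apply: eq_Rintegral => x _; rewrite mulN1r.
Qed.

Lemma ipBB f g : L2 f -> L2 g ->
  ip (fun x => f x - g x) (fun x => f x - g x) = ip f f - 2 * ip f g + ip g g.
Proof.
move=> Lf Lg; have Lfg := L2B Lf Lg.
rewrite ipBl// (ipC f) (ipC g) !ipBl// (ipC g f); ring.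
Qed.

Lemma ip_ge0 f : 0 <= ip f f.
Proof. by apply: Rintegral_ge0 => x _; rewrite -expr2 sqr_ge0. Qed.

Lemma sqr_L2norm f : L2norm f ^+ 2 = ip f f.
Proof. by rewrite sqr_sqrtr// ip_ge0. Qed.

Lemma ip_cauchy_schwarz f g : L2 f -> L2 g -> ip f g ^+ 2 <= ip f f * ip g g.
Proof.
move=> Lf Lg; set a := ip f f; set b := ip f g; set c := ip g g.
have q t : 0 <= a - 2 * (t * b) + t ^+ 2 * c.
  have := ip_ge0 (fun x => f x - t * g x); rewrite (ipBB Lf (L2Z t Lg)).
  rewrite (ipC f (fun x => t * g x)) (ipZl t Lg Lf) (ipZl t Lg (L2Z t Lg)).
  rewrite (ipC g (fun x => t * g x)) (ipZl t Lg Lg) (ipC g f) -/a -/b -/c.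
  by rewrite expr2 -mulrA.
have c0 : 0 <= c := ip_ge0 g.
have [c00|c00] := eqVneq c 0.
  have [->|b0] := eqVneq b 0; first by rewrite expr0n/= c00 mulr0.
  (* For c = 0 the quadratic degenerates to a - 2tb, which equals -1 at this t. *)
  have := q ((a + 1) / (2 * b)); rewrite c00 mulr0 addr0.
  have -> : 2 * ((a + 1) / (2 * b) * b) = a + 1 by field.
  by lra.
have cp : 0 < c by rewrite lt_neqAle eq_sym c00.
have := q (b / c).
have -> : a - 2 * (b / c * b) + (b / c) ^+ 2 * c = (a * c - b ^+ 2) / c by field.
by rewrite pmulr_lge0 ?invr_gt0// subr_ge0.
Qed.

Lemma ae_eq_ip f g : L2 f -> L2 g ->
  mu.-negligible (D `&` [set x | f x != g x]) -> ip f f = ip g g.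
Proof.
move=> [mf _] [mg _] fg; rewrite /ip /Rintegral; congr fine.
apply: ae_eq_integral; first exact: measurable_I01.
- by apply/measurable_EFinP; exact: measurable_funM.
- by apply/measurable_EFinP; exact: measurable_funM.
apply: negligibleS fg => x /= /not_implyP[Dx /eqP].
by rewrite eqe => fgx; split => //; apply: contra fgx => /eqP ->.
Qed.

(** The rate 4^(-k) for squared norms bounds the L1 norms of consecutive differences by 2^(-k),
    through Cauchy-Schwarz on the unit interval. Hence the sum of these differences is integrable,
    finite almost everywhere, and u_k converges there; Fatou's lemma transfers the rate to the
    limit. *)
Lemma L2_riesz_fischer (u : nat -> R -> R) : (forall k, L2 (u k)) ->
  (forall k l, (k <= l)%N -> ip (fun x => u k x - u l x) (fun x => u k x - u l x) <= 4^-1 ^+ k) ->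
  exists2 g, L2 g &
    forall k, ip (fun x => u k x - g x) (fun x => u k x - g x) <= 4^-1 ^+ k.
Proof.
move=> Lu Cu.
pose dl k (x : R) : R := `|u k x - u k.+1 x|.
have Ldl k : L2 (dl k).
  have [m1 i1] := L2B (Lu k) (Lu k.+1); split; first exact: measurableT_comp.
  move: i1; congr (mu.-integrable _ _).
  by apply/funext => x; rewrite /dl real_normK ?num_real.
have idl k : (\int[mu]_(x in D) (dl k x)%:E <= (2^-1 ^+ k)%:E)%E.
  have i1 : mu.-integrable D (EFin \o (fun x => dl k x * 1)) by exact: L2_mul (Ldl k) (L2_cst 1).
  have -> : (\int[mu]_(x in D) (dl k x)%:E = (ip (dl k) (fun=> 1))%:E)%E.
    rewrite /ip /Rintegral fineK; last exact: (integrable_fin_num measurable_I01 i1).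
    by apply: eq_integral => x _; rewrite mulr1.
  have cs := ip_cauchy_schwarz (Ldl k) (L2_cst 1).
  have e1 : ip (fun=> 1 : R) (fun=> 1 : R) = 1.
    by rewrite /ip /Rintegral mulr1 integral_cst_I01.
  have e2 : ip (dl k) (dl k) <= 4^-1 ^+ k.
    apply: le_trans (Cu k k.+1 (leqnSn k)).
    rewrite le_eqVlt; apply/orP; left; apply/eqP; apply: eq_Rintegral => x _.
    by rewrite -!expr2 /dl real_normK ?num_real.
  rewrite lee_fin; apply: le_trans (ler_norm _) _.
  rewrite -(@ler_pXn2r _ 2)// ?nnegrE ?exprn_ge0 ?invr_ge0// real_normK ?num_real//.
  apply: le_trans cs _; rewrite e1 mulr1; apply: le_trans e2 _.
  rewrite -exprM mulnC exprM le_eqVlt; apply/orP; left; apply/eqP; congr (_ ^+ k).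
  by field.
have dl0 k x : 0 <= dl k x by exact: normr_ge0.
have mdl k : measurable_fun D (fun x => (dl k x)%:E).
  by apply/measurable_EFinP; case: (Ldl k).
pose G x : \bar R := (\sum_(0 <= k <oo) (dl k x)%:E)%E.
have mG : measurable_fun D G.
  apply: (@ge0_emeasurable_sum _ _ R D (fun k x => (dl k x)%:E) xpredT) => [k x _ _|k _] //.
  by rewrite lee_fin dl0.
have iG : mu.-integrable D G.
  apply/integrableP; split => //.
  have -> : (\int[mu]_(x in D) `|G x| = \int[mu]_(x in D) G x)%E.
    by apply: eq_integral => x _; rewrite gee0_abs// nneseries_ge0// => k _ _; rewrite lee_fin dl0.
  have dlE0 k x : D x -> (0 <= (dl k x)%:E)%E by rewrite lee_fin dl0.
  rewrite (integral_nneseries mu measurable_I01 mdl dlE0).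
  apply: (@le_lt_trans _ _ (2%:E)); last by rewrite ltry.
  apply: (@le_trans _ _ (\sum_(0 <= k <oo) (2^-1 ^+ k)%:E)%E).
    apply: lee_nneseries => [k _ _|k _]; last exact: idl.
    by apply: integral_ge0 => x _; rewrite lee_fin dl0.
  apply: nneseries_le => [j|n]; first by rewrite exprn_ge0// invr_ge0.
  have -> : \sum_(0 <= j < n) 2^-1 ^+ j = 2 - 2 * 2^-1 ^+ n :> R.
    elim: n => [|n IH]; first by rewrite big_geq// expr0; ring.
    by rewrite big_nat_recr//= IH exprS; field.
  by rewrite gerBl mulr_ge0// exprn_ge0// invr_ge0.
have aeG := integrable_ae measurable_I01 iG.
(* An upper limit is measurable without any convergence; it is the limit off a null set. *)
pose g x := fine (limn_esup (fun k => (u k x)%:E)).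
have cvgu : {ae mu, forall x, D x -> u k x @[k --> \oo] --> g x}.
  apply: filterS aeG => x Gx Dx.
  have cu : cvgn (fun k => u k x).
    have : cvgn (series (telescope (fun k => u k x))).
      apply: normed_cvg.
      apply: (@nondecreasing_is_cvgn _ [normed series (telescope (fun k => u k x))]).
        by apply: nondecreasing_series => *; exact: normr_ge0.
      exists (fine (G x)) => _ [n _ <-].
      rewrite -lee_fin fineK ?Gx// /G /= /series /= -sumEFin.
      rewrite (eq_bigr (fun k => (dl k x)%:E)); last first.
        by move=> k _; rewrite /dl /telescope distrC.
      by apply: nneseries_lim_ge => k _ _; rewrite lee_fin dl0.
    rewrite telescopeK => c.
    rewrite (_ : (fun k => u k x) = (fun k => (u k x - u 0%N x) + u 0%N x)); last first.
      by apply/funext => k; rewrite subrK.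
    by apply: is_cvgD => //; exact: is_cvg_cst.
  have cE : (u k x)%:E @[k --> \oo] --> (limn (fun k => u k x))%:E.
    by apply: cvg_EFin; [near=> k|exact: cu].
  by rewrite /g (cvg_limn_einf_sup cE).2.
have mu_ k : measurable_fun D (u k) by case: (Lu k).
have mg : measurable_fun D g.
  apply: (measurableT_comp (@fine_measurable R setT measurableT)) => //.
  apply: measurable_fun_limn_esup => k; exact/measurable_EFinP.
have mug k : measurable_fun D (fun x : R => u k x - g x) by exact: measurable_funB.
have mug2 k : measurable_fun D (fun x : R => ((u k x - g x) ^+ 2)%:E).
  by apply/measurable_EFinP; exact: measurable_funX.
have key k : (\int[mu]_(x in D) ((u k x - g x) ^+ 2)%:E <= (4^-1 ^+ k)%:E)%E.
  (* The shift by k makes the Cauchy bound hold for every term of the sequence. *)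
  pose F l x : \bar R := ((u k x - u (l + k)%N x) ^+ 2)%:E.
  have mF l : measurable_fun D (F l).
    by apply/measurable_EFinP; apply: measurable_funX; exact: measurable_funB.
  have mNF l : measurable_fun D (fun x : R => (- F l x)%E).
    rewrite (_ : (fun x => _) = fun x : R => (-1 * (u k x - u (l + k)%N x) ^+ 2)%:E).
      apply/measurable_EFinP; apply: measurable_funM => //.
      by apply: measurable_funX; exact: measurable_funB.
    by apply/funext => x; rewrite mulN1r.
  have FT := fatou mu measurable_I01 mF (fun l x _ => eqbRL (lee_fin _ _) (sqr_ge0 _)).
  have -> : (\int[mu]_(x in D) ((u k x - g x) ^+ 2)%:E =
      \int[mu]_(x in D) limn_einf (F^~ x))%E.
    apply: ae_eq_integral; first exact: measurable_I01.
    - exact: mug2.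
    - rewrite /limn_einf; apply: measurableT_comp => //.
      exact: (measurable_fun_limn_esup mNF).
    apply: negligibleS cvgu => x /=; apply: contra_not => ux Dx; apply/esym.
    have cF : F l x @[l --> \oo] --> ((u k x - g x) ^+ 2)%:E.
      apply: cvg_EFin; first by near=> l.
      have ux' : u (l + k)%N x @[l --> \oo] --> g x.
        by apply: (cvg_comp _ _ _ (ux Dx)); exact: cvg_addnr.
      have c : (u k x - u (l + k)%N x) @[l --> \oo] --> u k x - g x.
        by apply: cvgB => //; exact: cvg_cst.
      by rewrite expr2; apply: cvg_trans (cvgM c c); apply: near_eq_cvg; near=> l.
    by rewrite (cvg_limn_einf_sup cF).1.
  apply: le_trans FT _; rewrite limn_einf_lim; apply: lime_le; first exact: is_cvg_einfs.
  apply: nearW => l; apply: (@le_trans _ _ (\int[mu]_(x in D) F l x)%E).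
    by apply: ereal_inf_lbound; exists l => //=.
  have := Cu k (l + k)%N (leq_addl _ _); rewrite -lee_fin /ip /Rintegral fineK; last first.
    exact: (integrable_fin_num measurable_I01 (L2_mul (L2B (Lu _) (Lu _)) (L2B (Lu _) (Lu _)))).
  by apply: le_trans; rewrite le_eqVlt; apply/orP; left; apply/eqP; apply: eq_integral => x _; rewrite /F expr2.
have Lug k : L2 (fun x => u k x - g x).
  split; first exact: mug.
  apply/integrableP; split; first exact: mug2.
  have -> : (\int[mu]_(x in D) `|((u k x - g x) ^+ 2)%:E| =
      \int[mu]_(x in D) ((u k x - g x) ^+ 2)%:E)%E.
    by apply: eq_integral => x _; rewrite gee0_abs// lee_fin sqr_ge0.
  by apply: le_lt_trans (key k) _; rewrite ltry.
exists g.
  have := L2B (Lu 0%N) (Lug 0%N); congr L2.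
  by apply/funext => x; ring.
move=> k; rewrite -lee_fin /ip /Rintegral fineK; last first.
  exact: (integrable_fin_num measurable_I01 (L2_mul (Lug k) (Lug k))).
by apply: le_trans (key k); rewrite le_eqVlt; apply/orP; left; apply/eqP; apply: eq_integral => x _; rewrite expr2.
Unshelve. all: by end_near. Qed.

End L2Space.

(** * Bessel's inequality and Parseval's identity *)

Section Basis.
Variables (R : realType) (phi : nat -> R -> R).
Hypothesis B : ONB phi.
Implicit Types (f g : R -> R) (th : nat -> R) (N M : nat).

Let Lphi j : (1 <= j)%N -> L2 (phi j).
Proof. by case: B => + _; exact. Qed.

Definition psum th N : R -> R := fun x => \sum_(1 <= j < N) th j * phi j x.

Let psum_le1 th N : (N <= 1)%N -> psum th N = fun=> 0.
Proof. by move=> N1; apply/funext => x; rewrite /psum big_geq. Qed.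

Let psumS th N : (1 <= N)%N -> psum th N.+1 = fun x => psum th N x + th N * phi N x.
Proof. by move=> N1; apply/funext => x; rewrite /psum big_nat_recr. Qed.

Lemma L2_psum th N : L2 (psum th N).
Proof.
elim: N => [|[|N] IH]; [by rewrite psum_le1//; exact: L2_cst..|].
by rewrite psumS//; apply: L2D => //; apply: L2Z; exact: Lphi.
Qed.

Lemma ip_psum f th N : L2 f -> ip (psum th N) f = \sum_(1 <= j < N) th j * coef phi f j.
Proof.
move=> Lf; have ip0 : ip (fun=> 0) f = 0.
  transitivity (ip (fun x => 0 * f x) f); last by rewrite ipZl// mul0r.
  by apply: eq_Rintegral => x _; rewrite !mul0r.
elim: N => [|[|N] IH]; [by rewrite psum_le1// ip0 big_geq..|].
rewrite psumS// ipDl//; [|exact: L2_psum|by apply: L2Z; exact: Lphi].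
by rewrite IH (ipZl _ (Lphi (ltn0Sn N)) Lf) [in RHS]big_nat_recr//= (ipC (phi _)).
Qed.

Lemma coef_psum th N i : (1 <= i)%N -> coef phi (psum th N) i = if (i < N)%N then th i else 0.
Proof.
move=> i1; rewrite /coef ip_psum; last exact: Lphi.
have E j : (1 <= j)%N -> coef phi (phi i) j = (i == j)%:R.
  by move=> j1; case: B => _ [+ _]; exact.
elim: N => [|[|N] IH]; [by rewrite big_geq|by rewrite big_geq// ltnS leqn0 gtn_eqF|].
rewrite big_nat_recr//= IH E//; have [->|iN] := eqVneq i N.+1.
  by rewrite ltnn ltnSn mulr1 add0r.
by rewrite mulr0 addr0 [in RHS]ltnS [in RHS]leq_eqVlt (negbTE iN).
Qed.

Lemma ip_psum_psum th N M : (N <= M)%N ->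
  ip (psum th N) (psum th M) = \sum_(1 <= j < N) th j ^+ 2.
Proof.
move=> NM; rewrite ip_psum; last exact: L2_psum.
apply: eq_big_nat => j /andP[j1 jN].
by rewrite coef_psum// (leq_trans jN NM) expr2.
Qed.

Lemma residual_norm f N : L2 f ->
  ip (fun x => f x - psum (coef phi f) N x) (fun x => f x - psum (coef phi f) N x) =
  ip f f - \sum_(1 <= j < N) coef phi f j ^+ 2.
Proof.
move=> Lf; rewrite (ipBB Lf (L2_psum _ _)) ip_psum_psum// ipC ip_psum//.
rewrite (eq_bigr (fun j => coef phi f j ^+ 2)); last by move=> j _; rewrite expr2.
by ring.
Qed.

Lemma bessel f N : L2 f -> \sum_(1 <= j < N) coef phi f j ^+ 2 <= ip f f.
Proof. by move=> Lf; rewrite -subr_ge0 -residual_norm// ip_ge0. Qed.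

Lemma nondecreasing_sumsq th N M : (N <= M)%N ->
  \sum_(1 <= j < N) th j ^+ 2 <= \sum_(1 <= j < M) th j ^+ 2.
Proof.
move=> NM; have [N1|N1] := leqP N 1.
  by rewrite big_geq//; apply: sumr_ge0 => *; exact: sqr_ge0.
rewrite [leRHS](@big_cat_nat _ _ _ N)//=; last exact: ltnW.
by rewrite lerDl; apply: sumr_ge0 => *; exact: sqr_ge0.
Qed.

Let small_pow (e : R) : 0 < e -> exists k : nat, 4^-1 ^+ k < e.
Proof.
move=> e0; have [k] := ltr_add_invr e0; rewrite add0r => ke; exists k.
apply: le_lt_trans ke; rewrite exprVn lef_pV2 ?posrE ?exprn_gt0//.
by rewrite -natrX ler_nat ltn_expl.
Qed.

(* The residuals of the partial sums are Cauchy; their limit is orthogonal to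
   every [phi j], hence vanishes by completeness of the basis. *)
Lemma parseval f (e : R) : L2 f -> 0 < e -> exists N, forall M, (N <= M)%N ->
  ip f f - \sum_(1 <= j < M) coef phi f j ^+ 2 <= e.
Proof.
move=> Lf e0; set th := coef phi f; pose c N := \sum_(1 <= j < N) th j ^+ 2.
have hs : has_sup (range c).
  split; first by exists (c 0%N), 0%N.
  by exists (ip f f) => _ [N _ <-]; exact: bessel.
set s := sup (range c).
have cs N : c N <= s by apply: ub_le_sup; [case: hs|exists N].
have cM N M : (N <= M)%N -> c N <= c M by exact: nondecreasing_sumsq.
have /choice[K HK] : forall k : nat, exists N, s - 4^-1 ^+ k <= c N.
  move=> k; have p0 : 0 < 4^-1 ^+ k :> R by rewrite exprn_gt0// invr_gt0.
  by have [_ [N _ <-] /ltW ?] := sup_adherent p0 hs; exists N.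
(* Summing the successors gives indices that are nondecreasing, at least [K k] and greater than k,
   all at once. *)
pose M_ k := (\sum_(i < k.+1) (K i).+1)%N.
have MK k : (K k <= M_ k)%N.
  by rewrite /M_ big_ord_recr/= (leq_trans (leqnSn _))// leq_addl.
have Mk k : (k < M_ k)%N.
  elim: k => [|k IH]; rewrite /M_ big_ord_recr/=; first by rewrite big_ord0.
  by rewrite addnS ltnS (leq_trans IH)// leq_addr.
have MM k l : (k <= l)%N -> (M_ k <= M_ l)%N.
  move=> /subnK <-; elim: (l - k)%N => [|n IH]; first by rewrite add0n.
  by apply: leq_trans IH _; rewrite addSn /M_ [leqRHS]big_ord_recr/= leq_addr.
pose u k (x : R) := f x - psum th (M_ k) x.
have Lu k : L2 (u k) by apply: L2B => //; exact: L2_psum.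
have Cu k l : (k <= l)%N ->
    ip (fun x => u k x - u l x) (fun x => u k x - u l x) <= 4^-1 ^+ k.
  move=> kl.
  have -> : ip (fun x => u k x - u l x) (fun x => u k x - u l x) =
      ip (fun x => psum th (M_ k) x - psum th (M_ l) x)
         (fun x => psum th (M_ k) x - psum th (M_ l) x).
    by apply: eq_Rintegral => x _; rewrite /u; ring.
  rewrite (ipBB (L2_psum _ _) (L2_psum _ _)) !ip_psum_psum ?MM// -!/(c _).
  have := cs (M_ l); have := HK k; have := cM _ _ (MK k); lra.
have [g Lg Hg] := L2_riesz_fischer Lu Cu.
have gj j : (1 <= j)%N -> ip g (phi j) = 0.
  (* For k >= j the residual [u k] is orthogonal to [phi j], so the coefficient of g is, up to sign,
     that of [u k] - g. *)
  move=> j1; have ck k : (j <= k)%N -> ip g (phi j) ^+ 2 <= 4^-1 ^+ k.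
    move=> jk; have uj : ip (u k) (phi j) = 0.
      rewrite ipBl//; [|exact: L2_psum|exact: Lphi].
      by rewrite -!/(coef phi _ j) coef_psum// (leq_ltn_trans jk (Mk k)) subrr.
    have := ip_cauchy_schwarz (L2B (Lu k) Lg) (Lphi j1).
    rewrite ipBl//; last exact: Lphi.
    rewrite uj sub0r sqrrN => H; apply: le_trans H _.
    have -> : ip (phi j) (phi j) = 1 by case: B => _ [/(_ j j j1 j1) + _]; rewrite eqxx.
    by rewrite mulr1; exact: Hg.
  apply/eqP; rewrite -sqrf_eq0 eq_le sqr_ge0 andbT leNgt; apply/negP => p0.
  have [k kp] := small_pow p0.
  have := ck (maxn j k) (leq_maxl _ _); apply/negP; rewrite -ltNge; apply: le_lt_trans kp.
  by apply: ler_wiXn2l; rewrite ?leq_maxr// ?invr_ge0// invf_le1// ler1n.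
have ng : (@lebesgue_measure R).-negligible (@I01 R `&` [set x | g x != 0]).
  by case: B => _ [_]; exact.
have [k ke] := small_pow e0.
exists (M_ k) => M kM; apply: le_trans (ltW ke).
apply: (@le_trans _ _ (ip (u k) (u k))).
  by rewrite residual_norm// lerD2l lerN2; exact: cM.
rewrite (@ae_eq_ip _ (u k) (fun x => u k x - g x))//; first exact: L2B.
apply: negligibleS ng => x /= [Dx ux]; split => //.
by apply: contra ux => /eqP ->; rewrite subr0.
Qed.

End Basis.

(** * Asymptotics of the weights *)

Section Weights.
Variables (R : realType) (sigma r : R) (kap : nat -> nat -> R).
Hypotheses (sigma0 : 0 < sigma) (kap0 : forall n j, 0 <= kap n j)
  (a1 : A1 kap) (a2 : A2 sigma kap) (a3 : A3 r kap) (a5 : A5 kap).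

Lemma kap_nonincreasing n i j : (1 <= n)%N -> (1 <= i)%N -> (i <= j)%N ->
  kap n j <= kap n i.
Proof.
move=> n1 i1 /subnK <-; elim: (j - i)%N => [|m IH]; first by rewrite add0n.
by rewrite addSn; apply: le_trans (a1 _ _) IH => //; rewrite (leq_trans i1)// leq_addl.
Qed.

Lemma rhoE_fin n : (1 <= n)%N -> (rho kap n)%:E = rhoE kap n.
Proof.
move=> n1; have [c1 [c2 [_ [_ /(_ n n1)[_ H]]]]] := a3.
rewrite /rho fineK// ge0_fin_numE; first by apply: le_lt_trans H _; rewrite ltry.
by apply: nneseries_ge0 => j _ _; rewrite lee_fin.
Qed.

Lemma kap_sum_le n N : (1 <= n)%N -> \sum_(1 <= j < N) kap n j <= rho kap n.
Proof.
by move=> n1; apply: (@nneseries_partial_le _ xpredT) => //; rewrite rhoE_fin.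
Qed.

Lemma rho_le n (c : R) : (1 <= n)%N -> (forall N, \sum_(1 <= j < N) kap n j <= c) ->
  rho kap n <= c.
Proof.
by move=> n1 H; rewrite -lee_fin rhoE_fin//; apply: nneseries_le.
Qed.

Lemma rho_gt0 n : (1 <= n)%N -> 0 < rho kap n.
Proof.
move=> n1; have [c1 [c2 [c10 [_ /(_ n n1)[H _]]]]] := a3.
rewrite -lte_fin rhoE_fin//; apply: lt_le_trans H.
by rewrite lte_fin mulr_gt0// powR_gt0// ltr0n.
Qed.

Let sum_mono n N M : (N <= M)%N ->
  \sum_(1 <= j < N) kap n j <= \sum_(1 <= j < M) kap n j.
Proof.
move=> NM; have [N1|N1] := leqP N 1.
  by rewrite big_geq//; apply: sumr_ge0.
rewrite [leRHS](@big_cat_nat _ _ _ N)//=; last exact: ltnW.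
by rewrite lerDl; apply: sumr_ge0.
Qed.

(** The defining property holds at 0 and fails eventually, because the partial sums approach [rho],
    which exceeds its half. The maximum thus exists and [xget] does not return its default. *)
Lemma knP n : (1 <= n)%N -> kn_prop kap n (kn kap n) /\
  forall m, kn_prop kap n m -> (m <= kn kap n)%N.
Proof.
move=> n1; apply: (@xgetPex _ 0%N [set k | kn_prop kap n k /\ _]).
have r0 := rho_gt0 n1.
have [N0 HN0] : exists N, rho kap n / 2 < \sum_(1 <= j < N) kap n j.
  apply/not_existsP => H.
  suff : rho kap n <= rho kap n / 2 by lra.
  by apply: rho_le => // N; rewrite leNgt; apply/negP; exact: H.
have ex : exists k, \sum_(1 <= j < k) kap n j <= rho kap n / 2.
  by exists 0%N; rewrite big_geq// divr_ge0// ltW.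
have ub k : \sum_(1 <= j < k) kap n j <= rho kap n / 2 -> (k <= N0)%N.
  move=> kr; rewrite leqNgt; apply/negP => /ltnW /(sum_mono n) H.
  by have := le_lt_trans (le_trans H kr) HN0; rewrite ltxx.
by have [k kP kM] := ex_maxnP ex ub; exists k; split => // m; exact: kM.
Qed.

Lemma kn_ge1 n : (1 <= n)%N -> (1 <= kn kap n)%N.
Proof.
move=> n1; have [_] := knP n1; apply.
by rewrite /kn_prop big_geq// divr_ge0// ltW// rho_gt0.
Qed.

Lemma kn_sum_gt n : (1 <= n)%N -> rho kap n / 2 < \sum_(1 <= j < (kn kap n).+1) kap n j.
Proof.
move=> n1; have [_ H] := knP n1; rewrite ltNge; apply/negP => /H.
by rewrite ltnn.
Qed.

Let sum_const N (c : R) : \sum_(1 <= j < N.+1) c = N%:R * c.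
Proof. by rewrite big_const_nat subn1/= iter_addr_0 mulr_natl. Qed.

Lemma kn_kapn_le n : (1 <= n)%N -> (kn kap n)%:R * kapn kap n <= rho kap n.
Proof.
move=> n1; apply: le_trans (kap_sum_le (kn kap n).+1 n1).
rewrite -sum_const !big_nat; apply: ler_sum => j /andP[j1 jk].
exact: kap_nonincreasing.
Qed.

(** The first k_n weights sum to more than [rho]/2 by maximality of k_n, and each is at most b times
    [kapn]. With [kn_kapn_le], k_n times [kapn] has the order of [rho]. *)
Lemma kn_kapn_ge n (b : R) : (1 <= n)%N -> kap n 1%N <= b * kapn kap n ->
  rho kap n / 2 < (kn kap n)%:R * (b * kapn kap n).
Proof.
move=> n1 kb; apply: lt_le_trans (kn_sum_gt n1) _.
rewrite -sum_const !big_nat; apply: ler_sum => j /andP[j1 jk].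
by apply: le_trans kb; exact: kap_nonincreasing.
Qed.

(** The coefficient of xi_j^2 - 1 in n^2 T_n, the noise having variance sigma^2/n. *)
Definition wgt n j : R := sigma ^+ 2 * n%:R * kap n j.

Lemma wgt_sumsq_bounds : exists v0 v1 : R, [/\ 0 < v0, 0 < v1 & forall n, (1 <= n)%N ->
  (forall N, \sum_(1 <= j < N) wgt n j ^+ 2 <= v1) /\
  (exists N, v0 <= \sum_(1 <= j < N) wgt n j ^+ 2)].
Proof.
have [C1 [C2 [C10 H]]] := a2.
have s4 : 0 < sigma ^+ 4 by rewrite exprn_gt0.
have C20 : 0 < C2.
  have [H1 H2] := H 1%N isT; have := lt_trans H1 H2; rewrite lte_fin; exact: lt_trans.
(* [A2] is normalised by sigma^(-4), whereas the squared coefficients carry sigma^4. *)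
exists (C1 * sigma ^+ 4 * sigma ^+ 4), (C2 * sigma ^+ 4 * sigma ^+ 4).
split; [by rewrite !mulr_gt0|by rewrite !mulr_gt0|move=> n n1].
have [H1 H2] := H n n1.
have n0 : 0 < n%:R :> R by rewrite ltr0n.
pose q := sigma ^- 4 * n%:R ^+ 2.
have q0 : 0 < q by rewrite mulr_gt0 ?invr_gt0// exprn_gt0.
have wE N : \sum_(1 <= j < N) wgt n j ^+ 2 =
    q * (\sum_(1 <= j < N) kap n j ^+ 2) * sigma ^+ 4 * sigma ^+ 4.
  rewrite mulr_sumr !mulr_suml; apply: eq_bigr => j _.
  by rewrite /wgt /q; field; exact: lt0r_neq0.
have up N : q * \sum_(1 <= j < N) kap n j ^+ 2 <= C2.
  rewrite mulr_sumr; apply: (@nneseries_partial_le _ xpredT (fun j => q * kap n j ^+ 2)).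
    by move=> j; rewrite mulr_ge0 ?sqr_ge0// ltW.
  apply: ltW; move: H2; rewrite /Defs.esum1 -nneseriesZl//.
  by move=> j _; rewrite lee_fin sqr_ge0.
split=> [N|]; first by rewrite wE ler_pM2r// ler_pM2r.
apply/not_existsP => Hn.
have : (q%:E * Defs.esum1 (fun j => (kap n j ^+ 2)%R) <= C1%:E)%E.
  rewrite /Defs.esum1 -nneseriesZl//; last by move=> j _; rewrite lee_fin sqr_ge0.
  apply: (@nneseries_le _ xpredT (fun j => q * kap n j ^+ 2)).
    by move=> j; rewrite mulr_ge0 ?sqr_ge0// ltW.
  move=> N; rewrite -mulr_sumr leNgt; apply/negP => HN; apply: (Hn N).
  by rewrite wE ltW// ltr_pM2r// ltr_pM2r.
by move/(lt_le_trans H1); rewrite ltxx.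
Qed.

(** The sum of squared weights has order n^(-2). It is at most b [kapn] [rho], which bounds [kapn]
    from below; it is at least k_n [kapn]^2 with k_n [kapn] of the order of [rho], which bounds
    [kapn] from above. Dividing [rho] by [kapn] gives k_n, stated in product form as k_n x^2 of
    order n^2. *)
Lemma weights_asymptotics : exists b q1 q2 q3 q4 : R,
  [/\ 0 < b, 0 < q1, 0 < q2, 0 < q3 & 0 < q4] /\ forall n, (1 <= n)%N ->
  let x := n%:R `^ (2 * r) in
  [/\ kap n 1%N <= b * kapn kap n, q1 * x <= n%:R ^+ 2 * kapn kap n,
      n%:R ^+ 2 * kapn kap n <= q2 * x, (kn kap n)%:R * x ^+ 2 <= q3 * n%:R ^+ 2 &
      q4 * n%:R ^+ 2 <= (kn kap n)%:R * x ^+ 2].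
Proof.
have [v0 [v1 [v00 v10 Hv]]] := wgt_sumsq_bounds.
have [c1 [c2 [c10 [c20 H3]]]] := a3.
have [[a [b [a0 [b0 H5]]]] _] := a5.
have s4 : 0 < sigma ^+ 4 by rewrite exprn_gt0.
pose q1 := v0 / (sigma ^+ 4 * b * c2).
pose q2 := 2 * b * v1 / (sigma ^+ 4 * c1).
have q10 : 0 < q1 by rewrite divr_gt0// !mulr_gt0.
have q20 : 0 < q2 by rewrite divr_gt0// !mulr_gt0.
exists b, q1, q2, (c2 / q1), (c1 / (2 * b * q2)).
have q40 : 0 < 2 * b * q2 by apply: mulr_gt0 => //; exact: mulr_gt0.
split; first by split => //; apply: divr_gt0.
move=> n n1 x.
have n0 : 0 < n%:R :> R by rewrite ltr0n.
have x0 : 0 < x by rewrite powR_gt0.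
have [_ kb] := H5 n n1.
have [Hup [N0 Hlo]] := Hv n n1.
have [r1 r2] := H3 n n1.
rewrite -rhoE_fin// lee_fin powRN -/x in r1.
rewrite -rhoE_fin// lee_fin powRN -/x in r2.
have k1 := kn_kapn_le n1; have k2 := kn_kapn_ge n1 kb.
have k0 : 0 <= (kn kap n)%:R :> R by [].
set k := (kn kap n)%:R in k0 k1 k2 *; set ka := kapn kap n in kb k1 k2 *.
have ka0 : 0 <= ka by exact: kap0.
have sn0 : 0 <= sigma ^+ 4 * n%:R ^+ 2 by apply: mulr_ge0; [exact: ltW|exact: sqr_ge0].
have K1 j : (1 <= j)%N -> kap n j <= b * ka.
  by move=> j1; apply: le_trans kb; exact: kap_nonincreasing.
have lo : v0 <= sigma ^+ 4 * n%:R ^+ 2 * (b * ka * (c2 / x)).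
  apply: le_trans Hlo _.
  apply: (@le_trans _ _ (sigma ^+ 4 * n%:R ^+ 2 * (b * ka * \sum_(1 <= j < N0) kap n j))).
    rewrite !mulr_sumr !big_nat; apply: ler_sum => j /andP[j1 _].
    rewrite /wgt (_ : (_ * _) ^+ 2 = sigma ^+ 4 * n%:R ^+ 2 * (kap n j * kap n j)); last by ring.
    by apply: (ler_wpM2l sn0); apply: ler_wpM2r => //; exact: K1.
  apply: (ler_wpM2l sn0); apply: ler_wpM2l; first by rewrite mulr_ge0 ?(ltW b0).
  exact: le_trans (kap_sum_le _ n1) r2.
have hi : sigma ^+ 4 * n%:R ^+ 2 * (k * ka * ka) <= v1.
  apply: le_trans (Hup (kn kap n).+1).
  rewrite -(mulrA k) -sum_const mulr_sumr !big_nat; apply: ler_sum => j /andP[j1 jk].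
  rewrite /wgt [leRHS](_ : _ = sigma ^+ 4 * n%:R ^+ 2 * (kap n j * kap n j)); last by ring.
  have kj : ka <= kap n j by exact: kap_nonincreasing.
  by apply: (ler_wpM2l sn0); exact: ler_pM.
have B1 : q1 * x <= n%:R ^+ 2 * ka.
  rewrite /q1 mulrAC ler_pdivrMr ?mulr_gt0// -ler_pdivlMr//.
  apply: le_trans lo _; rewrite le_eqVlt; apply/orP; left; apply/eqP; field.
  exact: lt0r_neq0.
have kap_gt0 : 0 < ka.
  have := lt_le_trans (mulr_gt0 q10 x0) B1.
  by rewrite pmulr_rgt0// exprn_gt0.
have r12 : c1 / x < 2 * b * (k * ka).
  by apply: le_lt_trans r1 _; move: k2; rewrite ltr_pdivrMr// => /lt_le_trans; apply;
     rewrite le_eqVlt; apply/orP; left; apply/eqP; ring.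
have B2 : n%:R ^+ 2 * ka <= q2 * x.
  rewrite /q2 [leRHS]mulrAC ler_pdivlMr ?mulr_gt0// -ler_pdivrMr//.
  apply: (@le_trans _ _ (2 * b * (sigma ^+ 4 * n%:R ^+ 2 * (k * ka * ka)))); last first.
    by rewrite ler_pM2l ?mulr_gt0.
  have -> : n%:R ^+ 2 * ka * (sigma ^+ 4 * c1) / x = sigma ^+ 4 * n%:R ^+ 2 * ka * (c1 / x).
    by field; exact: lt0r_neq0.
  have -> : 2 * b * (sigma ^+ 4 * n%:R ^+ 2 * (k * ka * ka)) =
    sigma ^+ 4 * n%:R ^+ 2 * ka * (2 * b * (k * ka)) by ring.
  by rewrite ler_pM2l ?(ltW r12)// !mulr_gt0// exprn_gt0.
split => //.
- rewrite mulrAC ler_pdivlMr//.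
  have kx : k * ka * x <= c2 by rewrite -ler_pdivlMr//; exact: le_trans r2.
  have h1 : q1 * x * (k * x) <= n%:R ^+ 2 * ka * (k * x) by rewrite ler_wpM2r// mulr_ge0// ltW.
  have h2 : n%:R ^+ 2 * (k * ka * x) <= n%:R ^+ 2 * c2 by rewrite ler_wpM2l// sqr_ge0.
  rewrite [leLHS](_ : _ = q1 * x * (k * x)); last by ring.
  apply: le_trans h1 _; rewrite [leLHS](_ : _ = n%:R ^+ 2 * (k * ka * x)); last by ring.
  by apply: le_trans h2 _; rewrite mulrC.
- rewrite mulrAC ler_pdivrMr//.
  have h1 : c1 * n%:R ^+ 2 <= 2 * b * (k * ka) * x * n%:R ^+ 2.
    by rewrite ler_wpM2r ?sqr_ge0// -ler_pdivrMr// ltW.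
  have h2 : 2 * b * k * x * (n%:R ^+ 2 * ka) <= 2 * b * k * x * (q2 * x).
    by rewrite ler_wpM2l// !mulr_ge0// ltW.
  apply: le_trans h1 _; rewrite [leLHS](_ : _ = 2 * b * k * x * (n%:R ^+ 2 * ka)); last by ring.
  apply: le_trans h2 _; rewrite le_eqVlt; apply/orP; left; apply/eqP; ring.
Qed.

End Weights.

(** * The test statistic as a limit of quadratic forms *)

Section NonnegativeRealSeries.
Variable R : realType.

(** Puts the series in the form, starting from 0, to which measurability and termwise integration
    are applied. *)
Lemma esum1_from0 (a : nat -> R) :
  Defs.esum1 a = (\sum_(0 <= j <oo) ((0 < j)%N%:R * a j)%:E)%E.
Proof.
rewrite /Defs.esum1; congr (limn _); apply/funext => N.
elim: N => [|[|N] IH]; first by rewrite !big_geq.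
  by rewrite [in LHS]big_geq// big_nat1 mul0r.
by rewrite big_nat_recr//= [in RHS]big_nat_recr//= IH mul1r.
Qed.

Lemma rsum1_cvg (a : nat -> R) (c : R) : (forall j, 0 <= a j) ->
  (forall N, \sum_(1 <= j < N) a j <= c) ->
  (\sum_(1 <= j < N) a j) @[N --> \oo] --> rsum1 a.
Proof.
move=> a0 ac; apply: nondecreasing_is_cvgn.
  apply/nondecreasing_seqP => -[|N]; first by rewrite !big_geq.
  by rewrite [leRHS]big_nat_recr//= lerDl.
by exists c => _ [N _ <-].
Qed.

(** Divergent series are included: the real limit and the finite part of the infinite sum then both
    take the default value 0. This gives measurability of [Tstat] on the whole space, before any
    convergence is known. *)
Lemma rsum1_fine (a : nat -> R) : (forall j, 0 <= a j) -> rsum1 a = fine (Defs.esum1 a).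
Proof.
move=> a0.
have a0E j : (1 <= j)%N -> true -> (0 <= (a j)%:E)%E by rewrite lee_fin.
have [fin|] := boolP (Defs.esum1 a \is a fin_num).
  have H N : \sum_(1 <= j < N) a j <= fine (Defs.esum1 a).
    by apply: (@nneseries_partial_le _ xpredT) => //; rewrite fineK.
  have cv := rsum1_cvg a0 H.
  apply/eqP; rewrite eq_le; apply/andP; split.
    by apply: (cvgr_to_le cv); near=> N; exact: H.
  rewrite -lee_fin fineK//; apply: nneseries_le => // N.
  apply: (cvgr_to_ge cv); near=> M.
  have NM : (N <= M)%N by near: M; exact: nbhs_infty_ge.
  have [N1|N1] := leqP N 1; first by rewrite big_geq//; apply: sumr_ge0.
  rewrite [leRHS](@big_cat_nat _ _ _ N)//=; last exact: ltnW.
  by rewrite lerDl; apply: sumr_ge0.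
rewrite ge0_fin_numE ?nneseries_ge0// -leNgt leye_eq => /eqP E; rewrite E /=.
rewrite /rsum1 dvgP// => cv.
have cvE : (\sum_(1 <= j < N) a j)%:E @[N --> \oo] -->
    (limn (fun N => \sum_(1 <= j < N) a j))%:E.
  by apply: cvg_EFin; [near=> N|exact: cv].
have : Defs.esum1 a = (limn (fun N => \sum_(1 <= j < N) a j))%:E.
  apply: cvg_lim => //; apply: cvg_trans cvE.
  by apply: near_eq_cvg; near=> N; rewrite /= sumEFin.
by rewrite E.
Unshelve. all: by end_near. Qed.

End NonnegativeRealSeries.

Section Statistic.
Context (R : realType) (d : measure_display) (Omega : measurableType d)
  (P : probability Omega R) (xi : nat -> Omega -> R).
Hypothesis Hxi : iid_std_normal P xi.
Variables (sigma r : R) (kap : nat -> nat -> R).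
Hypotheses (sigma0 : 0 < sigma) (kap0 : forall n j, 0 <= kap n j)
  (a1 : A1 kap) (a3 : A3 r kap).

Let mxi j : measurable_fun setT (xi j).
Proof. by case: Hxi. Qed.

Definition energy n (th : nat -> R) : R := rsum1 (fun j => kap n j * th j ^+ 2).

Lemma energy_cvg n (th : nat -> R) (F : R) : (1 <= n)%N -> (forall N, \sum_(1 <= j < N) th j ^+ 2 <= F) ->
  (\sum_(1 <= j < N) kap n j * th j ^+ 2) @[N --> \oo] --> energy n th.
Proof.
move=> n1 HF; apply: (@rsum1_cvg _ _ (kap n 1%N * F)).
  by move=> j; rewrite mulr_ge0// sqr_ge0.
move=> N; apply: (@le_trans _ _ (kap n 1%N * \sum_(1 <= j < N) th j ^+ 2)); last first.
  exact: ler_wpM2l.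
rewrite mulr_sumr !big_nat; apply: ler_sum => j /andP[j1 _].
by apply: ler_wpM2r; [exact: sqr_ge0|exact: (kap_nonincreasing a1)].
Qed.

Lemma measurable_Tstat n th : measurable_fun setT (Tstat xi sigma kap n th).
Proof.
apply: measurable_funB => //.
rewrite (_ : (fun w => _) = fun w => fine (\sum_(0 <= j <oo | j \in xpredT)
    ((0 < j)%N%:R * (kap n j * obs xi sigma n th w j ^+ 2))%:E)%E); last first.
  apply/funext => w; rewrite rsum1_fine ?esum1_from0//.
  by move=> j; rewrite mulr_ge0// sqr_ge0.
apply: (measurableT_comp (@fine_measurable R setT measurableT)).
apply: (@ge0_emeasurable_sum _ _ R setT
  (fun j w => ((0 < j)%N%:R * (kap n j * obs xi sigma n th w j ^+ 2))%:E) xpredT).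
  by move=> j w _ _; rewrite lee_fin mulr_ge0// mulr_ge0// sqr_ge0.
move=> j _; apply/measurable_EFinP; apply: measurable_funM => //; apply: measurable_funM => //.
apply: measurable_funX; apply: measurable_funD => //.
exact: measurable_funM.
Qed.

(** By monotone convergence the expected sum is [rho], which is finite, so the sum is finite almost
    surely. *)
Lemma ae_weighted_squares_bounded n : (1 <= n)%N ->
  {ae P, forall w, exists B : R, forall N, \sum_(1 <= j < N) kap n j * xi j w ^+ 2 <= B}.
Proof.
move=> n1.
pose g j w : \bar R := ((0 < j)%N%:R * (kap n j * xi j w ^+ 2))%:E.
have g0 j w : setT w -> (0 <= g j w)%E.
  by move=> _; rewrite lee_fin mulr_ge0// mulr_ge0// sqr_ge0.
have mg j : measurable_fun setT (g j).
  apply/measurable_EFinP; apply: measurable_funM => //; apply: measurable_funM => //.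
  exact: measurable_funX.
pose G w : \bar R := (\sum_(0 <= j <oo) g j w)%E.
have intG : (\int[P]_w G w = rhoE kap n)%E.
  rewrite (integral_nneseries P measurableT mg g0) /rhoE esum1_from0.
  apply: eq_eseriesr => j _.
  have E : \int[P]_w ((0 < j)%N%:R * kap n j * xi j w ^+ 2) = (0 < j)%N%:R * kap n j.
    transitivity (\int[P]_w (0 * xi j w ^+ 4 + (0 < j)%N%:R * kap n j * xi j w ^+ 2 + 0)).
      by apply: eq_Rintegral => w _; ring.
    by rewrite (expectation_poly4 Hxi); ring.
  have I : P.-integrable setT (EFin \o (fun w => (0 < j)%N%:R * kap n j * xi j w ^+ 2)).
    have h := @integrable_xi _ _ _ _ _ Hxi j (fun x => (0 < j)%N%:R * kap n j * x ^+ 2)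
      ((0 < j)%N%:R * kap n j); apply: h.
      by apply: measurable_funM => //; exact: exprn_measurable.
    move=> x; rewrite normrM ger0_norm ?mulr_ge0// ler_wpM2l ?mulr_ge0//.
    by rewrite ger0_norm ?sqr_ge0//; have [] := pow_le_1D6 x.
  rewrite -E /Rintegral fineK; last exact: (integrable_fin_num measurableT I).
  by apply: eq_integral => w _; rewrite /g mulrA.
have iG : P.-integrable setT G.
  apply/integrableP; split.
    by apply: (@ge0_emeasurable_sum _ _ R setT g xpredT) => // j w _ _; exact: g0.
  have -> : (\int[P]_w `|G w| = \int[P]_w G w)%E.
    by apply: eq_integral => w _; rewrite gee0_abs// nneseries_ge0// => j _ _; exact: g0.
  by rewrite intG -(rhoE_fin kap0 a3 n1) ltry.
have := integrable_ae measurableT iG.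
apply: filterS => w /(_ I) fG; exists (fine (G w)) => N.
apply: (@nneseries_partial_le _ xpredT (fun j => kap n j * xi j w ^+ 2)).
  by move=> j; rewrite mulr_ge0// sqr_ge0.
by rewrite fineK// -/(Defs.esum1 _) esum1_from0.
Qed.

(** The squared observation is expanded, and the centring by [rho] is distributed over the summands,
    turning xi_j^2 into xi_j^2 - 1. Convergence comes from (x + y)^2 <= 2 x^2 + 2 y^2 and the almost
    sure bound on the weighted squares. *)
Lemma Tstat_cvg n (th : nat -> R) (F : R) : (1 <= n)%N -> (forall N, \sum_(1 <= j < N) th j ^+ 2 <= F) ->
  {ae P, forall w,
    (xi_sum xi (wgt sigma kap n) sq1 N w + n%:R ^+ 2 * \sum_(1 <= j < N) kap n j * th j ^+ 2
     + xi_sum xi (fun j => 2 * sigma * n%:R ^+ 2 * n%:R `^ (- (1 / 2)) * kap n j * th j) id N w)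
    @[N --> \oo] --> n%:R ^+ 2 * Tstat xi sigma kap n th w}.
Proof.
move=> n1 HF; apply: filterS (ae_weighted_squares_bounded n1) => w [B HB].
have n0 : 0 < n%:R :> R by rewrite ltr0n.
set c := n%:R `^ (- (1 / 2)).
have c2 : c ^+ 2 = n%:R^-1.
  rewrite /c -powR_mulrn ?powR_ge0// -powRrM (_ : - (1 / 2) * 2%:R = -1); last by field.
  by rewrite powR_inv1// ltW.
have cT := @rsum1_cvg _ (fun j => kap n j * obs xi sigma n th w j ^+ 2)
  (2 * (kap n 1%N * F) + 2 * (sigma ^+ 2 * n%:R^-1) * B).
have {cT}cT : (\sum_(1 <= j < N) kap n j * obs xi sigma n th w j ^+ 2) @[N --> \oo] -->
    rsum1 (fun j => kap n j * obs xi sigma n th w j ^+ 2).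
  apply: cT => [j|N]; first by rewrite mulr_ge0// sqr_ge0.
  apply: (@le_trans _ _ (2 * (kap n 1%N * \sum_(1 <= j < N) th j ^+ 2) +
      2 * (sigma ^+ 2 * n%:R^-1) * \sum_(1 <= j < N) kap n j * xi j w ^+ 2)); last first.
    apply: lerD; first by rewrite ler_pM2l// ler_wpM2l.
    by apply: ler_wpM2l => //; rewrite mulr_ge0// divr_ge0// sqr_ge0.
  rewrite !mulr_sumr -big_split/= !big_nat; apply: ler_sum => j /andP[j1 _].
  have kj := kap_nonincreasing a1 n1 (leqnn 1) j1.
  rewrite /obs -/c -c2.
  apply: (@le_trans _ _ (kap n j * (2 * th j ^+ 2 + 2 * (sigma * c * xi j w) ^+ 2))).
    apply: ler_wpM2l => //.
    by have := sqr_ge0 (th j - sigma * c * xi j w); lra.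
  rewrite mulrDr; apply: lerD.
    by rewrite mulrCA ler_pM2l// ler_wpM2r// sqr_ge0.
  rewrite le_eqVlt; apply/orP; left; apply/eqP; ring.
have cR : (\sum_(1 <= j < N) kap n j) @[N --> \oo] --> rho kap n.
  have -> : rho kap n = rsum1 (kap n) by rewrite rsum1_fine.
  by apply: (@rsum1_cvg _ _ (rho kap n)) => // N; exact: (kap_sum_le kap0 a3).
have lim : (n%:R ^+ 2 * (\sum_(1 <= j < N) kap n j * obs xi sigma n th w j ^+ 2 -
    sigma ^+ 2 * n%:R^-1 * \sum_(1 <= j < N) kap n j)) @[N --> \oo] -->
    n%:R ^+ 2 * Tstat xi sigma kap n th w.
  apply: cvgM; first exact: cvg_cst.
  by apply: cvgB => //; apply: cvgM => //; exact: cvg_cst.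
apply: cvg_trans lim; apply: near_eq_cvg; near=> N.
rewrite /xi_sum !mulr_sumr -sumrB mulr_sumr -!big_split/=; apply: eq_bigr => j _.
rewrite /obs -/c /wgt /sq1.
have -> : sigma ^+ 2 * n%:R * kap n j = n%:R ^+ 2 * (sigma ^+ 2 * n%:R^-1 * kap n j).
  by field; exact: lt0r_neq0.
by rewrite -c2; ring.
Unshelve. all: by end_near. Qed.

Let sum0 N : \sum_(1 <= j < N) (0 : R) ^+ 2 <= 0.
Proof. by rewrite big1// => j _; rewrite expr0n. Qed.

Lemma null_quad_limit n (v0 v1 e : R) : (1 <= n)%N ->
  (forall j, (1 <= j)%N -> `|wgt sigma kap n j| <= e) ->
  (forall N, \sum_(1 <= j < N) wgt sigma kap n j ^+ 2 <= v1) ->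
  (exists N, v0 <= \sum_(1 <= j < N) wgt sigma kap n j ^+ 2) ->
  quad_limit P xi (wgt sigma kap n)
    (fun w => n%:R ^+ 2 * Tstat xi sigma kap n (fun=> 0) w) v0 v1 e.
Proof.
move=> n1 we wv1 wv0; split => //.
  by apply: measurable_funM => //; exact: measurable_Tstat.
apply: filterS (@Tstat_cvg n (fun=> 0) 0 n1 sum0) => w; apply: cvg_trans.
apply: near_eq_cvg; near=> N.
rewrite [X in _ * X]big1 ?mulr0 ?addr0; last by move=> j _; rewrite expr0n mulr0.
rewrite [X in _ + X]big1 ?addr0// => j _.
by rewrite mulr0 mul0r.
Unshelve. all: by end_near. Qed.

(** Both statistics use the same noise, so the quadratic parts cancel exactly and a limit of linear
    forms remains; Chebyshev's inequality applies with all weights bounded by the first. *)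
Lemma alternative_deviation n (th : nat -> R) (F eta : R) : (1 <= n)%N ->
  (forall N, \sum_(1 <= j < N) th j ^+ 2 <= F) -> 0 < eta ->
  Pr P [set w | eta <= `|n%:R ^+ 2 * Tstat xi sigma kap n th w
     - n%:R ^+ 2 * Tstat xi sigma kap n (fun=> 0) w - n%:R ^+ 2 * energy n th|]
  <= (4 * sigma ^+ 2 * n%:R ^+ 3 * kap n 1%N ^+ 2 * F) / eta ^+ 2.
Proof.
move=> n1 HF eta0.
have n0 : 0 < n%:R :> R by rewrite ltr0n.
pose c : R := n%:R `^ (- (1 / 2)).
have c2 : c ^+ 2 = n%:R^-1.
  rewrite /c -powR_mulrn ?powR_ge0// -powRrM (_ : - (1 / 2) * 2%:R = -1); last by field.
  by rewrite powR_inv1// ltW.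
pose cc j := 2 * sigma * n%:R ^+ 2 * c * kap n j * th j.
apply: (@truncated_chebyshev _ _ _ _ (xi_sum xi cc id)).
- by move=> N; apply: (measurable_xi_sum Hxi); exact: measurable_id.
- apply: measurable_funB => //; apply: measurable_funB.
    by apply: measurable_funM => //; exact: measurable_Tstat.
  by apply: measurable_funM => //; exact: measurable_Tstat.
- have H1 := @Tstat_cvg n th F n1 HF.
  have H0 := @Tstat_cvg n (fun=> 0) 0 n1 sum0.
  apply: filterS2 H1 H0 => w c1 c0.
  have cE := energy_cvg n1 HF.
  have cE' : (n%:R ^+ 2 * \sum_(1 <= j < N) kap n j * th j ^+ 2) @[N --> \oo] -->
      n%:R ^+ 2 * energy n th by apply: cvgM => //; exact: cvg_cst.
  apply: cvg_trans; last exact: (cvgB (cvgB c1 c0) cE').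
  apply: near_eq_cvg; near=> N.
  rewrite /= !fctE.
  rewrite (_ : \sum_(1 <= j < N) kap n j * 0 ^+ 2 = 0); last first.
    by rewrite big1// => j _; rewrite expr0n mulr0.
  rewrite (_ : xi_sum xi (fun j => _ * 0) id N w = 0); last first.
    by rewrite /xi_sum big1// => j _; rewrite mulr0 mul0r.
  by rewrite /cc; ring.
- by move=> N; have [] := id_sum_second_moment Hxi cc N.
- move=> N; have [_ _ ->] := id_sum_second_moment Hxi cc N.
  apply: (@le_trans _ _ (4 * sigma ^+ 2 * n%:R ^+ 3 * kap n 1%N ^+ 2 *
      \sum_(1 <= j < N) th j ^+ 2)); last first.
    by apply: ler_wpM2l => //; rewrite !mulr_ge0 ?exprn_ge0// ltW.
  rewrite mulr_sumr !big_nat; apply: ler_sum => j /andP[j1 _].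
  have -> : cc j ^+ 2 = 4 * sigma ^+ 2 * n%:R ^+ 3 * kap n j ^+ 2 * th j ^+ 2.
    have -> : cc j ^+ 2 = 4 * sigma ^+ 2 * n%:R ^+ 4 * c ^+ 2 * kap n j ^+ 2 * th j ^+ 2.
      by rewrite /cc; ring.
    by rewrite c2; field; exact: lt0r_neq0.
  apply: ler_wpM2r; first exact: sqr_ge0.
  apply: ler_wpM2l; first by rewrite !mulr_ge0 ?exprn_ge0// ltW.
  by rewrite lerXn2r ?nnegrE//; exact: (kap_nonincreasing a1).
- exact: eta0.
Unshelve. all: by end_near. Qed.

End Statistic.

(** * Consistency of threshold tests *)

Section LimSup.
Variable R : realType.
Implicit Type u : nat -> R.

Let bounded01 u : (forall n, 0 <= u n <= 1) -> bounded_fun u.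
Proof.
move=> u01; exists 1; split => // M M1 n _ /=; apply: le_trans (ltW M1).
by have /andP[u0 u1] := u01 n; rewrite ger0_norm.
Qed.

Let sups_ub u N n : (forall n, 0 <= u n <= 1) -> (N <= n)%N -> u n <= sups u N.
Proof.
move=> u01 Nn; apply: ub_le_sup; last by exists n.
by exists 1 => _ [m _ <-]; have /andP[] := u01 m.
Qed.

Lemma limn_sup_le u (c : R) : (forall n, 0 <= u n <= 1) ->
  (\forall n \near \oo, u n <= c) -> limn_sup u <= c.
Proof.
move=> u01 [N _ HN]; rewrite limn_supE; last exact: bounded01.
apply: (@le_trans _ _ (sups u N)).
  apply: ge_inf; last by exists N.
  exists 0 => _ [m _ <-]; apply: le_trans (sups_ub u01 (leqnn m)).
  by have /andP[] := u01 m.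
apply: ge_sup; first by exists (u N), N => /=.
by move=> _ [m /= Nm <-]; exact: HN.
Qed.

Lemma limn_sup_lt u (c : R) : (forall n, 0 <= u n <= 1) -> limn_sup u < c ->
  exists2 c' : R, c' < c & \forall n \near \oo, u n <= c'.
Proof.
move=> u01; rewrite limn_supE; last exact: bounded01.
move=> uc; have [N HN] : exists N, sups u N < c.
  apply/not_existsP => H; move: uc; apply/negP; rewrite -leNgt.
  apply: lb_le_inf; first by exists (sups u 0%N), 0%N.
  by move=> _ [N _ <-]; rewrite leNgt; apply/negP; exact: H.
by exists (sups u N) => //; exists N => // n /= Nn; exact: sups_ub.
Qed.

End LimSup.

Section Testing.
Context (R : realType) (d : measure_display) (Omega : measurableType d)
  (P : probability Omega R) (xi : nat -> Omega -> R).
Hypothesis Hxi : iid_std_normal P xi.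
(** [X n] stands for the scaled statistic under the hypothesis and [Y n] for the one under the
    alternative, built on the same noise: they differ by the shift [A n] up to an error that
    vanishes in probability. *)
Variables (X Y : nat -> Omega -> R) (A : nat -> R) (a : nat -> nat -> R) (v0 v1 : R).
Hypotheses (mX : forall n, measurable_fun setT (X n))
  (mY : forall n, measurable_fun setT (Y n)) (v00 : 0 < v0) (v10 : 0 < v1)
  (HX : forall e : R, 0 < e -> \forall n \near \oo, quad_limit P xi (a n) (X n) v0 v1 e)
  (HY : forall eta eps : R, 0 < eta -> 0 < eps ->
    \forall n \near \oo, Pr P [set w | eta <= `|Y n w - X n w - A n|] <= eps).

Let m_le (f : Omega -> R) (t : R) : measurable_fun setT f -> measurable [set w | f w <= t].
Proof.
move=> mf; rewrite (_ : [set w | _] = f @^-1` `]-oo, t]%classic).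
  by rewrite -[X in measurable X]setTI; exact: mf.
by apply/seteqP; split => w /=; rewrite in_itv.
Qed.

Let m_gt (f : Omega -> R) (t : R) : measurable_fun setT f -> measurable [set w | t < f w].
Proof.
move=> mf; rewrite (_ : [set w | _] = ~` [set w | f w <= t]); first exact/measurableC/m_le.
by apply/seteqP; split => w /=; rewrite ltNge => /negP.
Qed.

Let m_ge (f : Omega -> R) (t : R) : measurable_fun setT f -> measurable [set w | t <= f w].
Proof.
move=> mf; rewrite (_ : [set w | _] = f @^-1` `[t, +oo[%classic).
  by rewrite -[X in measurable X]setTI; exact: mf.
by apply/seteqP; split => w /=; rewrite in_itv/= andbT.
Qed.

Let m_dist n (t eta : R) : measurable [set w | `|X n w - t| <= eta].
Proof. by apply: m_le; apply: measurableT_comp => //; exact: measurable_funB. Qed.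

Let m_dev n (eta : R) : measurable [set w | eta <= `|Y n w - X n w - A n|].
Proof.
apply: m_ge; apply: measurableT_comp => //; apply: measurable_funB => //.
exact: measurable_funB.
Qed.

Let m_absX n (M : R) : measurable [set w | M <= `|X n w|].
Proof. by apply: m_ge; exact: measurableT_comp. Qed.

Let PrC n (t : R) : Pr P [set w | X n w <= t] = 1 - Pr P [set w | t < X n w].
Proof.
rewrite -Pr_setC; last exact: m_gt.
by congr Pr; apply/seteqP; split => w /=; [rewrite leNgt => /negP|move/negP; rewrite -leNgt].
Qed.

Let tight_constant (m : R) : 0 < m -> exists2 M : R, 0 < M & 2 * v1 / M ^+ 2 < m.
Proof.
move=> m0; have q0 : 0 <= 2 * v1 / m by rewrite divr_ge0// ?mulr_ge0// ltW.
exists (2 * v1 / m + 1); first by rewrite ltr_wpDl.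
set M := _ + 1; have M1 : 1 <= M by rewrite lerDr.
have M0 : 0 < M by exact: lt_le_trans M1.
rewrite ltr_pdivrMr; last exact: exprn_gt0.
rewrite [ltRHS]mulrC -ltr_pdivrMr//.
by apply: (@lt_le_trans _ _ M); [rewrite ltrDl|rewrite expr2 ler_peMr// ltW].
Qed.

(** By tightness a threshold far to the right has level near 0 and one far to the left has level
    near 1; both are excluded since alpha lies strictly inside (0, 1). *)
Lemma thresholds_bounded (alpha : R) (tau : nat -> R) : 0 < alpha < 1 ->
  Pr P [set w | tau n < X n w] @[n --> \oo] --> alpha ->
  exists2 M : R, 0 < M & \forall n \near \oo, `|tau n| <= M.
Proof.
move=> /andP[al0 al1] cv.
pose m := Num.min alpha (1 - alpha) / 2.
have m0 : 0 < m by rewrite divr_gt0// lt_min al0 subr_gt0.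
have m1 : 2 * m <= alpha by rewrite /m mulrC divfK// ge_min lexx.
have m2 : 2 * m <= 1 - alpha by rewrite /m mulrC divfK// ge_min lexx orbT.
have [M M0 HM] := tight_constant m0.
exists M => //; near=> n.
have Q : quad_limit P xi (a n) (X n) v0 v1 1 by near: n; exact: HX.
have T := quad_limit_tight Hxi M0 Q.
have : `|alpha - Pr P [set w | tau n < X n w]| < m.
  by near: n; move/cvgrPdist_lt: cv; exact.
rewrite ltr_norml => /andP[h1 h2].
rewrite leNgt; apply/negP; rewrite ltr_normr => /orP[t1|t2].
  have : Pr P [set w | tau n < X n w] <= Pr P [set w | M <= `|X n w|].
    apply: Pr_le => [||w /= tw]; [exact: m_gt|exact: m_absX|].
    by apply: le_trans (ler_norm _); apply: ltW; exact: lt_trans tw.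
  by lra.
have : Pr P [set w | X n w <= tau n] <= Pr P [set w | M <= `|X n w|].
  apply: Pr_le => [||w /= tw]; [exact: m_le|exact: m_absX|].
  by rewrite -normrN; apply: le_trans (ler_norm _); lra.
by rewrite PrC; lra.
Unshelve. all: by end_near. Qed.

(** Outside a rare event, Y <= tau forces X <= tau - 3/4 a0. The window of half-width a0/4 around
    tau - 3/8 a0 lies strictly between this range and the rejection region; as tau is bounded, its
    mass is at least a fixed c, and this mass is lost to the type II error. *)
Lemma separated_consistent (a0 alpha : R) (tau : nat -> R) : 0 < a0 ->
  (\forall n \near \oo, a0 <= A n) -> 0 < alpha < 1 ->
  Pr P [set w | tau n < X n w] @[n --> \oo] --> alpha ->
  limn_sup (fun n => Pr P [set w | Y n w <= tau n]) < 1 - alpha.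
Proof.
move=> a00 aA al01 cv.
have [M M0 tM] := thresholds_bounded al01 cv.
have q0 : 0 < a0 / 4 by rewrite divr_gt0.
have [c [e [c0 e0 Hc]]] := quad_limit_spread Hxi v00 (ltW v10) (ltW (addr_gt0 M0 a00)) q0.
(* Of the gain c, one quarter covers the rare event and one quarter the deviation of the level from
   alpha. *)
apply: (@le_lt_trans _ _ (1 - alpha - c / 2)); last by lra.
apply: limn_sup_le => [n|]; first by rewrite Pr_ge0 Pr_le1//; exact: m_le.
near=> n.
have An : a0 <= A n by near: n.
have tn : `|tau n| <= M by near: n.
have Q : quad_limit P xi (a n) (X n) v0 v1 e by near: n; exact: HX.
have dev : Pr P [set w | a0 / 4 <= `|Y n w - X n w - A n|] <= c / 4.
  by near: n; apply: HY => //; rewrite divr_gt0.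
have cn : `|alpha - Pr P [set w | tau n < X n w]| < c / 4.
  by near: n; move/cvgrPdist_lt: cv; apply; rewrite divr_gt0.
have s1 : c <= Pr P [set w | `|X n w - (tau n - 3 / 8 * a0)| <= a0 / 4].
  apply: (Hc (a n)) => //; apply: le_trans (ler_normB _ _) _; apply: lerD => //.
  by rewrite ger0_norm; lra.
have mL : measurable [set w | X n w <= tau n - 3 / 4 * a0] by exact: m_le.
have mM := m_dist n (tau n - 3 / 8 * a0) (a0 / 4).
have mR : measurable [set w | tau n < X n w] by exact: m_gt.
have d1 : [set w | X n w <= tau n - 3 / 4 * a0] `&`
    [set w | `|X n w - (tau n - 3 / 8 * a0)| <= a0 / 4] = set0.
  by apply/seteqP; split => w //= [h]; rewrite ler_norml => /andP[]; lra.
have d2 : ([set w | X n w <= tau n - 3 / 4 * a0] `|`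
    [set w | `|X n w - (tau n - 3 / 8 * a0)| <= a0 / 4]) `&` [set w | tau n < X n w] = set0.
  by apply/seteqP; split => w //= [[h|]]; [|rewrite ler_norml => /andP[? ?]]; lra.
have := Pr_le1 P (measurableU _ _ (measurableU _ _ mL mM) mR).
rewrite (Pr_setUI0 P (measurableU _ _ mL mM) mR d2) (Pr_setUI0 P mL mM d1) => tot.
have up : Pr P [set w | Y n w <= tau n] <=
    Pr P [set w | X n w <= tau n - 3 / 4 * a0] +
    Pr P [set w | a0 / 4 <= `|Y n w - X n w - A n|].
  apply: le_trans (Pr_setU P mL (m_dev n (a0 / 4))).
  apply: Pr_le => [||w /= Yw]; [exact: m_le|exact: measurableU|].
  have [dw|dw] := leP (a0 / 4) `|Y n w - X n w - A n|; first by right.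
  by left; move: dw; rewrite ltr_norml => /andP[]; lra.
by move: cn; rewrite ltr_norml => /andP[]; lra.
Unshelve. all: by end_near. Qed.

(** Possible atoms preclude an exact median. The threshold lies 1/(n+1) to the right of the supremum
    of those with level above 1/2, and whatever is missing to 1/2 sits in a window of half-width
    2/(n+1). *)
Let near_median n : quad_limit P xi (a n) (X n) v0 v1 1 -> exists tau : R,
  Pr P [set w | tau < X n w] <= 1 / 2 /\
  1 / 2 < Pr P [set w | tau < X n w] + Pr P [set w | `|X n w - tau| <= 2 / n.+1%:R].
Proof.
move=> Q; have h0 : 0 < 1 / 2 :> R by rewrite divr_gt0.
have [M M0 HM] := tight_constant h0.
have T := quad_limit_tight Hxi M0 Q.
pose F t := Pr P [set w | t < X n w].
have Fmono s t : s <= t -> F t <= F s.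
  move=> st; apply: Pr_le => [||w /=]; [exact: m_gt|exact: m_gt|exact: le_lt_trans].
pose E := [set t | 1 / 2 < F t].
have EM : E (- M).
  rewrite /E /=; have : Pr P [set w | X n w <= - M] <= Pr P [set w | M <= `|X n w|].
    apply: Pr_le => [||w /= tw]; [exact: m_le|exact: m_absX|].
    by rewrite -normrN; apply: le_trans (ler_norm _); lra.
  by rewrite PrC -/(F _); lra.
have Eub t : E t -> t <= M.
  rewrite /E /= => Et; rewrite leNgt; apply/negP => Mt.
  have := Fmono _ _ (ltW Mt).
  have : F M <= Pr P [set w | M <= `|X n w|].
    apply: Pr_le => [||w /= tw]; [exact: m_gt|exact: m_absX|].
    by apply: le_trans (ler_norm _); exact: ltW.
  by lra.
have hs : has_sup E by split; [exists (- M)|exists M => t; exact: Eub].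
pose dl : R := n.+1%:R^-1.
have dl0 : 0 < dl by rewrite invr_gt0.
exists (sup E + dl); split.
  rewrite leNgt; apply/negP => H.
  have : sup E + dl <= sup E by apply: ub_le_sup; [case: hs|exact: H].
  by lra.
have [t Et ts] := sup_adherent dl0 hs.
have tle : t <= sup E by apply: ub_le_sup => //; case: hs.
apply: (lt_le_trans Et).
apply: le_trans (Pr_setU P _ (m_dist n _ _)); last exact: m_gt.
apply: Pr_le => [||w /= tw]; [exact: m_gt|by apply: measurableU; [exact: m_gt|exact: m_dist]|].
have [sw|sw] := ltP (sup E + dl) (X n w); first by left.
by right; rewrite /= -/dl ler_norml; apply/andP; split; lra.
Qed.

(** Near-median thresholds have level tending to 1/2 by anti-concentration. If [A n] were below
    eta/2, then X <= tau would imply Y <= tau except when X is within eta of tau or the deviation is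
    large, and the type II error would come too close to 1/2. *)
Lemma consistent_separated :
  (forall tau : nat -> R, Pr P [set w | tau n < X n w] @[n --> \oo] --> (1 / 2 : R) ->
     limn_sup (fun n => Pr P [set w | Y n w <= tau n]) < 1 / 2) ->
  exists2 a0 : R, 0 < a0 & \forall n \near \oo, a0 <= A n.
Proof.
move=> cons.
have /choice[tau Htau] : forall n, exists tau : R, quad_limit P xi (a n) (X n) v0 v1 1 ->
    Pr P [set w | tau < X n w] <= 1 / 2 /\
    1 / 2 < Pr P [set w | tau < X n w] + Pr P [set w | `|X n w - tau| <= 2 / n.+1%:R].
  move=> n; have [Q|nQ] := pselect (quad_limit P xi (a n) (X n) v0 v1 1).
    by have [t Ht] := near_median Q; exists t.
  by exists 0.
have cv : Pr P [set w | tau n < X n w] @[n --> \oo] --> (1 / 2 : R).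
  apply/cvgrPdist_le => eps eps0.
  have [eta [e [eta0 e0 He]]] := quad_limit_anticoncentration Hxi v00 (ltW v10) eps0.
  near=> n.
  have Q1 : quad_limit P xi (a n) (X n) v0 v1 1 by near: n; exact: HX.
  have Qe : quad_limit P xi (a n) (X n) v0 v1 e by near: n; exact: HX.
  have [h1 h2] := Htau n Q1.
  have h3 : Pr P [set w | `|X n w - tau n| <= 2 / n.+1%:R] <= eps.
    apply: le_trans (He _ _ (tau n) Qe).
    apply: Pr_le => [||w /= h]; [exact: m_dist|exact: m_dist|apply: le_trans h _].
    rewrite ler_pdivrMr// mulrC -ler_pdivrMr//; apply: ltW.
    apply: (@lt_trans _ _ n%:R); last by rewrite ltr_nat.
    by near: n; exact: nbhs_infty_gtr.
  by rewrite ger0_norm; lra.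
have G01 n : 0 <= Pr P [set w | Y n w <= tau n] <= 1.
  by rewrite Pr_ge0 Pr_le1//; exact: m_le.
have [c' c'lt Gc] := limn_sup_lt G01 (cons tau cv).
(* Two exceptional events of this probability use up only half of the gap between c' and 1/2. *)
have eps0 : 0 < (1 / 2 - c') / 4 by rewrite divr_gt0// subr_gt0.
have [eta [e [eta0 e0 He]]] := quad_limit_anticoncentration Hxi v00 (ltW v10) eps0.
exists (eta / 2); first by rewrite divr_gt0.
near=> n.
have Q1 : quad_limit P xi (a n) (X n) v0 v1 1 by near: n; exact: HX.
have Qe : quad_limit P xi (a n) (X n) v0 v1 e by near: n; exact: HX.
have [h1 _] := Htau n Q1.
have Gn : Pr P [set w | Y n w <= tau n] <= c' by near: n.
have dev : Pr P [set w | eta / 2 <= `|Y n w - X n w - A n|] <= (1 / 2 - c') / 4.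
  by near: n; apply: HY => //; rewrite divr_gt0.
have anti := He _ _ (tau n) Qe.
rewrite leNgt; apply/negP => An.
have mG : measurable [set w | Y n w <= tau n] by exact: m_le.
have : Pr P [set w | X n w <= tau n] <= Pr P [set w | Y n w <= tau n] +
    Pr P [set w | `|X n w - tau n| <= eta] +
    Pr P [set w | eta / 2 <= `|Y n w - X n w - A n|].
  apply: (@le_trans _ _ (Pr P ([set w | Y n w <= tau n] `|`
      [set w | `|X n w - tau n| <= eta] `|` [set w | eta / 2 <= `|Y n w - X n w - A n|]))).
    apply: Pr_le => [||w /= Xw]; first exact: m_le.
      by apply: measurableU; [apply: measurableU => //; exact: m_dist|exact: m_dev].
    have [dw|dw] := leP (eta / 2) `|Y n w - X n w - A n|; first by right.
    have [ew|ew] := leP `|X n w - tau n| eta; first by left; right.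
    left; left; move: dw ew; rewrite ltr_norml => /andP[d1 d2].
    by rewrite ler0_norm; lra.
  apply: le_trans (Pr_setU P _ _) _; [by apply: measurableU => //; exact: m_dist|exact: m_dev|].
  by rewrite lerD2r; apply: Pr_setU => //; exact: m_dist.
by rewrite PrC; lra.
Unshelve. all: by end_near. Qed.

End Testing.

(** * Consistency and the energy captured by the weights *)

Section Exponents.
Variables (R : realType) (r : R).
Hypothesis r12 : r < 1 / 2.

Let r2 : 2 * r < 1.
Proof. by rewrite mulrC -ltr_pdivlMr. Qed.

(** This smallness of n^(2r-1) controls both the largest coefficient of the quadratic form and the
    variance of the linear form. *)
Lemma powR_ratio_small (e : R) : 0 < e ->
  \forall n \near \oo, n%:R `^ (2 * r) <= e * n%:R.
Proof.
move=> e0; have p0 : 0 < 1 - 2 * r by rewrite subr_gt0.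
near=> n.
have n0 : 0 < n%:R :> R by rewrite ltr0n; near: n; exact: nbhs_infty_gt.
have : (e^-1) `^ (1 - 2 * r)^-1 <= n%:R by near: n; exact: nbhs_infty_ger.
move/(ge0_ler_powR (ltW p0) (powR_ge0 _ _) (ltW n0)).
rewrite /= -powRrM mulVf ?gt_eqF// powRr1 ?invr_ge0 ?(ltW e0)// => H.
have nE : n%:R = n%:R `^ (2 * r) * n%:R `^ (1 - 2 * r) :> R.
  rewrite -powRD; last by rewrite (gt_eqF n0) implybT.
  by rewrite (_ : 2 * r + (1 - 2 * r) = 1) ?powRr1 ?(ltW n0)//; ring.
have H1 : 1 <= e * n%:R `^ (1 - 2 * r) by rewrite mulrC -ler_pdivrMr// mul1r.
rewrite [in leRHS]nE mulrCA ler_peMr// powR_ge0.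
Unshelve. all: by end_near. Qed.

Lemma sqr_powRN n : (n%:R `^ (- r)) ^+ 2 = (n%:R `^ (2 * r))^-1 :> R.
Proof.
rewrite -powR_mulrn ?powR_ge0// -powRrM -powRN; congr (_ `^ _); ring.
Qed.

Lemma powR_dimension n : (1 <= n)%N ->
  n%:R `^ (2 - 4 * r) * (n%:R `^ (2 * r)) ^+ 2 = n%:R ^+ 2 :> R.
Proof.
move=> n1; have n0 : n%:R != 0 :> R by rewrite pnatr_eq0 -lt0n.
rewrite -!powR_mulrn ?powR_ge0// -powRrM -powRD; last by rewrite n0 implybT.
congr (_ `^ _); ring.
Qed.

(** The origin of s: at frequencies of order k_n, that is n^(2-4r), the Besov ball allows a squared
    tail of exactly the order n^(-2r) of the squared norm of the alternatives. *)
Lemma besov_exponent n : (n%:R `^ (2 - 4 * r)) `^ (2 * (r / (2 - 4 * r))) = n%:R `^ (2 * r) :> R.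
Proof. rewrite -powRrM; congr (_ `^ _).
have h : 2 - 4 * r != 0 by rewrite gt_eqF//; move: r2; lra.
by field. Qed.

End Exponents.

Section Energy.
Context (R : realType) (d : measure_display) (Omega : measurableType d)
  (P : probability Omega R) (xi : nat -> Omega -> R).
Hypothesis Hxi : iid_std_normal P xi.
Variables (sigma r : R) (kap : nat -> nat -> R).
Hypotheses (sigma0 : 0 < sigma) (r12 : r < 1 / 2)
  (kap0 : forall n j, 0 <= kap n j)
  (a1 : A1 kap) (a2 : A2 sigma kap) (a3 : A3 r kap) (a5 : A5 kap).
Variables (th : nat -> nat -> R) (C : R).
Hypotheses (C0 : 0 < C) (thC : forall n N, (1 <= n)%N ->
  \sum_(1 <= j < N) th n j ^+ 2 <= C / n%:R `^ (2 * r)).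

(** The scaling n^2, modified at n = 0 so that thresholds can be rescaled back for every n. *)
Let sc (n : nat) : R := if n == 0%N then 1 else n%:R ^+ 2.

Let sc_gt0 n : 0 < sc n.
Proof. by rewrite /sc; case: eqP => // /eqP n0; rewrite exprn_gt0// ltr0n lt0n. Qed.

Let scE n : (1 <= n)%N -> sc n = n%:R ^+ 2.
Proof. by rewrite /sc lt0n => /negbTE ->. Qed.

Let X n w := sc n * Tstat xi sigma kap n (fun=> 0) w.
Let Y n w := sc n * Tstat xi sigma kap n (th n) w.
Let A n := n%:R ^+ 2 * energy kap n (th n).

Let mX n : measurable_fun setT (X n).
Proof. by apply: measurable_funM => //; exact: (measurable_Tstat Hxi). Qed.

Let mY n : measurable_fun setT (Y n).
Proof. by apply: measurable_funM => //; exact: (measurable_Tstat Hxi). Qed.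

Let kap1_small : exists2 q : R, 0 < q & forall n, (1 <= n)%N ->
  n%:R ^+ 2 * kap n 1%N <= q * n%:R `^ (2 * r).
Proof.
have [b [q1 [q2 [q3 [q4 [[b0 _ q20 _ _] H]]]]]] := weights_asymptotics sigma0 kap0 a1 a2 a3 a5.
exists (b * q2); first exact: mulr_gt0.
move=> n n1; have [h1 _ h2 _ _] := H n n1.
apply: (@le_trans _ _ (n%:R ^+ 2 * (b * kapn kap n))); first by rewrite ler_wpM2l// sqr_ge0.
by rewrite mulrCA -mulrA ler_pM2l.
Qed.

Let HX v0 v1 : (forall n, (1 <= n)%N ->
    (forall N, \sum_(1 <= j < N) wgt sigma kap n j ^+ 2 <= v1) /\
    (exists N, v0 <= \sum_(1 <= j < N) wgt sigma kap n j ^+ 2)) ->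
  forall e : R, 0 < e -> \forall n \near \oo, quad_limit P xi (wgt sigma kap n) (X n) v0 v1 e.
Proof.
move=> Hv e e0; have [q q0 Hq] := kap1_small.
near=> n.
have n1 : (1 <= n)%N by near: n; exact: nbhs_infty_gt.
have n0 : 0 < n%:R :> R by rewrite ltr0n.
have [h1 h2] := Hv n n1.
have -> : X n = fun w => n%:R ^+ 2 * Tstat xi sigma kap n (fun=> 0) w.
  by apply/funext => w; rewrite /X scE.
apply: (null_quad_limit Hxi kap0 a1 a3) => // j j1.
rewrite ger0_norm; last first.
  by rewrite /wgt; apply: mulr_ge0 => //; apply: mulr_ge0 => //; exact: sqr_ge0.
apply: (@le_trans _ _ (sigma ^+ 2 * n%:R * kap n 1%N)).
  apply: ler_wpM2l; first by rewrite mulr_ge0// sqr_ge0.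
  exact: (kap_nonincreasing a1).
have s0 : 0 < sigma ^+ 2 * q by rewrite mulr_gt0// exprn_gt0.
have xe : n%:R `^ (2 * r) <= e / (sigma ^+ 2 * q) * n%:R.
  by near: n; apply: powR_ratio_small => //; rewrite divr_gt0// mulr_gt0// exprn_gt0.
rewrite -(ler_pM2r n0); apply: (@le_trans _ _ (sigma ^+ 2 * (q * n%:R `^ (2 * r)))).
  rewrite [leLHS](_ : _ = sigma ^+ 2 * (n%:R ^+ 2 * kap n 1%N)); last by ring.
  by rewrite ler_wpM2l ?sqr_ge0//; exact: Hq.
rewrite mulrA; apply: le_trans (ler_wpM2l (ltW s0) xe) _.
rewrite le_eqVlt; apply/orP; left; apply/eqP; field.
by rewrite (gt_eqF q0) (gt_eqF sigma0).
Unshelve. all: by end_near. Qed.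

(** The first weight has order at most n^(2r-2) and the squared norm n^(-2r), so the variance bound
    n^3 (n^(2r-2))^2 n^(-2r) is n^(2r-1). *)
Let HY (eta eps : R) : 0 < eta -> 0 < eps ->
  \forall n \near \oo, Pr P [set w | eta <= `|Y n w - X n w - A n|] <= eps.
Proof.
move=> eta0 eps0; have [q q0 Hq] := kap1_small.
pose K := 4 * sigma ^+ 2 * q ^+ 2 * C.
have K0 : 0 < K by rewrite !mulr_gt0// exprn_gt0.
near=> n.
have n1 : (1 <= n)%N by near: n; exact: nbhs_infty_gt.
have n0 : 0 < n%:R :> R by rewrite ltr0n.
rewrite /Y /X /A scE//.
apply: le_trans (alternative_deviation Hxi sigma0 kap0 a1 a3 n1 (fun N => thC N n1) eta0) _.
have xe : n%:R `^ (2 * r) <= eps * eta ^+ 2 / K * n%:R.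
  by near: n; apply: powR_ratio_small => //; rewrite divr_gt0// mulr_gt0// exprn_gt0.
set x := n%:R `^ (2 * r) in xe *.
have x0 : 0 < x by rewrite powR_gt0.
rewrite ler_pdivrMr ?exprn_gt0//.
have kq : n%:R ^+ 2 * kap n 1%N <= q * x by exact: Hq.
have kq2 : (n%:R ^+ 2 * kap n 1%N) ^+ 2 <= (q * x) ^+ 2.
  by rewrite lerXn2r ?nnegrE// mulr_ge0// ?sqr_ge0// ltW.
have -> : 4 * sigma ^+ 2 * n%:R ^+ 3 * kap n 1%N ^+ 2 * (C / x) =
    4 * sigma ^+ 2 * C / (x * n%:R) * (n%:R ^+ 2 * kap n 1%N) ^+ 2.
  by field; rewrite !gt_eqF.
apply: le_trans (ler_wpM2l _ kq2) _.
  by rewrite divr_ge0// !mulr_ge0// ?sqr_ge0// ltW.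
have -> : 4 * sigma ^+ 2 * C / (x * n%:R) * (q * x) ^+ 2 = K * x / n%:R.
  by rewrite /K; field; rewrite !gt_eqF.
rewrite ler_pdivrMr//; apply: le_trans (ler_wpM2l (ltW K0) xe) _.
by rewrite le_eqVlt; apply/orP; left; apply/eqP; field; rewrite gt_eqF.
Unshelve. all: by end_near. Qed.

Lemma alpha_errE n (t : R) : alpha_err P xi sigma kap n t = Pr P [set w | sc n * t < X n w].
Proof.
congr (fine (P _)); apply/seteqP; split => w /=; by rewrite /X ltr_pM2l.
Qed.

Lemma beta_errE n (t : R) : beta_err P xi sigma kap n t (th n) = Pr P [set w | Y n w <= sc n * t].
Proof.
congr (fine (P _)); apply/seteqP; split => w /=; by rewrite /Y ler_pM2l.
Qed.

Lemma consistent_iff_energy :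
  (forall (alpha : R) (t : nat -> R), 0 < alpha < 1 ->
    (fun n => alpha_err P xi sigma kap n (t n) / alpha) @ \oo --> (1:R) ->
    limn_sup (fun n => beta_err P xi sigma kap n (t n) (th n)) < 1 - alpha) <->
  exists2 a0 : R, 0 < a0 & \forall n \near \oo, a0 <= n%:R ^+ 2 * energy kap n (th n).
Proof.
have [v0 [v1 [v00 v10 Hv]]] := wgt_sumsq_bounds sigma0 a2.
have hX := HX Hv.
split=> [cons|[a0 a00 HA] alpha t al01 cv].
  apply: (consistent_separated Hxi mX mY v00 v10 hX HY) => tau cv.
  have h01 : 0 < (1 / 2 : R) < 1 by lra.
  (* Level 1/2 suffices in this direction; the converse treats every level. *)
  have := cons (1 / 2) (fun n => tau n / sc n) h01.
  have E n : sc n * (tau n / sc n) = tau n by rewrite mulrC divfK// gt_eqF.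
  rewrite (_ : (fun n => beta_err P xi sigma kap n (tau n / sc n) (th n)) =
     (fun n => Pr P [set w | Y n w <= tau n])); last first.
    by apply/funext => n; rewrite beta_errE E.
  rewrite (_ : (fun n => alpha_err P xi sigma kap n (tau n / sc n) / (1 / 2)) =
     (fun n => Pr P [set w | tau n < X n w] / (1 / 2))); last first.
    by apply/funext => n; rewrite alpha_errE E.
  move=> H; apply: lt_le_trans (H _) _; last by lra.
  have cv2 : (Pr P [set w | tau n < X n w] / (1 / 2)) @[n --> \oo] --> (1 / 2) / (1 / 2 : R).
    by apply: cvgM => //; exact: cvg_cst.
  by rewrite (_ : 1 / 2 / (1 / 2) = 1) in cv2; [exact: cv2|field].
under eq_fun do rewrite beta_errE.
apply: (separated_consistent Hxi mX mY v00 v10 hX HY a00 HA al01).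
have {}cv : (alpha_err P xi sigma kap n (t n) / alpha * alpha) @[n --> \oo] --> 1 * alpha.
  by apply: cvgM => //; exact: cvg_cst.
rewrite mul1r in cv; apply: cvg_trans cv; apply: near_eq_cvg; near=> n.
by rewrite alpha_errE divfK// gt_eqF//; case/andP: al01.
Unshelve. all: by end_near. Qed.

End Energy.

(** * Besov truncations *)

Section FiniteExceptions.
Variable R : realType.

(** Consistency constrains only large n, whereas the decomposition is demanded for every n >= 1. The
    finitely many remaining values are absorbed into the constant one at a time; index 0, where
    positivity is not assumed, is skipped. *)
Lemma uniform_lower_bound (g : nat -> R) N (m : R) : 0 < m ->
  (forall n, (1 <= n)%N -> 0 < g n) -> (forall n, (1 <= n)%N -> (N <= n)%N -> m <= g n) ->
  exists2 m' : R, 0 < m' & forall n, (1 <= n)%N -> m' <= g n.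
Proof.
move=> m0 g0; elim: N m m0 => [|N IH] m m0 Hm; first by exists m => // n n1; exact: Hm.
have [N0|N0] := posnP N; first by exists m => // n n1; apply: Hm; rewrite ?N0.
apply: (IH (Num.min m (g N))); first by rewrite lt_min m0 g0.
move=> n n1; rewrite leq_eqVlt => /orP[/eqP <-|Nn]; first by rewrite ge_min lexx orbT.
by rewrite ge_min Hm.
Qed.

Lemma uniform_upper_bound (g : nat -> R) N (m : R) : 0 < m ->
  (forall n, (1 <= n)%N -> (N <= n)%N -> g n <= m) ->
  exists2 m' : R, 0 < m' & forall n, (1 <= n)%N -> g n <= m'.
Proof.
elim: N m => [|N IH] m m0 Hm; first by exists m => // n n1; exact: Hm.
have [N0|N0] := posnP N; first by exists m => // n n1; apply: Hm; rewrite ?N0.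
apply: (IH (Num.max m (g N))); first by rewrite lt_max m0.
move=> n n1; rewrite leq_eqVlt => /orP[/eqP <-|Nn]; first by rewrite le_max lexx orbT.
by rewrite le_max Hm.
Qed.

End FiniteExceptions.

Section Besov.
Variables (R : realType) (phi : nat -> R -> R).
Hypothesis B : ONB phi.
Implicit Types (f : R -> R) (s lam : R).

(** For lam >= J the tail of the truncation is empty; for lam < J the tail is at most the squared
    norm of f, and lam^(2s) at most J^(2s). *)
Lemma besov_truncation f s (P0 : R) J : L2 f -> 0 <= s -> 0 <= P0 ->
  J%:R `^ (2 * s) * ip f f <= P0 -> besov_ball phi s P0 (psum phi (coef phi f) J).
Proof.
move=> Lf s0 P00 HP lam lam0; set g := psum _ _ _.
have L0 : 0 <= lam `^ (2 * s) by exact: powR_ge0.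
pose b := if lam < J%:R then ip f f else 0.
apply: (@le_trans _ _ ((lam `^ (2 * s) * b)%:E)).
  rewrite EFinM; apply: lee_wpmul2l; first by rewrite lee_fin.
  apply: (@nneseries_le _ (fun j => lam < j%:R) (fun j => coef phi g j ^+ 2)) => [j|N].
    exact: sqr_ge0.
  rewrite /b; case: ifPn => [_|lJ].
    apply: (@le_trans _ _ (\sum_(1 <= j < N) coef phi g j ^+ 2)).
      by rewrite big_mkcond/=; apply: ler_sum => j _; case: ifP => // _; exact: sqr_ge0.
    apply: le_trans (bessel B N (L2_psum B _ _)) _.
    by rewrite ip_psum_psum//; exact: bessel.
  rewrite big_nat_cond big1// => j /andP[/andP[j1 _] lj].
  rewrite coef_psum//; case: ifPn => [jJ|_]; last by rewrite expr0n.
  by move: lJ; rewrite (lt_trans lj)// ltr_nat.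
rewrite lee_fin /b; case: ifPn => [lJ|_]; last by rewrite mulr0.
apply: le_trans HP; apply: ler_wpM2r; first exact: ip_ge0.
by apply: ge0_ler_powR; rewrite ?nnegrE ?mulr_ge0// ltW.
Qed.

(** The ball bounds sums of squared coefficients beyond lam; Parseval's identity, used up to an
    arbitrary e, turns this into a bound on the norm defect. Strictness of lam < J places every
    index from J on in the tail. *)
Lemma besov_tail f s (P0 : R) lam J : L2 f -> besov_ball phi s P0 f -> 0 < lam -> lam < J%:R ->
  lam `^ (2 * s) * (ip f f - \sum_(1 <= j < J) coef phi f j ^+ 2) <= P0.
Proof.
move=> Lf bf lam0 lJ; have L0 : 0 < lam `^ (2 * s) by exact: powR_gt0.
have J1 : (1 <= J)%N by rewrite -(ltr0n R); exact: lt_trans lJ.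
have part M : lam `^ (2 * s) * \sum_(1 <= j < M | lam < j%:R) coef phi f j ^+ 2 <= P0.
  rewrite mulr_sumr.
  apply: (@nneseries_partial_le _ (fun j => lam < j%:R)
    (fun j => lam `^ (2 * s) * coef phi f j ^+ 2)) => [j|].
    by rewrite mulr_ge0 ?sqr_ge0// ltW.
  have := bf lam lam0; rewrite -nneseriesZl//.
  by move=> j _; rewrite lee_fin sqr_ge0.
rewrite mulrC -ler_pdivlMr//; apply/ler_addgt0Pr => e e0.
have [N HN] := parseval B Lf e0.
have := HN (maxn N J) (leq_maxl _ _).
rewrite (@big_cat_nat _ _ _ J 1 (maxn N J))//= ?leq_maxr//.
set T := \sum_(J <= j < maxn N J) _.
suff : T <= P0 / lam `^ (2 * s) by lra.
rewrite ler_pdivlMr// mulrC; apply: le_trans (part (maxn N J)); rewrite ler_pM2l//.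
rewrite [leRHS]big_mkcond/= [leRHS](@big_cat_nat _ _ _ J 1 (maxn N J))//= ?leq_maxr//.
apply: (@le_trans _ _ (\sum_(J <= j < maxn N J) if lam < j%:R then coef phi f j ^+ 2 else 0)).
  rewrite /T !big_nat; apply: ler_sum => j /andP[Jj _].
  by rewrite (lt_le_trans lJ)// ler_nat.
by rewrite lerDr; apply: sumr_ge0 => j _; case: ifP => // _; exact: sqr_ge0.
Qed.

End Besov.

(** * Energy of order one versus a Besov component of order n^(-r) *)

Section Characterization.
Variables (R : realType) (sigma r : R) (phi : nat -> R -> R) (kap : nat -> nat -> R).
Hypotheses (sigma0 : 0 < sigma) (r0 : 0 < r) (r12 : r < 1 / 2) (B : ONB phi)
  (kap0 : forall n j, 0 <= kap n j)
  (a1 : A1 kap) (a2 : A2 sigma kap) (a3 : A3 r kap) (a4 : A4 kap) (a5 : A5 kap).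
Variables (f : nat -> R -> R) (C : R).
Hypotheses (Lf : forall n, L2 (f n)) (C0 : 0 < C)
  (fC : forall n, (1 <= n)%N -> ip (f n) (f n) <= C / n%:R `^ (2 * r)).

Local Notation th n := (coef phi (f n)).
Local Notation E n := (n%:R ^+ 2 * energy kap n (th n)).
Local Notation S n J := (\sum_(1 <= j < J) th n j ^+ 2).
Local Notation x_ n := (n%:R `^ (2 * r) : R).
Let s := r / (2 - 4 * r).

Let p0 : 0 < 2 - 4 * r.
Proof. by have : 2 * r < 1; [rewrite mulrC -ltr_pdivlMr|lra]. Qed.

Let s0 : 0 < s.
Proof. exact: divr_gt0. Qed.

Let S_le n J : S n J <= ip (f n) (f n).
Proof. exact: bessel. Qed.

Let x_gt0 n : (1 <= n)%N -> 0 < x_ n.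
Proof. by move=> n1; rewrite powR_gt0// ltr0n. Qed.

Let energy_lim n : (1 <= n)%N ->
  (\sum_(1 <= j < N) kap n j * th n j ^+ 2) @[N --> \oo] --> energy kap n (th n).
Proof. by move=> n1; apply: (energy_cvg kap0 a1 n1) => N; exact: S_le. Qed.

Let energy_ge n J : (1 <= n)%N -> kap n J * S n J <= energy kap n (th n).
Proof.
move=> n1; apply: (cvgr_to_ge (energy_lim n1)); near=> N.
have JN : (J <= N)%N by near: N; exact: nbhs_infty_ge.
have [J1|J1] := leqP J 1.
  rewrite big_geq// mulr0; apply: sumr_ge0 => j _.
  by rewrite mulr_ge0// sqr_ge0.
rewrite [leRHS](@big_cat_nat _ _ _ J)//=; last exact: ltnW.
rewrite -[leLHS]addr0; apply: lerD; last by apply: sumr_ge0 => j _; rewrite mulr_ge0// sqr_ge0.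
rewrite mulr_sumr !big_nat; apply: ler_sum => j /andP[j1 jJ].
apply: ler_wpM2r; first exact: sqr_ge0.
by apply: (kap_nonincreasing a1) => //; exact: ltnW.
Unshelve. all: by end_near. Qed.

Let energy_le n J : (1 <= n)%N -> (1 <= J)%N ->
  energy kap n (th n) <= kap n 1%N * S n J + kap n J * ip (f n) (f n).
Proof.
move=> n1 J1; apply: (cvgr_to_le (energy_lim n1)); near=> N.
have JN : (J <= N)%N by near: N; exact: nbhs_infty_ge.
rewrite (@big_cat_nat _ _ _ J)//=; apply: lerD.
  rewrite mulr_sumr !big_nat; apply: ler_sum => j /andP[j1 _].
  by apply: ler_wpM2r; [exact: sqr_ge0|exact: (kap_nonincreasing a1)].
apply: (@le_trans _ _ (kap n J * \sum_(J <= j < N) th n j ^+ 2)).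
  rewrite mulr_sumr !big_nat; apply: ler_sum => j /andP[Jj _].
  by apply: ler_wpM2r; [exact: sqr_ge0|exact: (kap_nonincreasing a1)].
apply: ler_wpM2l => //; apply: le_trans (S_le n N).
rewrite [leRHS](@big_cat_nat _ _ _ J)//= lerDr.
by apply: sumr_ge0 => j _; exact: sqr_ge0.
Unshelve. all: by end_near. Qed.

(** By [A4] the coefficients beyond (1 + dl) k_n contribute at most q2 C1 C/(1 + dl) to the scaled
    energy. The choice of [dl] makes this at most a0/2, and the other half must come from the first
    coefficients. *)
Lemma energy_captured (a0 : R) : 0 < a0 -> exists D m : R, [/\ 0 < D, 0 < m &
  forall n, (1 <= n)%N -> a0 <= E n ->
    exists2 J, J%:R <= D * n%:R `^ (2 - 4 * r) & m <= x_ n * S n J].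
Proof.
move=> a00.
have [b [q1 [q2 [q3 [q4 [[b0 q10 q20 q30 q40] H]]]]]] :=
  weights_asymptotics sigma0 kap0 a1 a2 a3 a5.
have [C1 [lam [C10 [lam1 H4]]]] := a4.
pose dl := 2 * q2 * C1 * C / a0.
have dl0 : 0 < dl by rewrite divr_gt0// !mulr_gt0.
exists ((1 + dl) * q3), (a0 / (2 * q2 * b)).
split; [by rewrite mulr_gt0// addr_gt0|by rewrite divr_gt0// !mulr_gt0|move=> n n1 aE].
have n0 : 0 < n%:R :> R by rewrite ltr0n.
have x0 := x_gt0 n1.
have [h1 _ h3 h4 _] := H n n1.
set k := kn kap n in h4.
have k1 : (1 <= k)%N by exact: (kn_ge1 kap0 a3).
have dk0 : 0 <= (1 + dl) * k%:R by rewrite mulr_ge0// addr_ge0// ltW.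
pose J := Num.truncn ((1 + dl) * k%:R).
have /andP[J1 J2] := truncn_itv dk0.
have J0 : (1 <= J)%N.
  by rewrite /J truncn_gt0 mulrDl mul1r (@le_trans _ _ k%:R)// ?ler1n// lerDl mulr_ge0// ltW.
exists J.
  apply: le_trans J1 _; rewrite -mulrA ler_pM2l; last by rewrite addr_gt0.
  rewrite -(ler_pM2r (exprn_gt0 2 x0)) -mulrA (powR_dimension r n1).
  exact: h4.
have kJ := H4 dl n dl0 n1; rewrite -/k -/J in kJ.
have kapn0 : 0 <= kapn kap n by exact: kap0.
have kJ2 : kap n J <= C1 * (1 + dl)^-1 * kapn kap n.
  apply: le_trans (ltW kJ) _; apply: ler_wpM2r => //; apply: ler_wpM2l; first exact: ltW.
  rewrite -powR_inv1 ?addr_ge0// ?(ltW dl0)//; apply: ler_powR; last by rewrite lerN2 ltW.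
  by rewrite lerDl ltW.
have e1 := energy_le n1 J0.
have Sn0 : 0 <= S n J by apply: sumr_ge0 => j _; exact: sqr_ge0.
have e2 : energy kap n (th n) <=
    kapn kap n * (b * S n J + C1 * (1 + dl)^-1 * (C / x_ n)).
  apply: le_trans e1 _; rewrite mulrDr; apply: lerD.
    by rewrite mulrA (mulrC _ b) ler_wpM2r.
  apply: (@le_trans _ _ (C1 * (1 + dl)^-1 * kapn kap n * (C / x_ n))).
    by apply: ler_pM => //; [exact: ip_ge0|exact: fC].
  by rewrite le_eqVlt; apply/orP; left; apply/eqP; ring.
have id0 : 0 <= (1 + dl)^-1 by rewrite invr_ge0 addr_ge0// ltW.
have Z0 : 0 <= b * S n J + C1 * (1 + dl)^-1 * (C / x_ n).
  by rewrite addr_ge0 ?mulr_ge0// ?(ltW b0) ?(ltW C10)// ?(ltW C0)// invr_ge0 ltW.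
have e3 : a0 <= q2 * x_ n * (b * S n J + C1 * (1 + dl)^-1 * (C / x_ n)).
  apply: le_trans aE _; apply: (@le_trans _ _ (n%:R ^+ 2 *
    (kapn kap n * (b * S n J + C1 * (1 + dl)^-1 * (C / x_ n))))).
    by apply: ler_wpM2l => //; exact: sqr_ge0.
  by rewrite mulrA; apply: ler_wpM2r.
have e4 : q2 * x_ n * (b * S n J + C1 * (1 + dl)^-1 * (C / x_ n)) =
    q2 * b * (x_ n * S n J) + q2 * C1 * C * (1 + dl)^-1.
  by field; rewrite !gt_eqF// addr_gt0.
have e5 : q2 * C1 * C * (1 + dl)^-1 <= a0 / 2.
  rewrite ler_pdivrMr ?addr_gt0// mulrDr mulr1.
  have -> : a0 / 2 * dl = q2 * C1 * C by rewrite /dl; field; rewrite gt_eqF.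
  by rewrite lerDr divr_ge0// ltW.
rewrite ler_pdivrMr ?mulr_gt0//.
by move: e3; rewrite e4; move: e5; set u := _ * (1 + dl)^-1; lra.
Qed.

(** For large n the truncation index comes from [energy_captured]. For the finitely many others
    completeness of the basis provides a nonzero coefficient, truncation occurs just after it, and
    the constants are adjusted. *)
Lemma energy_to_besov (a0 : R) : 0 < a0 -> (\forall n \near \oo, a0 <= E n) ->
  (forall n, (1 <= n)%N -> 0 < ip (f n) (f n)) ->
  exists P0 m : R, [/\ 0 < P0, 0 < m & exists J : nat -> nat, forall n, (1 <= n)%N ->
    (J n)%:R `^ (2 * s) * ip (f n) (f n) <= P0 /\ m <= x_ n * S n (J n)].
Proof.
move=> a00 [N _ HN] f0; have [D [m [D0 m0 HD]]] := energy_captured a00.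
have /choice[J HJ] : forall n, exists J, (1 <= n)%N -> 0 < S n J /\
    ((N <= n)%N -> J%:R <= D * n%:R `^ (2 - 4 * r) /\ m <= x_ n * S n J).
  move=> n; have [n1|n1] := leqP 1 n; last first.
    by exists 0%N.
  have [Nn|Nn] := leqP N n.
    have [J J1 J2] := HD n n1 (HN n Nn); exists J => _; split => //.
    by have := lt_le_trans m0 J2; rewrite pmulr_rgt0// x_gt0.
  have [j j1 fj] : exists2 j, (1 <= j)%N & th n j != 0.
    apply: contrapT => H; have := f0 n n1.
    have z j : (1 <= j)%N -> ip (f n) (phi j) = 0.
      by move=> j1; apply/eqP/negPn/negP => h; apply: H; exists j.
    have ng : (@lebesgue_measure R).-negligible (@I01 R `&` [set x | f n x != 0]).
      by case: B => _ [_ +]; apply.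
    rewrite (ae_eq_ip (Lf n) (L2_cst 0) ng).
    have -> : ip (fun=> 0 : R) (fun=> 0 : R) = 0 by rewrite /ip /Rintegral mulr0 integral0.
    by rewrite ltxx.
  exists j.+1 => _; split => //; rewrite big_nat_recr//= ltr_wpDl//.
    by apply: sumr_ge0 => i _; exact: sqr_ge0.
  by rewrite exprn_even_gt0.
have [m' m'0 Hm'] := @uniform_lower_bound _ (fun n => x_ n * S n (J n)) N m m0
  (fun n n1 => mulr_gt0 (x_gt0 n1) (HJ n n1).1) (fun n n1 Nn => ((HJ n n1).2 Nn).2).
have up n : (1 <= n)%N -> (N <= n)%N ->
    (J n)%:R `^ (2 * s) * ip (f n) (f n) <= D `^ (2 * s) * C.
  move=> n1 Nn; have [JD _] := (HJ n n1).2 Nn.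
  have JD2 : (J n)%:R `^ (2 * s) <= D `^ (2 * s) * x_ n.
    rewrite -(besov_exponent r12) -/s -powRM ?powR_ge0 ?(ltW D0)//.
    apply: ge0_ler_powR => //; first by rewrite mulr_ge0// ltW.
      by rewrite nnegrE.
    by rewrite nnegrE mulr_ge0 ?powR_ge0// ltW.
  apply: le_trans (ler_pM _ _ JD2 (fC n1)) _; [exact: powR_ge0|exact: ip_ge0|].
  by rewrite le_eqVlt; apply/orP; left; apply/eqP; field; rewrite gt_eqF// x_gt0.
have DC0 : 0 < D `^ (2 * s) * C by rewrite mulr_gt0// powR_gt0.
have [P0 P00 HP0] := @uniform_upper_bound _ (fun n => (J n)%:R `^ (2 * s) * ip (f n) (f n)) N
  _ DC0 up.
by exists P0, m'; split => //; exists J => n n1; split; [exact: HP0|exact: Hm'].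
Qed.

(** At a frequency J of order k_n, f1 is close to its truncation g, so the inner product of f with g
    is still of order n^(-2r). As g only sees the first coefficients of f, Cauchy-Schwarz bounds
    their sum of squares from below, and [A5] keeps the weight at J comparable to [kapn]. *)
Lemma besov_to_energy (P0 c1 C1 : R) (f1 : nat -> R -> R) : 0 < P0 -> 0 < c1 -> 0 < C1 ->
  (forall n, L2 (f1 n)) ->
  (forall n, (1 <= n)%N -> [/\ besov_ball phi s P0 (f1 n), c1 / x_ n <= ip (f1 n) (f1 n),
     ip (f1 n) (f1 n) <= C1 / x_ n & ip (f n) (f1 n) = ip (f1 n) (f1 n)]) ->
  exists2 a0 : R, 0 < a0 & forall n, (1 <= n)%N -> a0 <= E n.
Proof.
move=> P00 c10 C10 Lf1 H1.
have [b [q1 [q2 [q3 [q4 [[b0 q10 q20 q30 q40] H]]]]]] :=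
  weights_asymptotics sigma0 kap0 a1 a2 a3 a5.
(* Makes the product of the squared norms of f and f1 - g at most (c1/(2 x_n))^2, so half of the
   inner product survives the truncation. *)
pose T := 4 * C * P0 / c1 ^+ 2.
have T0 : 0 < T by rewrite divr_gt0 ?exprn_gt0// !mulr_gt0.
(* With lam = (D - 1) k_n and k_n >= q4 n^(2-4r) this gives lam^(2s) >= T x_n. The extra 1 absorbs
   the rounding in J, as k_n >= 1. *)
pose D := 1 + T `^ (2 * s)^-1 / q4.
have s20 : 0 < 2 * s by rewrite mulr_gt0.
have Tp : 0 < T `^ (2 * s)^-1 by rewrite powR_gt0.
have D1 : 1 < D by rewrite ltrDl divr_gt0.
have [_ /(_ D D1)[C5 [C50 H5]]] := a5.
exists (C5 * q1 * (c1 ^+ 2 / (4 * C1))).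
  by rewrite !mulr_gt0// ?invr_gt0 ?exprn_gt0// mulr_gt0.
move=> n n1.
have x0 := x_gt0 n1.
have [hb hc hC ho] := H1 n n1.
have [_ h2 _ _ h5] := H n n1.
have kJ := H5 n n1.
set k := kn kap n in h5 kJ.
have k1 : 1 <= k%:R :> R by rewrite ler1n; exact: (kn_ge1 kap0 a3).
have Dk0 : 0 <= D * k%:R by rewrite mulr_ge0// (le_trans ler01)// ltW.
set J := Num.truncn (D * k%:R) in kJ.
have /andP[_ J2] := truncn_itv Dk0; rewrite -/J in J2.
pose lam := (D - 1) * k%:R.
have lam0 : 0 < lam by rewrite mulr_gt0 ?subr_gt0// (lt_le_trans ltr01).
have lamJ : lam < J%:R.
  by move: J2; rewrite -natr1 /lam mulrBl mul1r; lra.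
have lamT : T * x_ n <= lam `^ (2 * s).
  have -> : T * x_ n = (T `^ (2 * s)^-1 * n%:R `^ (2 - 4 * r)) `^ (2 * s).
    rewrite powRM ?powR_ge0// -powRrM mulVf ?gt_eqF// powRr1 ?(ltW T0)//.
    by rewrite besov_exponent.
  apply: ge0_ler_powR; [exact: ltW|by rewrite nnegrE mulr_ge0 ?powR_ge0|by rewrite nnegrE ltW|].
  have -> : lam = T `^ (2 * s)^-1 * (q4^-1 * k%:R) by rewrite /lam /D; ring.
  rewrite ler_pM2l// ler_pdivlMl//.
  rewrite -(ler_pM2r (exprn_gt0 2 x0)) -mulrA (powR_dimension r n1).
  exact: h5.
have tail := besov_tail B (Lf1 n) hb lam0 lamJ.
set t1 := coef phi (f1 n) in tail.
set rs := ip (f1 n) (f1 n) - _ in tail.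
pose g := psum phi t1 J.
have Lg : L2 g by exact: L2_psum.
have rsE : ip (fun z => f1 n z - g z) (fun z => f1 n z - g z) = rs by exact: residual_norm.
have rs0 : 0 <= rs by rewrite -rsE ip_ge0.
have rsT : T * x_ n * rs <= P0 by apply: le_trans tail; exact: ler_wpM2r.
have cs := ip_cauchy_schwarz (Lf n) (L2B (Lf1 n) Lg).
rewrite rsE in cs.
have ipg : ip (f n) (fun z => f1 n z - g z) = ip (f1 n) (f1 n) - ip (f n) g.
  by rewrite ipC (ipBl (Lf1 n) Lg (Lf n)) !(ipC _ (f n)) ho.
rewrite ipg in cs.
have small : (ip (f1 n) (f1 n) - ip (f n) g) ^+ 2 <= (c1 / x_ n / 2) ^+ 2.
  apply: le_trans cs _.
  apply: (@le_trans _ _ (C / x_ n * (P0 / (T * x_ n)))).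
    apply: ler_pM; [exact: ip_ge0|exact: rs0|exact: fC|].
    have Tx0 : 0 < T * x_ n by apply: mulr_gt0.
    by rewrite ler_pdivlMr// mulrC.
  rewrite le_eqVlt; apply/orP; left; apply/eqP; rewrite /T; field.
  by rewrite !gt_eqF.
have y0 : 0 < c1 / x_ n by rewrite divr_gt0.
have y20 : 0 < c1 / x_ n / 2 by exact: divr_gt0.
have big : c1 / x_ n / 2 <= ip (f n) g.
  have : `|ip (f1 n) (f1 n) - ip (f n) g| <= c1 / x_ n / 2.
    rewrite -(@ler_pXn2r _ 2)// ?nnegrE ?(ltW y20)//.
    by rewrite real_normK ?num_real.
  rewrite ler_norml => /andP[_]; lra.
pose h := psum phi (th n) J.
have Lh : L2 h by exact: L2_psum.
have gh : ip (f n) g = ip g h.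
  rewrite ipC !(ip_psum B)//; apply: eq_big_nat => j /andP[j1 jJ].
  by rewrite coef_psum// jJ.
have cs2 := ip_cauchy_schwarz Lg Lh.
rewrite -gh (ip_psum_psum B _ (leqnn J)) (ip_psum_psum B _ (leqnn J)) in cs2.
have gg : \sum_(1 <= j < J) t1 j ^+ 2 <= C1 / x_ n.
  by apply: le_trans hC; exact: bessel.
have Sn0 : 0 <= S n J by apply: sumr_ge0 => j _; exact: sqr_ge0.
have big2 : (c1 / x_ n / 2) ^+ 2 <= C1 / x_ n * S n J.
  apply: (@le_trans _ _ (ip (f n) g ^+ 2)).
    apply: lerXn2r; [by rewrite nnegrE ltW|by rewrite nnegrE ltW// (lt_le_trans y20)|exact: big].
  by apply: le_trans cs2 _; exact: ler_wpM2r.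
have xS : c1 ^+ 2 / (4 * C1) <= x_ n * S n J.
  rewrite ler_pdivrMr ?mulr_gt0//.
  have := ler_wpM2l (_ : 0 <= 4 * x_ n ^+ 2) big2.
  have -> : 4 * x_ n ^+ 2 * (c1 / x_ n / 2) ^+ 2 = c1 ^+ 2 by field; rewrite gt_eqF.
  have -> : 4 * x_ n ^+ 2 * (C1 / x_ n * S n J) = x_ n * S n J * (4 * C1).
    by field; rewrite gt_eqF.
  by apply; rewrite mulr_ge0// sqr_ge0.
apply: (@le_trans _ _ (n%:R ^+ 2 * (kap n J * S n J))); last first.
  by apply: ler_wpM2l; [exact: sqr_ge0|exact: energy_ge].
apply: (@le_trans _ _ (C5 * (n%:R ^+ 2 * kapn kap n) * S n J)); last first.
  rewrite [leLHS](_ : _ = n%:R ^+ 2 * (C5 * kapn kap n * S n J)); last by ring.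
  by apply: ler_wpM2l; [exact: sqr_ge0|exact: ler_wpM2r].
apply: (@le_trans _ _ (C5 * (q1 * x_ n) * S n J)); last first.
  by apply: ler_wpM2r => //; rewrite ler_pM2l.
rewrite [leRHS](_ : _ = C5 * q1 * (x_ n * S n J)); last by ring.
by rewrite ler_pM2l// mulr_gt0.
Qed.

End Characterization.

Theorem theorem7 (R : realType) (d : measure_display) (Omega : measurableType d)
  (P : probability Omega R) (xi : nat -> Omega -> R)
  (sigma r : R) (phi : nat -> R -> R) (kap : nat -> nat -> R) :
  iid_std_normal P xi ->
  0 < sigma -> 0 < r -> r < 1 / 2 ->
  ONB phi ->
  (forall n j, 0 <= kap n j) ->
  A1 kap -> A2 sigma kap -> A3 r kap -> A4 kap -> A5 kap ->
  let s := r / (2 - 4 * r) in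
  forall f : nat -> R -> R,
  (forall n, L2 (f n)) ->
  (exists c C : R, 0 < c /\ c < C /\ forall n, (1 <= n)%N ->
      c * n%:R `^ (- r) <= L2norm (f n) /\ L2norm (f n) <= C * n%:R `^ (- r)) ->
  (consistent P xi sigma kap phi f <->
   exists P0 : R, 0 < P0 /\
   exists c1 C1 : R, 0 < c1 /\ c1 <= C1 /\
   exists f1 : nat -> R -> R,
     (forall n, L2 (f1 n)) /\
     forall n, (1 <= n)%N ->
       besov_ball phi s P0 (f1 n) /\
       c1 * n%:R `^ (- r) <= L2norm (f1 n) /\ L2norm (f1 n) <= C1 * n%:R `^ (- r) /\
       L2norm (f n) ^+ 2 = L2norm (f1 n) ^+ 2 + L2norm (f n \- f1 n) ^+ 2).
Proof.
move=> Hxi sigma0 r0 r12 B kap0 a1 a2 a3 a4 a5 s f Lf [c [C [c0 [cC Hf]]]].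
have C0 : 0 < C by exact: lt_trans cC.
have nr_ge0 n : 0 <= n%:R `^ (- r) :> R by exact: powR_ge0.
have norm_ge0 (g : R -> R) : 0 <= L2norm g by exact: sqrtr_ge0.
have fC n : (1 <= n)%N -> ip (f n) (f n) <= C ^+ 2 / n%:R `^ (2 * r).
  move=> n1; have [_ H] := Hf n n1.
  by rewrite -sqr_L2norm -sqr_powRN -exprMn lerXn2r ?nnegrE// mulr_ge0// ltW.
have fc n : (1 <= n)%N -> 0 < ip (f n) (f n).
  move=> n1; have [H _] := Hf n n1; rewrite -sqr_L2norm exprn_gt0//.
  by apply: lt_le_trans H; rewrite mulr_gt0// powR_gt0// ltr0n.
have C20 : 0 < C ^+ 2 by rewrite exprn_gt0.
have thC n N : (1 <= n)%N ->
    \sum_(1 <= j < N) coef phi (f n) j ^+ 2 <= C ^+ 2 / n%:R `^ (2 * r).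
  by move=> n1; apply: le_trans (fC n n1); exact: bessel.
rewrite /consistent (consistent_iff_energy Hxi sigma0 r12 kap0 a1 a2 a3 a5 C20 thC).
split=> [[a0 a00 Ha]|[P0 [P00 [c1 [C1 [c10 [cC1 [f1 [Lf1 H1]]]]]]]]]; last first.
  have C10 : 0 < C1 by exact: lt_le_trans cC1.
  have H2 n : (1 <= n)%N -> [/\ besov_ball phi s P0 (f1 n),
      c1 ^+ 2 / n%:R `^ (2 * r) <= ip (f1 n) (f1 n),
      ip (f1 n) (f1 n) <= C1 ^+ 2 / n%:R `^ (2 * r) &
      ip (f n) (f1 n) = ip (f1 n) (f1 n)].
    move=> n1; have [hb [h1 [h2 h3]]] := H1 n n1.
    split => //.
    - by rewrite -sqr_L2norm -sqr_powRN -exprMn lerXn2r ?nnegrE// mulr_ge0// ltW.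
    - by rewrite -sqr_L2norm -sqr_powRN -exprMn lerXn2r ?nnegrE// mulr_ge0// ltW.
    (* Expanding the last norm, the Pythagorean identity says precisely that f - f1 is orthogonal to
       f1. *)
    - move: h3; rewrite !sqr_L2norm.
      have -> : ip (f n \- f1 n) (f n \- f1 n) =
        ip (f n) (f n) - 2 * ip (f n) (f1 n) + ip (f1 n) (f1 n) by exact: ipBB.
      by lra.
  have [a0 a00 Ha] := besov_to_energy sigma0 r0 r12 B kap0 a1 a2 a3 a5 Lf C20 fC
    P00 (exprn_gt0 2 c10) (exprn_gt0 2 C10) Lf1 H2.
  by exists a0 => //; exists 1%N => // n; exact: Ha.
have [P0 [m [P00 m0 [J HJ]]]] := energy_to_besov sigma0 r0 r12 B kap0 a1 a2 a3 a4 a5 Lf C20 fC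
  a00 Ha fc.
have q0 : 0 < 2 - 4 * r by have : 2 * r < 1; [rewrite mulrC -ltr_pdivlMr|lra].
have s0 : 0 <= s by rewrite divr_ge0// ltW.
have sm0 : 0 < Num.sqrt m by rewrite sqrtr_gt0.
(* The upper constant C would do for the norm; adding sqrt m secures the required order of the two
   constants. *)
exists P0; split => //; exists (Num.sqrt m), (C + Num.sqrt m).
split=> //; split; first by rewrite lerDr ltW.
exists (fun n => psum phi (coef phi (f n)) (J n)); split=> [n|n n1]; first exact: L2_psum.
have [h1 h2] := HJ n n1.
have x0 : 0 < n%:R `^ (2 * r) :> R by rewrite powR_gt0// ltr0n.
have nE : L2norm (psum phi (coef phi (f n)) (J n)) ^+ 2 =
    \sum_(1 <= j < J n) coef phi (f n) j ^+ 2 by rewrite sqr_L2norm (ip_psum_psum B).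
split; first by apply: (besov_truncation B (Lf n)) => //; exact: ltW.
split.
  rewrite -(@ler_pXn2r _ 2)// ?nnegrE// ?mulr_ge0 ?sqrtr_ge0//.
  by rewrite nE exprMn sqr_sqrtr ?(ltW m0)// sqr_powRN ler_pdivrMr// mulrC.
split.
  apply: (@le_trans _ _ (C * n%:R `^ (- r))); last by rewrite ler_wpM2r// lerDl ltW.
  rewrite -(@ler_pXn2r _ 2)// ?nnegrE// ?mulr_ge0 ?(ltW C0)//.
  by rewrite nE exprMn sqr_powRN; exact: thC.
rewrite nE !sqr_L2norm.
have -> : ip (f n \- psum phi (coef phi (f n)) (J n)) (f n \- psum phi (coef phi (f n)) (J n)) =
  ip (f n) (f n) - \sum_(1 <= j < J n) coef phi (f n) j ^+ 2 by exact: residual_norm.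
by ring.
Qed.
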